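(* Let $R$ be an associative unital ring. The following conditions are equivalent. (i) $R$ is von Neumann regular. (ii) Every acyclic $R$-complex is pure-acyclic. (iii) Every $R$-complex is semi-flat. (iv) Every complex of pure-projective $R$-modules is semi-projective. (v) Every complex of pure-injective $R$-modules is semi-injective.
   Context: $R$-modules are left modules; right $R$-modules are modules over the opposite ring $R^\circ$. An $R$-complex is a (possibly unbounded) chain complex $M$ of $R$-modules, indexed homologically; $Z_i(M)=\operatorname{Ker}(\partial_i^M)$. $\operatorname{Hom}_R(L,M)$ is the total Hom complex and $N\otimes_R M$ the total tensor product complex (for an $R^\circ$-complex $N$). A complex is acyclic if its homology vanishes. An exact sequence $0\to L\to M\to N\to 0$ of $R$-modules is pure if $0\to \operatorname{Hom}_R(A,L)\to\operatorname{Hom}_R(A,M)\to\operatorname{Hom}_R(A,N)\to 0$ is exact for every finitely presented $R$-module $A$. An $R$-module $P$ is pure-projective if $\operatorname{Hom}_R(P,-)$ is exact on every pure exact sequence of $R$-modules; an $R$-module $E$ is pure-injective if $\operatorname{Hom}_R(-,E)$ is exact on every pure exact sequence of $R$-modules. An $R$-complex $M$ is pure-acyclic if it is acyclic and $0\to Z_i(M)\to M_i\to Z_{i-1}(M)\to 0$ is pure for every $i\in\mathbb{Z}$. An $R$-complex $F$ is semi-flat if every $F_i$ is flat and $-\otimes_R F$ preserves acyclicity (of $R^\circ$-complexes). An $R$-complex $P$ is semi-projective if every $P_i$ is projective and $\operatorname{Hom}_R(P,-)$ preserves acyclicity. An $R$-complex $I$ is semi-injective if every $I_i$ is injective and $\operatorname{Hom}_R(-,I)$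 preserves acyclicity. *)

(* Defs.v *)
From HB Require Import structures.
From mathcomp Require Import all_boot all_order all_algebra.
From mathcomp Require Import generic_quotient ring_quotient.
From mathcomp Require Import boolp zify.
From mathcomp.multinomials Require Import freeg.

Set Implicit Arguments.
Unset Strict Implicit.
Unset Printing Implicit Defensive.

Import GRing.Theory.

Local Open Scope ring_scope.
Local Open Scope quotient_scope.

(* Left modules over an arbitrary (possibly zero, possibly noncommutative)    *)
(* ring are [lmodType R] with [R : pzRingType]; right modules are             *)
(* [lmodType R^c].  Classical choice makes the decidable equality and choice  *)
(* operator carried by an [lmodType] harmless: every type has them.           *)

Definition von_neumann_regular (R : pzRingType) : Prop :=
  forall a : R, exists x : R, a = a * x * a.

(* 0 -> A -> B -> C -> 0 *)
Definition short_exact (A B C : zmodType) (f : A -> B) (g : B -> C) : Prop :=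
  [/\ injective f,
      forall y, g y = 0 <-> exists x, f x = y
    & forall z, exists y, g y = z].

Section HomGroup.
Variables (R : pzRingType) (U V : lmodType R).
Implicit Types f g h : {linear U -> V}.

Lemma linear_ext f g : f =1 g -> f = g.
Proof.
case: f g => [f [[mf] [af]]] [g [[mg] [ag]]] /= /funext fg.
by subst g; congr (GRing.Linear.Pack (GRing.Linear.Class _ _));
  congr (_ _); apply: Prop_irrelevance.
Qed.

HB.instance Definition _ := gen_eqMixin {linear U -> V}.
HB.instance Definition _ := gen_choiceMixin {linear U -> V}.

Definition lin0 : {linear U -> V} := \0.
Definition linD f g : {linear U -> V} := f \+ g.
Definition linN f : {linear U -> V} := \- f.

Lemma linDA : associative linD.
Proof. by move=> f g h; apply: linear_ext => x /=; rewrite addrA. Qed.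
Lemma linDC : commutative linD.
Proof. by move=> f g; apply: linear_ext => x /=; rewrite addrC. Qed.
Lemma lin0D : left_id lin0 linD.
Proof. by move=> f; apply: linear_ext => x /=; rewrite add0r. Qed.
Lemma linND : left_inverse lin0 linN linD.
Proof. by move=> f; apply: linear_ext => x /=; rewrite addNr. Qed.

HB.instance Definition _ :=
  GRing.isZmodule.Build {linear U -> V} linDA linDC lin0D linND.

Lemma lin0E x : (0 : {linear U -> V}) x = 0. Proof. by []. Qed.
Lemma linDE f g x : (f + g) x = f x + g x. Proof. by []. Qed.
Lemma linBE f g x : (f - g) x = f x - g x. Proof. by []. Qed.
Lemma linMzE f (m : int) x : (f *~ m) x = f x *~ m.
Proof.
have linMnE n : (f *+ n) x = f x *+ n.
  by elim: n => // n IHn; rewrite !mulrS linDE IHn.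
by case: m => n; rewrite -?pmulrn ?NegzE -?nmulrn // -linMnE.
Qed.
End HomGroup.

Section ModuleNotions.
Variable R : pzRingType.

Definition hom_post (A L M : lmodType R) (f : {linear L -> M})
  (h : {linear A -> L}) : {linear A -> M} := f \o h.

Definition hom_pre (E L M : lmodType R) (f : {linear L -> M})
  (h : {linear M -> E}) : {linear L -> E} := h \o f.

(* R^m -> R^n -> A -> 0 *)
Definition finitely_presented (A : lmodType R) : Prop :=
  exists (m n : nat) (r : {linear 'rV[R]_m -> 'rV[R]_n})
         (p : {linear 'rV[R]_n -> A}),
    (forall a, exists y, p y = a) /\
    (forall y, p y = 0 <-> exists x, r x = y).

Definition pure_exact (L M N : lmodType R)
    (f : {linear L -> M}) (g : {linear M -> N}) : Prop :=
  short_exact f g /\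
  forall A : lmodType R, finitely_presented A ->
    short_exact (hom_post (A := A) f) (hom_post (A := A) g).

Definition projective (P : lmodType R) : Prop :=
  forall (L M N : lmodType R) (f : {linear L -> M}) (g : {linear M -> N}),
    short_exact f g -> short_exact (hom_post (A := P) f) (hom_post (A := P) g).

Definition injective_module (E : lmodType R) : Prop :=
  forall (L M N : lmodType R) (f : {linear L -> M}) (g : {linear M -> N}),
    short_exact f g -> short_exact (hom_pre (E := E) g) (hom_pre (E := E) f).

Definition pure_projective (P : lmodType R) : Prop :=
  forall (L M N : lmodType R) (f : {linear L -> M}) (g : {linear M -> N}),
    pure_exact f g -> short_exact (hom_post (A := P) f) (hom_post (A := P) g).

Definition pure_injective (E : lmodType R) : Prop :=
  forall (L M N : lmodType R) (f : {linear L -> M}) (g : {linear M -> N}),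
    pure_exact f g -> short_exact (hom_pre (E := E) g) (hom_pre (E := E) f).

End ModuleNotions.

Section Kernel.
Variables (R : pzRingType) (U V : lmodType R) (f : {linear U -> V}).

Definition ker_pred : {pred U} := fun x => f x == 0.

Lemma ker_submod_closed : submod_closed ker_pred.
Proof.
split; rewrite ?unfold_in /ker_pred ?raddf0 //.
move=> a x y; rewrite !unfold_in /ker_pred linearP => /eqP -> /eqP ->.
by rewrite scaler0 addr0.
Qed.

HB.instance Definition _ :=
  GRing.isSubmodClosed.Build R U ker_pred ker_submod_closed.

Record ker : Type := Ker { ker_val : U; ker_valP : ker_val \in ker_pred }.

HB.instance Definition _ := [isSub for ker_val].
HB.instance Definition _ := [Choice of ker by <:].
HB.instance Definition _ := [SubChoice_isSubLmodule of ker by <:].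

Definition ker_incl : {linear ker -> U} := val.

Section Corestriction.
Variables (W : lmodType R) (g : {linear W -> U}) (fg0 : forall w, f (g w) = 0).

Definition corestr_fun (w : W) : ker := Ker (introT eqP (fg0 w)).

Lemma corestr_is_linear : linear corestr_fun.
Proof. by move=> a x y; apply: val_inj; rewrite /= linearP. Qed.

HB.instance Definition _ :=
  GRing.isLinear.Build R W ker *:%R corestr_fun corestr_is_linear.

Definition corestr : {linear W -> ker} := corestr_fun.
End Corestriction.
End Kernel.

Section FreeLift.
Variables (K : choiceType) (A : zmodType) (h : K -> A).

Definition free_lift (D : {freeg K / int}) : A :=
  \sum_(k <- dom D) h k *~ coeff k D.

Lemma free_liftE (s : seq K) D : uniq s -> {subset dom D <= s} ->
  free_lift D = \sum_(k <- s) h k *~ coeff k D.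
Proof.
move=> us sub; rewrite /free_lift [RHS](bigID (mem (dom D))) /=.
rewrite [X in _ = _ + X]big1 ?addr0; last first.
  by move=> k /coeff_outdom ->; rewrite mulr0z.
rewrite -[RHS]big_filter; apply: perm_big; apply: uniq_perm.
- exact: uniq_dom.
- exact: filter_uniq.
by move=> k; rewrite mem_filter; case: (boolP (k \in dom D)) => // /sub ->.
Qed.

Lemma free_lift_is_zmod_morphism : zmod_morphism free_lift.
Proof.
move=> D1 D2; set s := undup (dom D1 ++ dom D2 ++ dom (D1 - D2)).
have us : uniq s by apply: undup_uniq.
rewrite !(@free_liftE s) ?us // ?/s.
- by rewrite -sumrB; apply: eq_bigr => k _; rewrite coeffB mulrzBr.
- by move=> k kD; rewrite mem_undup !mem_cat kD !orbT.
- by move=> k kD; rewrite mem_undup !mem_cat kD.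
- by move=> k kD; rewrite mem_undup !mem_cat kD !orbT.
Qed.

HB.instance Definition _ :=
  GRing.isZmodMorphism.Build {freeg K / int} A free_lift free_lift_is_zmod_morphism.

Lemma free_liftU k : free_lift << k >> = h k.
Proof. by rewrite /free_lift domU1 big_seq1 coeffU eqxx. Qed.
End FreeLift.

Section Tensor.
Variables (R : pzRingType) (N : lmodType R^c) (M : lmodType R).

(* The scaling [a *: x] of the right module [N] is the right action x a.      *)
Inductive tensor_relation : {freeg (N * M) / int} -> Prop :=
| TensorDl x x' y :
    tensor_relation (<< (x + x', y) >> - << (x, y) >> - << (x', y) >>)
| TensorDr x y y' :
    tensor_relation (<< (x, y + y') >> - << (x, y) >> - << (x, y') >>)
| TensorZ x (a : R) y :
    tensor_relation (<< ((a : R^c) *: x, y) >> - << (x, a *: y) >>).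

(* The subgroup of the free abelian group generated by the relations.         *)
Definition tensor_null : {pred {freeg (N * M) / int}} := fun z =>
  `[< forall S : zmodClosed {freeg (N * M) / int},
        (forall r, tensor_relation r -> r \in S) -> z \in S >].

Lemma tensor_null_zmod_closed : zmod_closed tensor_null.
Proof.
split=> [|x y]; rewrite ?unfold_in.
  by apply/asboolP => S _; apply: rpred0.
move=> /asboolP hx /asboolP hy; apply/asboolP => S hS.
by apply: rpredB; [apply: hx | apply: hy].
Qed.

HB.instance Definition _ := GRing.isZmodClosed.Build
  {freeg (N * M) / int} tensor_null tensor_null_zmod_closed.

Definition tensor : Type := Quotient.quot tensor_null.
HB.instance Definition _ := Choice.on tensor.
HB.instance Definition _ := EqQuotient.on tensor.
HB.instance Definition _ := GRing.Zmodule.on tensor.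
HB.instance Definition _ := ZmodQuotient.on tensor.

Definition ptensor (x : N) (y : M) : tensor := \pi_tensor << (x, y) >>.

Lemma ptensor_rel r : tensor_relation r -> \pi_tensor r = 0.
Proof.
move=> hr; rewrite -[0](raddf0 \pi_tensor).
apply/eqP; rewrite -Quotient.idealrBE subr0 unfold_in.
by apply/asboolP => S; apply.
Qed.

Lemma ptensorDl x x' y : ptensor (x + x') y = ptensor x y + ptensor x' y.
Proof.
apply/eqP; rewrite -subr_eq0 opprD addrA /ptensor -!raddfB /=.
by rewrite ptensor_rel //; exact: TensorDl.
Qed.

Lemma ptensorDr x y y' : ptensor x (y + y') = ptensor x y + ptensor x y'.
Proof.
apply/eqP; rewrite -subr_eq0 opprD addrA /ptensor -!raddfB /=.
by rewrite ptensor_rel //; exact: TensorDr.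
Qed.

Lemma ptensorZ x (a : R) y : ptensor ((a : R^c) *: x) y = ptensor x (a *: y).
Proof.
apply/eqP; rewrite -subr_eq0 /ptensor -!raddfB /=.
by rewrite ptensor_rel //; exact: TensorZ.
Qed.

Lemma ptensor0l y : ptensor 0 y = 0.
Proof. by apply: (@addrI _ (ptensor 0 y)); rewrite -ptensorDl !addr0. Qed.

Lemma ptensor0r x : ptensor x 0 = 0.
Proof. by apply: (@addrI _ (ptensor x 0)); rewrite -ptensorDr !addr0. Qed.

Lemma tensor_ext (A : zmodType) (h k : {additive tensor -> A}) :
  (forall x y, h (ptensor x y) = k (ptensor x y)) -> h =1 k.
Proof.
move=> hk t; rewrite -[t]reprK -[repr t]freeg_sumE !raddf_sum.
apply: eq_bigr => -[x y] _.
have -> : << coeff (x, y) (repr t) *g (x, y) >> =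
          << (x, y) >> *~ coeff (x, y) (repr t) :> {freeg (N * M) / int}.
  by rewrite freegU_mulz intz.
by rewrite !raddfMz; congr (_ *~ _); apply: hk.
Qed.

Section Lift.
Variables (A : zmodType) (b : N -> M -> A).
Hypothesis bDl : forall x x' y, b (x + x') y = b x y + b x' y.
Hypothesis bDr : forall x y y', b x (y + y') = b x y + b x y'.
Hypothesis bZ : forall x (a : R) y, b ((a : R^c) *: x) y = b x (a *: y).

Let lift0 := free_lift (fun k : N * M => b k.1 k.2).

Let lift0B u v : lift0 (u - v) = lift0 u - lift0 v.
Proof. exact: raddfB. Qed.

Let lift0U x y : lift0 << (x, y) >> = b x y.
Proof. exact: free_liftU. Qed.

Definition tensor_lift (t : tensor) : A := lift0 (repr t).

Let ker0 : {pred {freeg (N * M) / int}} := fun z => lift0 z == 0.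
Let ker0_closed : zmod_closed ker0.
Proof.
split=> [|x y]; rewrite ?unfold_in /ker0 /lift0 ?raddf0 //.
by move=> /eqP hx /eqP hy; rewrite raddfB /= hx hy subr0.
Qed.
HB.instance Definition _ := GRing.isZmodClosed.Build
  {freeg (N * M) / int} ker0 ker0_closed.

Lemma tensor_lift_pi z : tensor_lift (\pi_tensor z) = lift0 z.
Proof.
apply/eqP; rewrite -subr_eq0 /tensor_lift -raddfB.
have : repr (\pi_tensor z) - z \in tensor_null.
  by rewrite Quotient.idealrBE reprK.
rewrite unfold_in => /asboolP /(_ ker0); rewrite [_ \in ker0]unfold_in; apply.
move=> r; rewrite unfold_in /ker0.
case=> [x x' y|x y y'|x a y]; rewrite !lift0B !lift0U /=.
- by rewrite bDl -addrA -opprD subrr.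
- by rewrite bDr -addrA -opprD subrr.
- by rewrite bZ subrr.
Qed.

Lemma tensor_lift_is_zmod_morphism : zmod_morphism tensor_lift.
Proof.
move=> s t; rewrite -[s]reprK -[t]reprK -raddfB !tensor_lift_pi.
exact: raddfB.
Qed.

Lemma tensor_liftE x y : tensor_lift (ptensor x y) = b x y.
Proof. by rewrite tensor_lift_pi lift0U. Qed.
End Lift.
End Tensor.

Section TensorMap.
Variable R : pzRingType.

Definition tensor_map (N N' : lmodType R^c) (M M' : lmodType R)
    (f : {linear N -> N'}) (g : {linear M -> M'}) : tensor N M -> tensor N' M' :=
  tensor_lift (fun x y => ptensor (f x) (g y)).

Section Additive.
Variables (N N' : lmodType R^c) (M M' : lmodType R).
Variables (f : {linear N -> N'}) (g : {linear M -> M'}).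

Let mDl x x' y : ptensor (f (x + x')) (g y) =
  ptensor (f x) (g y) + ptensor (f x') (g y).
Proof. by rewrite raddfD ptensorDl. Qed.

Let mDr x y y' : ptensor (f x) (g (y + y')) =
  ptensor (f x) (g y) + ptensor (f x) (g y').
Proof. by rewrite raddfD ptensorDr. Qed.

Let mZ x (a : R) y : ptensor (f ((a : R^c) *: x)) (g y) =
  ptensor (f x) (g (a *: y)).
Proof. by rewrite !linearZ ptensorZ. Qed.

Lemma tensor_map_is_zmod_morphism : zmod_morphism (tensor_map f g).
Proof. exact: tensor_lift_is_zmod_morphism mDl mDr mZ. Qed.

HB.instance Definition _ := GRing.isZmodMorphism.Build
  (tensor N M) (tensor N' M') (tensor_map f g) tensor_map_is_zmod_morphism.

Lemma tensor_mapE x y : tensor_map f g (ptensor x y) = ptensor (f x) (g y).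
Proof. exact: tensor_liftE mDl mDr mZ x y. Qed.
End Additive.

Lemma tensor_map_comp (N N' N'' : lmodType R^c) (M M' M'' : lmodType R)
    (f : {linear N -> N'}) (f' : {linear N' -> N''})
    (g : {linear M -> M'}) (g' : {linear M' -> M''}) t :
  tensor_map f' g' (tensor_map f g t) = tensor_map (f' \o f) (g' \o g) t.
Proof.
apply: (@tensor_ext _ _ _ _ (tensor_map f' g' \o tensor_map f g)) => x y.
by rewrite /= !tensor_mapE.
Qed.

Lemma tensor_map_eq0 (N N' : lmodType R^c) (M M' : lmodType R)
    (f : {linear N -> N'}) (g : {linear M -> M'}) :
  (forall x, f x = 0) \/ (forall y, g y = 0) -> forall t, tensor_map f g t = 0.
Proof.
move=> fg0; apply: (@tensor_ext _ _ _ _ (tensor_map f g) \0) => x y.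
rewrite /= tensor_mapE; case: fg0 => [-> | ->] /=.
  exact: ptensor0l.
exact: ptensor0r.
Qed.

Definition flat (F : lmodType R) : Prop :=
  forall (A B C : lmodType R^c) (f : {linear A -> B}) (g : {linear B -> C}),
    short_exact f g ->
    short_exact (tensor_map f (idfun : {linear F -> F}))
                (tensor_map g (idfun : {linear F -> F})).
End TensorMap.

(* The differential of a complex is given as a matrix of maps [d i j] that    *)
(* vanishes off j = i - 1; this way [d (i + 1) i] and [d i (i - 1)] are       *)
(* composable without transport along identities such as (i + 1) - 1 = i.     *)
Record ab_complex : Type := AbComplex {
  ab_obj :> int -> zmodType;
  ab_d : forall i j, {additive ab_obj i -> ab_obj j};
  ab_d_shape : forall i j, j + 1 != i -> forall x, ab_d i j x = 0;
  ab_dd : forall i j k x, ab_d j k (ab_d i j x) = 0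
}.

Definition acyclic (C : ab_complex) : Prop :=
  forall i (x : C i), ab_d C i (i - 1) x = 0 ->
    exists y : C (i + 1), ab_d C (i + 1) i y = x.

Record complex (R : pzRingType) : Type := Complex {
  cx_obj :> int -> lmodType R;
  cx_d : forall i j, {linear cx_obj i -> cx_obj j};
  cx_d_shape : forall i j, j + 1 != i -> forall x, cx_d i j x = 0;
  cx_dd : forall i j k x, cx_d j k (cx_d i j x) = 0
}.

Definition forget (R : pzRingType) (C : complex R) : ab_complex :=
  @AbComplex (fun i => C i) (fun i j => cx_d C i j)
    (@cx_d_shape R C) (@cx_dd R C).

Section Cycles.
Variables (R : pzRingType) (M : complex R).

Definition cycles (i : int) : lmodType R := ker (cx_d M i (i - 1)).

Definition cycles_incl (i : int) : {linear cycles i -> M i} :=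
  ker_incl (cx_d M i (i - 1)).

Definition d_to_cycles (i : int) : {linear M i -> cycles (i - 1)} :=
  corestr (@cx_dd R M i (i - 1) (i - 1 - 1)).

Definition pure_acyclic : Prop :=
  acyclic (forget M) /\
  forall i : int, pure_exact (cycles_incl i) (d_to_cycles i).
End Cycles.

Lemma sign_succ (p n : int) :
  p + 1 = n -> - (-1) ^+ `|p|%N = (-1) ^+ `|n|%N :> int.
Proof.
move=> <-; rewrite -[LHS]mulN1r -exprS -[LHS]signr_odd -[RHS]signr_odd.
by congr (_ ^+ _); lia.
Qed.

Definition bifamily (T : int -> int -> zmodType) : Type := forall i j, T i j.

Section Bifamily.
Variable T : int -> int -> zmodType.
Implicit Types s t u : bifamily T.

HB.instance Definition _ := gen_eqMixin (bifamily T).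
HB.instance Definition _ := gen_choiceMixin (bifamily T).

Lemma bifamily_ext s t : (forall i j, s i j = t i j) -> s = t.
Proof.
by move=> st; apply: functional_extensionality_dep => i;
  apply: functional_extensionality_dep => j; apply: st.
Qed.

Definition bifam0 : bifamily T := fun i j => 0.
Definition bifamD s t : bifamily T := fun i j => s i j + t i j.
Definition bifamN s : bifamily T := fun i j => - s i j.

Lemma bifamDA : associative bifamD.
Proof. by move=> s t u; apply: bifamily_ext => i j; apply: addrA. Qed.
Lemma bifamDC : commutative bifamD.
Proof. by move=> s t; apply: bifamily_ext => i j; apply: addrC. Qed.
Lemma bifam0D : left_id bifam0 bifamD.
Proof. by move=> s; apply: bifamily_ext => i j; apply: add0r. Qed.
Lemma bifamND : left_inverse bifam0 bifamN bifamD.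
Proof. by move=> s; apply: bifamily_ext => i j; apply: addNr. Qed.

HB.instance Definition _ :=
  GRing.isZmodule.Build (bifamily T) bifamDA bifamDC bifam0D bifamND.

Lemma bifamDE s t i j : (s + t) i j = s i j + t i j. Proof. by []. Qed.
Lemma bifamBE s t i j : (s - t) i j = s i j - t i j. Proof. by []. Qed.
End Bifamily.

Section HomComplex.
Variables (R : pzRingType) (L M : complex R).

Let T (i j : int) : zmodType := {linear L i -> M j}.

(* Hom(L, M)_n is the product of the Hom(L_i, M_(i + n)).                     *)
Definition hom_deg (n : int) : {pred bifamily T} :=
  fun f => `[< forall i j, j != i + n -> f i j = 0 >].

Lemma hom_deg_zmod_closed n : zmod_closed (hom_deg n).
Proof.
split=> [|f g]; rewrite ?unfold_in.
  by apply/asboolP.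
move=> /asboolP f0 /asboolP g0; apply/asboolP => i j ij.
by rewrite bifamBE f0 ?g0 ?subrr.
Qed.

HB.instance Definition _ n :=
  GRing.isZmodClosed.Build (bifamily T) (hom_deg n) (hom_deg_zmod_closed n).

Record hom_part (n : int) : Type :=
  HomPart { hom_val : bifamily T; hom_valP : hom_val \in hom_deg n }.

HB.instance Definition _ n := [isSub for @hom_val n].
HB.instance Definition _ n := [Choice of hom_part n by <:].
HB.instance Definition _ n := [SubChoice_isSubZmodule of hom_part n by <:].

(* d f = d^M f - (-1)^n f d^L for f of degree n                               *)
Definition hom_d_val (n : int) (f : bifamily T) : bifamily T := fun i j =>
  (cx_d M (j + 1) j \o f i (j + 1) : {linear L i -> M j})
  - (f (i - 1) j \o cx_d L i (i - 1) : {linear L i -> M j}) *~ (-1) ^+ `|n|%N.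

Lemma hom_d_valE n f i j x : hom_d_val n f i j x =
  cx_d M (j + 1) j (f i (j + 1) x)
  - f (i - 1) j (cx_d L i (i - 1) x) *~ (-1) ^+ `|n|%N.
Proof. by rewrite /hom_d_val linBE /= linMzE. Qed.

Lemma hom_d_subproof (n p : int) (f : hom_part n) :
  (if p + 1 == n then hom_d_val n (hom_val f) else 0) \in hom_deg p.
Proof.
case: eqP => [pn | _]; last exact: rpred0.
have := hom_valP f; rewrite !unfold_in => /asboolP f0; apply/asboolP => i j ij.
apply: linear_ext => x; rewrite hom_d_valE (f0 i (j + 1)) ?(f0 (i - 1) j); [|lia|lia].
by rewrite raddf0 mul0rz subrr.
Qed.

Definition hom_d_fun (n p : int) (f : hom_part n) : hom_part p :=
  HomPart (hom_d_subproof p f).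

Lemma hom_d_is_zmod_morphism n p : zmod_morphism (@hom_d_fun n p).
Proof.
move=> f g; apply: val_inj => /=.
case: eqP => _; last first.
  by rewrite subrr.
apply: bifamily_ext => i j; apply: linear_ext => x.
rewrite bifamBE [RHS]linBE !hom_d_valE !bifamBE.
rewrite [X in cx_d M _ _ X]linBE raddfB [X in X *~ _]linBE mulrzBl.
by rewrite !opprD !opprK addrACA.
Qed.

HB.instance Definition _ n p := GRing.isZmodMorphism.Build
  (hom_part n) (hom_part p) (@hom_d_fun n p) (@hom_d_is_zmod_morphism n p).

Lemma hom_d_shape n p : p + 1 != n -> forall f, @hom_d_fun n p f = 0.
Proof.
by move=> pn f; apply: val_inj; rewrite /= (negPf pn).
Qed.

Lemma hom_dd n p q f : @hom_d_fun p q (@hom_d_fun n p f) = 0.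
Proof.
apply: val_inj => /=; case: eqP => [qp | //]; case: eqP => [pn | _].
  apply: bifamily_ext => i j; apply: linear_ext => x.
  rewrite !hom_d_valE -(sign_succ pn) raddfB /= raddfMz !cx_dd raddf0 mul0rz sub0r subr0.
  by rewrite mulrNz opprK subrr.
apply: bifamily_ext => i j; apply: linear_ext => x.
by rewrite hom_d_valE raddf0 mul0rz subrr.
Qed.

Definition hom_complex : ab_complex :=
  @AbComplex (fun n => hom_part n) (fun n p => @hom_d_fun n p) hom_d_shape hom_dd.
End HomComplex.

Section TensorComplex.
Variables (R : pzRingType) (N : complex R^c) (M : complex R).

Let T (i j : int) : zmodType := tensor (N i) (M j).

(* (N (x) M)_n is the direct sum of the N_i (x) M_j with i + j = n.           *)
Definition tensor_deg (n : int) : {pred bifamily T} := fun t =>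
  `[< (forall i j, i + j != n -> t i j = 0) /\
      exists s : seq (int * int), forall i j, (i, j) \notin s -> t i j = 0 >].

Lemma tensor_deg_zmod_closed n : zmod_closed (tensor_deg n).
Proof.
split=> [|f g]; rewrite ?unfold_in.
  by apply/asboolP; split => //; exists [::].
move=> /asboolP[f0 [sf fs]] /asboolP[g0 [sg gs]]; apply/asboolP; split.
  by move=> i j ij; rewrite bifamBE f0 ?g0 ?subrr.
exists (sf ++ sg) => i j; rewrite mem_cat negb_or => /andP[ij_f ij_g].
by rewrite bifamBE fs ?gs ?subrr.
Qed.

HB.instance Definition _ n := GRing.isZmodClosed.Build
  (bifamily T) (tensor_deg n) (tensor_deg_zmod_closed n).

Record tensor_part (n : int) : Type :=
  TensorPart { tensor_val : bifamily T; tensor_valP : tensor_val \in tensor_deg n }.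

HB.instance Definition _ n := [isSub for @tensor_val n].
HB.instance Definition _ n := [Choice of tensor_part n by <:].
HB.instance Definition _ n := [SubChoice_isSubZmodule of tensor_part n by <:].

(* d (x (x) y) = d x (x) y + (-1)^i x (x) d y for x of degree i               *)
Definition tensor_d_val (t : bifamily T) : bifamily T := fun i j =>
  tensor_map (cx_d N (i + 1) i) (idfun : {linear M j -> M j}) (t (i + 1) j)
  + tensor_map (idfun : {linear N i -> N i}) (cx_d M (j + 1) j) (t i (j + 1))
      *~ (-1) ^+ `|i|%N.

Lemma tensor_d_subproof (n p : int) (t : tensor_part n) :
  (if p + 1 == n then tensor_d_val (tensor_val t) else 0) \in tensor_deg p.
Proof.
case: eqP => [pn | _]; last exact: rpred0.
have := tensor_valP t; rewrite !unfold_in => /asboolP[t0 [s ts]].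
apply/asboolP; split=> [i j ij|].
  rewrite /tensor_d_val (t0 (i + 1) j) ?(t0 i (j + 1)); [|lia|lia].
  by rewrite !raddf0 mul0rz addr0.
exists ([seq (k.1 - 1, k.2) | k <- s] ++ [seq (k.1, k.2 - 1) | k <- s]) => i j.
rewrite mem_cat negb_or => /andP[ij1 ij2].
rewrite /tensor_d_val (ts (i + 1) j) ?(ts i (j + 1)).
- by rewrite !raddf0 mul0rz addr0.
- by apply: contra ij2 => /(map_f (fun k => (k.1, k.2 - 1))); rewrite /= addrK.
- by apply: contra ij1 => /(map_f (fun k => (k.1 - 1, k.2))); rewrite /= addrK.
Qed.

Definition tensor_d_fun (n p : int) (t : tensor_part n) : tensor_part p :=
  TensorPart (tensor_d_subproof p t).

Lemma tensor_d_is_zmod_morphism n p : zmod_morphism (@tensor_d_fun n p).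
Proof.
move=> s t; apply: val_inj => /=.
case: eqP => _; last first.
  by rewrite subrr.
apply: bifamily_ext => i j; rewrite bifamBE /tensor_d_val !bifamBE !raddfB /=.
by rewrite mulrzBl opprD addrACA.
Qed.

HB.instance Definition _ n p := GRing.isZmodMorphism.Build
  (tensor_part n) (tensor_part p) (@tensor_d_fun n p)
  (@tensor_d_is_zmod_morphism n p).

Lemma tensor_d_shape n p : p + 1 != n -> forall t, @tensor_d_fun n p t = 0.
Proof.
by move=> pn t; apply: val_inj; rewrite /= (negPf pn).
Qed.

Lemma tensor_dd n p q t : @tensor_d_fun p q (@tensor_d_fun n p t) = 0.
Proof.
apply: val_inj => /=; case: eqP => [_ | //]; case: eqP => [_ | _]; last first.
  by apply: bifamily_ext => i j; rewrite /tensor_d_val !raddf0 mul0rz addr0.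
apply: bifamily_ext => i j; rewrite /tensor_d_val !raddfD /= !raddfMz /=.
rewrite !tensor_map_comp.
have -> : forall u, tensor_map (cx_d N (i + 1) i \o cx_d N (i + 1 + 1) (i + 1))
    (idfun \o idfun : {linear M j -> M j}) u = 0.
  by apply: tensor_map_eq0; left=> x; apply: cx_dd.
have -> : forall u, tensor_map (idfun \o idfun : {linear N i -> N i})
    (cx_d M (j + 1) j \o cx_d M (j + 1 + 1) (j + 1)) u = 0.
  by apply: tensor_map_eq0; right=> x; apply: cx_dd.
rewrite mul0rz addr0 add0r -(@sign_succ i (i + 1)) // mulrNz.
exact: addNr.
Qed.

Definition tensor_complex : ab_complex :=
  @AbComplex (fun n => tensor_part n) (fun n p => @tensor_d_fun n p)
    tensor_d_shape tensor_dd.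
End TensorComplex.

Section SemiNotions.
Variable R : pzRingType.

Definition semi_flat (F : complex R) : Prop :=
  (forall i, flat (F i)) /\
  forall N : complex R^c, acyclic (forget N) -> acyclic (tensor_complex N F).

Definition semi_projective (P : complex R) : Prop :=
  (forall i, projective (P i)) /\
  forall M : complex R, acyclic (forget M) -> acyclic (hom_complex P M).

Definition semi_injective (I : complex R) : Prop :=
  (forall i, injective_module (I i)) /\
  forall M : complex R, acyclic (forget M) -> acyclic (hom_complex M I).

End SemiNotions.

(* Main.v *)
From HB Require Import structures.
From mathcomp Require Import all_boot all_order all_algebra.
From mathcomp Require Import generic_quotient ring_quotient.
From mathcomp Require Import boolp classical_sets wochoice finmap zify.
Require Import Defs.

Set Implicit Arguments.
Unset Strict Implicit.
Unset Printing Implicit Defensive.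

Import GRing.Theory.

Local Open Scope ring_scope.
Local Open Scope quotient_scope.

(** The engine of the implications that start from a von Neumann regular ring R
    is that a finitely generated submodule of a free module is a direct summand
    ([split_span]): one coordinate at a time, an element [y] with coordinate
    [r = r x r] is split off by the functional [coordinate * x].

    Hence finitely presented modules are projective and every exact sequence is
    pure, so that acyclic complexes are pure-acyclic, pure-projective modules are
    projective and pure-injective modules are injective. A tensor that vanishes
    over M lifts to a tensor over a free cover that involves finitely many
    relations; projecting onto their span shows that all modules are flat on
    either side ([tensor_exact_l], [tensor_exact_r]). So an acyclic
    complex N stays acyclic when tensored with the terms of F and with their
    cycles, and N (x) F is acyclic.

    For the Hom complexes the grading is dropped: it suffices that every map
    commuting with the differentials, from the direct sum of one complex to the
    product of the other, is null-homotopic ([hom_complex_acyclic]). On a finitely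
    generated stable submodule of a free differential module the boundaries are a
    direct summand, and homotopies can be written down. They are extended along
    inclusions by [extend_homotopy], which corrects a homotopy on the larger
    submodule by a boundary.

    If the source is projective it is a retract of a free differential module.
    A maximal homotopy among those defined on stable coordinate submodules is
    total, because any basis element lies in a stable set of countably many, and
    the submodule that it spans is the union of a sequence of finitely generated
    ones ([free_null_homotopic]).

    If the target is injective and the source is acyclic, then the source is P/K
    with P free and contractible and K acyclic. Now K is the union of a family of
    finitely generated acyclic, hence contractible, submodules indexed by finite
    sets. Vanishing of homotopy classes passes to the union ([directed_acyclic_on])
    by induction along a well-ordering of the index set: the statement about an
    initial segment allows an arbitrary finite set of further indices, so that
    only limit steps require an argument.

    Conversely, each of the other conditions is tested on a cyclic module. If R/Ra
    is projective, or if the sequence of Ra, R and R/Ra is pure, then Ra is a direct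
    summand of R and [a = a x a]. If it is flat, then [a (x) 1], which is zero in
    R (x) R/Ra, is zero in aR (x) R/Ra = aR/aRa. The characters of R/aR with values
    in Q/Z form a pure-injective module; if it is injective, then a character of
    R/aRa restricted to Ra extends to R, which forces it to vanish on [a]. *)

(** * Linear maps, submodules and quotients *)

Section MakeLinear.
Variables (R : pzRingType) (U V : lmodType R).

(** Packed linear maps are kept opaque, so that simplification never unfolds them
    and their values are computed by [mklinE] only. *)
Lemma mklin_subproof (f : U -> V) : linear f -> {g : {linear U -> V} | g =1 f}.
Proof.
move=> hf; pose g : {linear U -> V} :=
  HB.pack f (GRing.isLinear.Build R U V *:%R f hf).
by exists g.
Qed.

Definition mklin (f : U -> V) (hf : linear f) := sval (mklin_subproof hf).

Lemma mklinE f (hf : linear f) x : mklin hf x = f x.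
Proof. exact: (svalP (mklin_subproof hf)). Qed.

(** A linear relation that is total and single-valued is the graph of a linear
    map. This is how maps are factored through injections and surjections. *)
Lemma linear_choice (h : U -> V -> Prop) :
    (forall x, exists y, h x y) -> (forall x y y', h x y -> h x y' -> y = y') ->
    (forall a x x' y y', h x y -> h x' y' -> h (a *: x + x') (a *: y + y')) ->
  exists f : {linear U -> V}, forall x, h x (f x).
Proof.
move=> ex uniq lin; have [f fP] := choice ex.
have flin : linear f by move=> a x y; apply: (uniq (a *: x + y)) => //; apply: lin.
by exists (mklin flin) => x; rewrite mklinE.
Qed.
End MakeLinear.

Section MakeAdditive.
Variables (U V : zmodType).

Lemma mkadd_subproof (f : U -> V) :
  zmod_morphism f -> {g : {additive U -> V} | g =1 f}.
Proof.
move=> hf; pose g : {additive U -> V} :=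
  HB.pack f (GRing.isZmodMorphism.Build U V f hf).
by exists g.
Qed.

Definition mkadd (f : U -> V) (hf : zmod_morphism f) := sval (mkadd_subproof hf).

Lemma mkaddE f (hf : zmod_morphism f) x : mkadd hf x = f x.
Proof. exact: (svalP (mkadd_subproof hf)). Qed.
End MakeAdditive.

Section Subgroups.
Variable V : zmodType.

Record subgroup := Subgroup {
  sg_mem :> V -> Prop;
  sg0 : sg_mem 0;
  sgB : forall x y, sg_mem x -> sg_mem y -> sg_mem (x - y) }.

Lemma sgN (Y : subgroup) x : Y x -> Y (- x).
Proof. by move=> hx; rewrite -sub0r; apply: sgB => //; apply: sg0. Qed.
Lemma sgD (Y : subgroup) x y : Y x -> Y y -> Y (x + y).
Proof. by move=> hx hy; rewrite -[y]opprK; apply/sgB/sgN. Qed.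
Variable Y : subgroup.
Definition sg_pred : {pred V} := fun x => `[< Y x >].
Lemma sg_pred_closed : zmod_closed sg_pred.
Proof.
split; first by apply/asboolP/sg0.
by move=> x y /asboolP hx /asboolP hy; apply/asboolP/sgB.
Qed.
HB.instance Definition _ := GRing.isZmodClosed.Build V sg_pred sg_pred_closed.

Definition zquot : Type := Quotient.quot sg_pred.
HB.instance Definition _ := Choice.on zquot.
HB.instance Definition _ := EqQuotient.on zquot.
HB.instance Definition _ := GRing.Zmodule.on zquot.
HB.instance Definition _ := ZmodQuotient.on zquot.

Definition zpi : {additive V -> zquot} := \pi_zquot.

Lemma zpi_eq x y : zpi x = zpi y <-> Y (x - y).
Proof.
split=> [/eqP|h]; first by rewrite -Quotient.idealrBE => /asboolP.
by apply/eqP; rewrite -Quotient.idealrBE; apply/asboolP.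
Qed.

Lemma zpi_eq0 x : zpi x = 0 <-> Y x.
Proof. by have := zpi_eq x 0; rewrite subr0 raddf0. Qed.

Lemma zpi_surj u : exists x, zpi x = u.
Proof. by exists (repr u); apply: reprK. Qed.
End Subgroups.

Section Submodules.
Variables (R : pzRingType) (U : lmodType R).

Record submodule := Submodule {
  sm_mem :> U -> Prop;
  sm0 : sm_mem 0;
  smP : forall a x y, sm_mem x -> sm_mem y -> sm_mem (a *: x + y) }.

Implicit Type Y : submodule.

Lemma smD Y x y : Y x -> Y y -> Y (x + y).
Proof. by move=> /(smP 1) h /h; rewrite scale1r. Qed.
Lemma smZ Y a x : Y x -> Y (a *: x).
Proof. by move=> /(@smP Y a) /(_ (sm0 Y)); rewrite addr0. Qed.
Lemma smN Y x : Y x -> Y (- x).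
Proof. by rewrite -scaleN1r; apply: smZ. Qed.
Lemma smB Y x y : Y x -> Y y -> Y (x - y).
Proof. by move=> hx /smN; apply: smD. Qed.
Lemma sm_sum Y (I : Type) (s : seq I) (P : pred I) (F : I -> U) :
  (forall i, P i -> Y (F i)) -> Y (\sum_(i <- s | P i) F i).
Proof. by move=> h; elim/big_ind: _ => //; [apply: sm0 | apply: smD]. Qed.

Section Fixed.
Variable Y : submodule.
Definition sm_pred : {pred U} := fun x => `[< Y x >].
Lemma sm_pred_closed : submod_closed sm_pred.
Proof.
split; first by apply/asboolP/sm0.
by move=> a x y /asboolP hx /asboolP hy; apply/asboolP/smP.
Qed.
HB.instance Definition _ :=
  GRing.isSubmodClosed.Build R U sm_pred sm_pred_closed.

Record sub_of : Type := SubOf { sub_val : U; sub_valP : sub_val \in sm_pred }.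
HB.instance Definition _ := [isSub for sub_val].
HB.instance Definition _ := [Choice of sub_of by <:].
HB.instance Definition _ := [SubChoice_isSubLmodule of sub_of by <:].

Definition sub_incl : {linear sub_of -> U} := val.

Lemma sub_inclP u : Y (sub_incl u).
Proof. by case: u => u /= /asboolP. Qed.

Definition sub_mk (x : U) (hx : Y x) : sub_of := SubOf (introT (asboolP _) hx).

Lemma sub_mkE x (hx : Y x) : sub_incl (sub_mk hx) = x. Proof. by []. Qed.

Lemma sub_incl_inj : injective sub_incl. Proof. exact: val_inj. Qed.

Definition quot_of : Type := Quotient.quot sm_pred.
HB.instance Definition _ := Choice.on quot_of.
HB.instance Definition _ := EqQuotient.on quot_of.
HB.instance Definition _ := GRing.Zmodule.on quot_of.
HB.instance Definition _ := ZmodQuotient.on quot_of.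

Lemma quot_eq x y : \pi_quot_of x = \pi_quot_of y <-> Y (x - y).
Proof.
split=> [/eqP|h].
  by rewrite -Quotient.idealrBE => /asboolP.
by apply/eqP; rewrite -Quotient.idealrBE; apply/asboolP.
Qed.

Definition quot_scale (a : R) (u : quot_of) : quot_of := \pi_quot_of (a *: repr u).

Lemma quot_scale_pi a x : quot_scale a (\pi_quot_of x) = \pi_quot_of (a *: x).
Proof.
by apply/quot_eq; rewrite -scalerBr; apply/smZ/quot_eq; rewrite reprK.
Qed.

Lemma quot_scaleA a b u : quot_scale a (quot_scale b u) = quot_scale (a * b) u.
Proof. by rewrite /quot_scale -/(quot_scale a _) quot_scale_pi scalerA. Qed.
Lemma quot_scale1 : left_id 1 quot_scale.
Proof. by move=> u; rewrite /quot_scale scale1r reprK. Qed.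
Lemma quot_scaleDr : right_distributive quot_scale +%R.
Proof.
move=> a u v; rewrite -[u]reprK -[v]reprK -raddfD !quot_scale_pi scalerDr.
by rewrite raddfD.
Qed.
Lemma quot_scaleDl u : {morph quot_scale^~ u : a b / a + b}.
Proof. by move=> a b; rewrite /quot_scale scalerDl raddfD. Qed.

HB.instance Definition _ := GRing.Zmodule_isLmodule.Build R quot_of
  quot_scaleA quot_scale1 quot_scaleDr quot_scaleDl.

Lemma quot_pi_linear : linear (fun x : U => \pi_quot_of x : quot_of).
Proof.
by move=> a x y /=; rewrite raddfD /= -[X in X + _]quot_scale_pi.
Qed.

Definition quot_pi : {linear U -> quot_of} := mklin quot_pi_linear.

Lemma quot_pi_eq0 x : quot_pi x = 0 <-> Y x.
Proof.
rewrite -[X in _ = X](linear0 quot_pi) !mklinE.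
by have := quot_eq x 0; rewrite subr0.
Qed.

Lemma quot_piK u : quot_pi (repr u) = u.
Proof. by rewrite mklinE; apply: reprK. Qed.

Lemma quot_pi_surj u : exists x, quot_pi x = u.
Proof. by exists (repr u); apply: quot_piK. Qed.

Lemma sub_quot_exact : short_exact sub_incl quot_pi.
Proof.
split; [exact: sub_incl_inj | | exact: quot_pi_surj] => y; rewrite quot_pi_eq0.
split=> [hy|[x <-]]; last exact: sub_inclP.
by exists (sub_mk hy).
Qed.
End Fixed.
End Submodules.

Arguments sub_incl {R U Y}.
Arguments sub_incl_inj {R U Y}.

(** * Products and direct sums of families *)

Section Families.
Variables (R : pzRingType) (I : eqType) (M : I -> lmodType R).

Definition prodf : Type := forall i, M i.
Implicit Types s t u : prodf.

HB.instance Definition _ := gen_eqMixin prodf.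
HB.instance Definition _ := gen_choiceMixin prodf.

Lemma prodf_ext s t : (forall i, s i = t i) -> s = t.
Proof. by move=> st; apply: functional_extensionality_dep. Qed.

Definition prodf0 : prodf := fun i => 0.
Definition prodfD s t : prodf := fun i => s i + t i.
Definition prodfN s : prodf := fun i => - s i.
Lemma prodfDA : associative prodfD.
Proof. by move=> s t u; apply: prodf_ext => i; apply: addrA. Qed.
Lemma prodfDC : commutative prodfD.
Proof. by move=> s t; apply: prodf_ext => i; apply: addrC. Qed.
Lemma prodf0D : left_id prodf0 prodfD.
Proof. by move=> s; apply: prodf_ext => i; apply: add0r. Qed.
Lemma prodfND : left_inverse prodf0 prodfN prodfD.
Proof. by move=> s; apply: prodf_ext => i; apply: addNr. Qed.
HB.instance Definition _ :=
  GRing.isZmodule.Build prodf prodfDA prodfDC prodf0D prodfND.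

Definition prodfZ (a : R) s : prodf := fun i => a *: s i.
Lemma prodfZA a b s : prodfZ a (prodfZ b s) = prodfZ (a * b) s.
Proof. by apply: prodf_ext => i; apply: scalerA. Qed.
Lemma prodfZ1 : left_id 1 prodfZ.
Proof. by move=> s; apply: prodf_ext => i; apply: scale1r. Qed.
Lemma prodfZDr : right_distributive prodfZ +%R.
Proof. by move=> a s t; apply: prodf_ext => i; apply: scalerDr. Qed.
Lemma prodfZDl s : {morph prodfZ^~ s : a b / a + b}.
Proof. by move=> a b; apply: prodf_ext => i; apply: scalerDl. Qed.
HB.instance Definition _ := GRing.Zmodule_isLmodule.Build R prodf
  prodfZA prodfZ1 prodfZDr prodfZDl.

Lemma prodfE a s t i : (a *: s + t) i = a *: s i + t i. Proof. by []. Qed.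

Lemma prodfMz s (n : int) i : (s *~ n) i = s i *~ n.
Proof.
have hB : zmod_morphism (fun s : prodf => s i) by [].
by rewrite -[LHS](mkaddE hB) raddfMz /= mkaddE.
Qed.

Definition finsupp_sm : submodule prodf.
Proof.
exists (fun s => exists l : seq I, forall i, i \notin l -> s i = 0).
- by exists [::].
- move=> a s t [ls hs] [lt ht]; exists (ls ++ lt) => i; rewrite mem_cat negb_or.
  by case/andP=> hi hi'; rewrite prodfE hs // ht // scaler0 addr0.
Defined.

Definition dsum : lmodType R := sub_of finsupp_sm.

Implicit Type d : dsum.

Definition dcoord i (d : dsum) : M i := sub_incl d i.

Lemma dcoord_linear i : linear (@dcoord i).
Proof. by []. Qed.

Definition dproj i : {linear dsum -> M i} := mklin (@dcoord_linear i).

Lemma dprojE i d : dproj i d = sub_incl d i. Proof. exact: mklinE. Qed.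

Lemma dsum_supp d : exists l : seq I, uniq l /\ forall i, i \notin l -> dproj i d = 0.
Proof.
have [l hl] := sub_inclP d; exists (undup l); rewrite undup_uniq; split=> // i.
by rewrite mem_undup dprojE => /hl.
Qed.

Lemma dsum_ext d d' : (forall i, dproj i d = dproj i d') -> d = d'.
Proof.
move=> h; apply: sub_incl_inj; apply: prodf_ext => i.
by have := h i; rewrite !dprojE.
Qed.

Lemma dinj_supp i (x : M i) : finsupp_sm (dfwith prodf0 x).
Proof.
exists [:: i] => j; rewrite inE => ji.
by rewrite dfwith_out // eq_sym.
Qed.

Lemma dinj_linear i : linear (fun x : M i => sub_mk (dinj_supp x) : dsum).
Proof.
move=> a x y; apply: sub_incl_inj; apply: prodf_ext => j.
rewrite linearP /= prodfE /=; case: (eqVneq i j) => [<-|ij].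
  by rewrite !dfwith_in.
by rewrite !dfwith_out // /prodf0 scaler0 addr0.
Qed.

Definition dinj i : {linear M i -> dsum} := mklin (@dinj_linear i).

Lemma dproj_inj i x : dproj i (dinj i x) = x.
Proof. by rewrite dprojE mklinE; exact: dfwith_in. Qed.

Lemma dproj_inj0 i j x : i != j -> dproj j (dinj i x) = 0.
Proof. by rewrite dprojE mklinE; exact: dfwith_out. Qed.

Lemma dsumE d l : uniq l -> (forall i, i \notin l -> dproj i d = 0) ->
  d = \sum_(i <- l) dinj i (dproj i d).
Proof.
move=> ul hl; apply: dsum_ext => j; rewrite raddf_sum.
have [jl|jl] := boolP (j \in l); last first.
  rewrite hl // big1_seq // => i /= il.
  by apply: (@dproj_inj0 i j); apply: contraNneq jl => <-.
rewrite (bigD1_seq j) //= big1 ?addr0; last by move=> i ij; apply: dproj_inj0.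
exact/esym/dproj_inj.
Qed.

Lemma dsum_ind (P : dsum -> Prop) : P 0 ->
  (forall i x d, P d -> P (dinj i x + d)) -> forall d, P d.
Proof.
move=> P0 PD d; have [l [ul hl]] := dsum_supp d; rewrite (dsumE ul hl).
by elim: l {ul hl} => [|i l IH]; rewrite ?big_nil // big_cons; apply: PD.
Qed.

Lemma dsum_lin_ext (V : lmodType R) (f g : {linear dsum -> V}) :
  (forall i x, f (dinj i x) = g (dinj i x)) -> f =1 g.
Proof.
move=> fg; apply: dsum_ind => [|i x d IH]; first by rewrite !raddf0.
by rewrite !linearD fg IH.
Qed.

Section Lift.
Variables (V : lmodType R) (f : forall i, {linear M i -> V}).

Definition dlift_seq (l : seq I) (d : dsum) : V := \sum_(i <- l) f i (dproj i d).

(** Summing over a larger set of indices than the support changes nothing, so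
    the sum over a support is additive although supports vary. *)
Lemma dlift_seqE l l' d : uniq l -> uniq l' ->
  (forall i, i \notin l -> dproj i d = 0) ->
  (forall i, i \notin l' -> dproj i d = 0) -> dlift_seq l d = dlift_seq l' d.
Proof.
have aux m : uniq m -> (forall i, i \notin m -> dproj i d = 0) ->
    forall m', {subset m <= m'} -> uniq m' -> dlift_seq m d = dlift_seq m' d.
  move=> um hm m' mm' um'; rewrite /dlift_seq [RHS](bigID (mem m)) /=.
  rewrite [X in _ = _ + X]big1 ?addr0; last by move=> i /hm ->; rewrite raddf0.
  rewrite -[RHS]big_filter; apply: perm_big; apply: uniq_perm => //.
    exact: filter_uniq.
  by move=> i; rewrite mem_filter; case: (boolP (i \in m)) => // /mm' ->.
move=> ul ul' hl hl'; rewrite (aux _ ul hl (undup (l ++ l'))) ?undup_uniq //.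
  by rewrite [RHS](aux _ ul' hl' (undup (l ++ l'))) ?undup_uniq // => i;
     rewrite mem_undup mem_cat orbC => ->.
by move=> i; rewrite mem_undup mem_cat => ->.
Qed.

Lemma dlift_ex : exists g : {linear dsum -> V}, forall i x, g (dinj i x) = f i x.
Proof.
pose h d v := exists l, [/\ uniq l, forall i, i \notin l -> dproj i d = 0
  & v = dlift_seq l d].
have [d|d v v' [l [ul hl ->]] [l' [ul' hl' ->]]| |g gP] := @linear_choice _ _ _ h.
- by have [l [ul hl]] := dsum_supp d; exists (dlift_seq l d), l.
- exact: dlift_seqE.
- move=> a d d' v v' [l [ul hl ->]] [l' [ul' hl' ->]].
  pose m := undup (l ++ l').
  have um : uniq m by apply: undup_uniq.
  have hm i : i \notin m -> dproj i d = 0 /\ dproj i d' = 0.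
    by rewrite mem_undup mem_cat negb_or => /andP[/hl -> /hl' ->].
  exists m; split=> //.
    by move=> i /hm [e e']; rewrite linearP e e' scaler0 addr0.
  rewrite (dlift_seqE ul um hl); last by move=> i /hm [].
  rewrite (dlift_seqE ul' um hl'); last by move=> i /hm [].
  rewrite /dlift_seq scaler_sumr -big_split; apply: eq_bigr => i _ /=.
  by rewrite !linearP.
exists g => i x; have [l [ul hl ->]] := gP (dinj i x).
rewrite (@dlift_seqE l [:: i]) //.
  by rewrite /dlift_seq big_seq1 dproj_inj.
by move=> j; rewrite inE => ji; apply: dproj_inj0; rewrite eq_sym.
Qed.

Definition dlift : {linear dsum -> V} := sval (cid dlift_ex).
Lemma dliftE i x : dlift (dinj i x) = f i x.
Proof. exact: (svalP (cid dlift_ex)). Qed.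
End Lift.
End Families.

Arguments prodf_ext {R I M s t}.
Arguments dsum_ext {R I M d d'}.

(** * Spans, free modules and coordinates *)

Section Span.
Variables (R : pzRingType) (U : lmodType R).

(** Impredicatively, as the intersection of the submodules containing [l]; the
    minimality is then the definition. *)
Definition span (l : seq U) : submodule U.
Proof.
exists (fun x => forall Y : submodule U, (forall y, y \in l -> Y y) -> Y x).
- by move=> Y _; apply: sm0.
- by move=> a x y hx hy Y hY; apply: smP; [apply: hx | apply: hy].
Defined.

Lemma span_mem l x : x \in l -> span l x.
Proof. by move=> xl Y; apply. Qed.

Lemma span_min l (Y : submodule U) :
  (forall y, y \in l -> Y y) -> forall x, span l x -> Y x.
Proof. by move=> hY x; apply. Qed.

Lemma span_sub l l' : {subset l <= l'} -> forall x, span l x -> span l' x.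
Proof. by move=> ll'; apply: span_min => y /ll'; apply: span_mem. Qed.

Lemma span_nil x : span [::] x -> x = 0.
Proof.
have @Y : submodule U.
  exists (fun x => x = 0) => // a y z -> ->; by rewrite scaler0 addr0.
by move=> /(_ Y); apply.
Qed.

Lemma span_cons y l x : span (y :: l) x -> exists a x', span l x' /\ x = a *: y + x'.
Proof.
have @Y : submodule U.
  exists (fun x => exists a x', span l x' /\ x = a *: y + x').
    by exists 0, 0; split; [apply: sm0 | rewrite scale0r addr0].
  move=> a _ _ [b [x1 [h1 ->]]] [c [x2 [h2 ->]]].
  exists (a * b + c), (a *: x1 + x2); split; first exact: smP.
  by rewrite scalerDl scalerDr scalerA addrACA.
move=> /(_ Y); apply=> z; rewrite inE => /predU1P[->|zl].
  by exists 1, 0; split; [apply: sm0 | rewrite scale1r addr0].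
by exists 0, z; split; [apply: span_mem | rewrite scale0r add0r].
Qed.
End Span.

Section SpanMap.
Variables (R : pzRingType) (U V : lmodType R) (f : {linear U -> V}).

Definition preim_sm (Y : submodule V) : submodule U.
Proof.
exists (fun x => Y (f x)); first by rewrite linear0; apply: sm0.
by move=> a x y hx hy; rewrite linearP; apply: smP.
Defined.

Definition image_sm (Y : submodule U) : submodule V.
Proof.
exists (fun y => exists2 x, Y x & f x = y); first by exists 0; [apply: sm0 | rewrite linear0].
by move=> a _ _ [x hx <-] [y hy <-]; exists (a *: x + y); [apply: smP | rewrite linearP].
Defined.

Definition range_sm : submodule V.
Proof.
exists (fun y => exists x, f x = y); first by exists 0; rewrite linear0.
by move=> a _ _ [x <-] [y <-]; exists (a *: x + y); rewrite linearP.
Defined.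

Lemma span_map l x : span l x -> span (map f l) (f x).
Proof.
by apply: (@span_min _ _ l (preim_sm (span (map f l)))) => y yl; apply/span_mem/map_f.
Qed.

Lemma span_map_ex l y : span (map f l) y -> exists2 x, span l x & f x = y.
Proof.
apply: (@span_min _ _ _ (image_sm (span l))) => _ /mapP[x xl ->].
by exists x => //; apply: span_mem.
Qed.
End SpanMap.

Section LinEq.
Variables (R : pzRingType) (U V : lmodType R) (f g : {linear U -> V}).
Definition equalizer_sm : submodule U.
Proof.
exists (fun x => f x = g x); first by rewrite !linear0.
by move=> a x y hx hy; rewrite !linearP hx hy.
Defined.

Lemma span_eq l : (forall x, x \in l -> f x = g x) ->
  forall x, span l x -> f x = g x.
Proof. by move=> h; apply: (@span_min _ _ l equalizer_sm). Qed.
End LinEq.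

Section Zero.
Variable (R : pzRingType).
Lemma lin_ext_span (U V : lmodType R) (l : seq U) (f : {linear U -> V}) :
  (forall x, x \in l -> f x = 0) -> forall x, span l x -> f x = 0.
Proof. by move=> h x /(@span_eq _ _ _ f (\0 : {linear U -> V})); apply. Qed.
End Zero.

Section Free.
Variables (R : pzRingType) (K : eqType).

Definition fmod : lmodType R := dsum (fun _ : K => R^o).
Definition fbase (k : K) : fmod := dinj (fun _ : K => R^o) k 1.
Definition fcoord (k : K) : {linear fmod -> R^o} := dproj (fun _ : K => R^o) k.

Lemma fcoord_base k k' : fcoord k (fbase k') = (k' == k)%:R.
Proof.
have [<-|kk'] := eqVneq; first exact: dproj_inj.
exact: dproj_inj0.
Qed.

Lemma fcoord_supp x : exists l : seq K, uniq l /\ forall k, k \notin l -> fcoord k x = 0.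
Proof. exact: dsum_supp. Qed.

Lemma free_ext x y : (forall k, fcoord k x = fcoord k y) -> x = y.
Proof. exact: dsum_ext. Qed.

Lemma fbaseZ k (a : R) : dinj (fun _ : K => R^o) k a = a *: fbase k.
Proof. by rewrite -linearZ /= -[X in _ = _ _ X]/(a * 1) mulr1. Qed.

Lemma fmodE x l : uniq l -> (forall k, k \notin l -> fcoord k x = 0) ->
  x = \sum_(k <- l) (fcoord k x : R) *: fbase k.
Proof.
move=> ul hl; rewrite {1}(dsumE ul hl); apply: eq_bigr => k _.
exact: fbaseZ.
Qed.

Lemma free_lin_ext (V : lmodType R) (f g : {linear fmod -> V}) :
  (forall k, f (fbase k) = g (fbase k)) -> f =1 g.
Proof. by move=> fg; apply: dsum_lin_ext => k a; rewrite fbaseZ !linearZ fg. Qed.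

Section Lift.
Variables (V : lmodType R) (h : K -> V).
Lemma flift_linear k : linear (fun a : R^o => (a : R) *: h k).
Proof. by move=> a x y; rewrite scalerDl -scalerA. Qed.
Definition flift : {linear fmod -> V} := dlift (fun k => mklin (@flift_linear k)).
Lemma fliftE k : flift (fbase k) = h k.
Proof. by rewrite /flift /fbase dliftE mklinE scale1r. Qed.
End Lift.
End Free.

Arguments fcoord {R K}.

Definition fcover (R : pzRingType) (M : lmodType R) : {linear fmod R M -> M} :=
  flift (fun x : M => x).

Lemma fcoverE (R : pzRingType) (M : lmodType R) (x : M) : fcover M (fbase R x) = x.
Proof. exact: fliftE. Qed.

Section LiftProperty.
Variable R : pzRingType.

(** Projectivity in the form used for differentials: only the image of [h] has
    to lie in the image of [q]. *)
Definition lifts (P : lmodType R) : Prop :=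
  forall (M N : lmodType R) (q : {linear M -> N}) (h : {linear P -> N}),
  (forall x, exists y, q y = h x) ->
  exists h' : {linear P -> M}, forall x, q (h' x) = h x.

Lemma lifts_free (K : eqType) : lifts (fmod R K).
Proof.
move=> M N q h ex; have [s sP] := choice (fun k => ex (fbase R k)).
exists (flift s) => x.
by apply: (@free_lin_ext _ _ _ (q \o flift s) h) => k /=; rewrite fliftE.
Qed.

Lemma lifts_retract (P Q : lmodType R) (i : {linear P -> Q}) (p : {linear Q -> P}) :
  (forall x, p (i x) = x) -> lifts Q -> lifts P.
Proof.
move=> pi lQ M N q h ex.
have [|h' h'P] := lQ M N q (h \o p : {linear Q -> N}); first by move=> x; apply: ex.
by exists (h' \o i : {linear P -> M}) => x; rewrite /= h'P /= pi.
Qed.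

Lemma hom_post_exact (A L M N : lmodType R) (f : {linear L -> M})
    (g : {linear M -> N}) : short_exact f g ->
  (forall h : {linear A -> N}, exists h' : {linear A -> M}, forall x, g (h' x) = h x) ->
  short_exact (hom_post (A := A) f) (hom_post (A := A) g).
Proof.
move=> [injf ex _] lift; split.
- move=> h h' /(congr1 (fun k : {linear A -> M} => k : A -> M)) e.
  by apply: linear_ext => x; apply: injf; have := congr1 (@^~ x) e.
- move=> h; split=> [e|[h' <-]]; last first.
    by apply: linear_ext => x /=; apply/ex; exists (h' x).
  have hx x : exists y, f y = h x.
    apply/ex; by have := congr1 (fun k : {linear A -> N} => k x) e.
  have [||h' h'P] := @linear_choice _ A L (fun x y => f y = h x) hx.
  + by move=> x y y' <- /injf.
  + by move=> a x x' y y' e1 e2; rewrite !linearP e1 e2.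
  by exists h'; apply: linear_ext => x /=.
- move=> h; have [h' h'P] := lift h.
  by exists h'; apply: linear_ext => x /=.
Qed.

Lemma ker_exact (M N : lmodType R) (q : {linear M -> N}) :
  (forall y, exists x, q x = y) -> short_exact (ker_incl q) q.
Proof.
move=> sq; split=> // [|y]; first exact: val_inj.
split=> [/eqP qy|[x <-]]; first by exists (Ker qy).
by apply/eqP; case: x.
Qed.

Lemma projective_onto (P M N : lmodType R) (q : {linear M -> N}) (h : {linear P -> N}) :
  projective P -> (forall y, exists x, q x = y) ->
  exists h' : {linear P -> M}, forall x, q (h' x) = h x.
Proof.
move=> pP sq; have [_ _ /(_ h)[h' e]] := pP _ _ _ _ _ (ker_exact sq).
by exists h' => x; rewrite -e.
Qed.

(** A projective module is a retract of its free cover. *)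
Lemma projective_lifts P : projective P -> lifts P.
Proof.
move=> pP.
have [|i iP] := @projective_onto P _ _ (fcover P) (idfun : {linear P -> P}) pP.
  by move=> x; exists (fbase R x); apply: fcoverE.
apply: (@lifts_retract _ _ i (fcover P) iP); exact: lifts_free.
Qed.

Lemma lifts_dsum (I : eqType) (P : I -> lmodType R) :
  (forall i, lifts (P i)) -> lifts (dsum P).
Proof.
move=> lP M N q h ex.
pose s i := cid (lP i M N q (h \o dinj P i : {linear P i -> N})
                    (fun x => ex (dinj P i x))).
exists (dlift (fun i => sval (s i))) => x.
apply: (@dsum_lin_ext _ _ _ _ (q \o dlift _) h) => i y /=.
by rewrite dliftE (svalP (s i)).
Qed.

Lemma injective_extend_sub (E U : lmodType R) (Y : submodule U)
    (h : {linear sub_of Y -> E}) : injective_module E ->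
  exists v : {linear U -> E}, forall x, v (sub_incl x) = h x.
Proof.
move=> iE; have [_ _ /(_ h)[v e]] := iE _ _ _ _ _ (sub_quot_exact Y).
by exists v => x; rewrite -e.
Qed.

Lemma injective_extend (E U : lmodType R) (Y : submodule U) (v : U -> E) :
  injective_module E ->
  (forall a x y, Y x -> Y y -> v (a *: x + y) = a *: v x + v y) ->
  exists v' : {linear U -> E}, forall x, Y x -> v' x = v x.
Proof.
move=> iE vlin.
have hlin : linear (fun u : sub_of Y => v (sub_incl u)).
  by move=> a x y; rewrite linearP vlin //; apply: sub_inclP.
have [v' e] := injective_extend_sub (mklin hlin) iE.
by exists v' => x hx; rewrite -(sub_mkE hx) e mklinE.
Qed.

Lemma hom_pre_exact (E L M N : lmodType R) (f : {linear L -> M})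
    (g : {linear M -> N}) : short_exact f g ->
  (forall h : {linear L -> E}, exists h' : {linear M -> E}, forall x, h' (f x) = h x) ->
  short_exact (hom_pre (E := E) g) (hom_pre (E := E) f).
Proof.
move=> [_ ex sg] ext; split.
- move=> h h' e; apply: linear_ext => z; have [y <-] := sg z.
  by have := congr1 (fun k : {linear M -> E} => k y) e.
- move=> h; split=> [e|[h' <-]]; last first.
    apply: linear_ext => x /=.
    by have -> : g (f x) = 0 by [apply/ex; exists x]; rewrite linear0.
  have hf x : h (f x) = 0 by have := congr1 (fun k : {linear L -> E} => k x) e.
  have [|||h' h'P] := @linear_choice _ N E (fun z v => exists2 y, g y = z & v = h y).
  + by move=> z; have [y <-] := sg z; exists (h y), y.
  + move=> z v v' [y <- ->] [y' e' ->]; apply/eqP; rewrite -subr_eq0 -linearB.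
    by have /ex[x <-] : g (y - y') = 0 by [rewrite linearB e' subrr]; rewrite hf.
  + move=> a _ _ _ _ [y <- ->] [y' <- ->]; exists (a *: y + y'); first exact: linearP.
    exact/esym/linearP.
  exists h'; apply: linear_ext => y /=.
  have [y' e' ->] := h'P (g y); apply/eqP; rewrite -subr_eq0 -linearB.
  by have /ex[x <-] : g (y' - y) = 0 by [rewrite linearB e' subrr]; rewrite hf.
- by move=> h; have [h' h'P] := ext h; exists h'; apply: linear_ext => x /=.
Qed.
End LiftProperty.

(** * Finitely generated submodules over a von Neumann regular ring *)

(** Finitely supported, jointly injective coordinates: the common feature of
    row vectors and of free modules on arbitrary bases. *)
Definition has_coords (R : pzRingType) (F : lmodType R) : Prop :=
  exists (K : eqType) (c : K -> {linear F -> R^o}),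
    (forall x, exists l : seq K, forall k, k \notin l -> c k x = 0) /\
    (forall x, (forall k, c k x = 0) -> x = 0).

Lemma free_coords (R : pzRingType) (K : eqType) : has_coords (fmod R K).
Proof.
exists K, (@fcoord R K); split=> [x|x h].
  by have [l []] := fcoord_supp x; exists l.
by apply: free_ext => k; rewrite h linear0.
Qed.

Lemma entry_linear (R : pzRingType) n (i : 'I_n) : linear (fun x : 'rV[R]_n => x 0 i : R^o).
Proof. by move=> a x y; rewrite !mxE. Qed.

Lemma rV_coords (R : pzRingType) n : has_coords 'rV[R]_n.
Proof.
exists 'I_n, (fun i => mklin (@entry_linear R n i)); split=> [x|x h].
  by exists (enum 'I_n) => k; rewrite mem_enum.
by apply/rowP => i; have := h i; rewrite mklinE mxE.
Qed.

Lemma lifts_rV (R : pzRingType) n : lifts 'rV[R]_n.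
Proof.
have lsum : linear (fun x : 'rV[R]_n => \sum_i x 0 i *: fbase R i : fmod R 'I_n).
  move=> a x y; rewrite scaler_sumr -big_split; apply: eq_bigr => i _ /=.
  by rewrite !mxE scalerDl scalerA.
pose i := mklin lsum; pose p := flift (fun i : 'I_n => delta_mx 0 i : 'rV[R]_n).
apply: (@lifts_retract _ _ _ i p _ (@lifts_free _ _)) => x.
rewrite mklinE raddf_sum [RHS]row_sum_delta; apply: eq_bigr => j _ /=.
by rewrite linearZ /= fliftE.
Qed.

Section LocalSplit.
Variables (R : pzRingType) (F : lmodType R).

Lemma corner_linear (e e' : {linear F -> F}) : linear (fun x => e x + e' (x - e x)).
Proof.
move=> a x y.
have -> : a *: x + y - e (a *: x + y) = a *: (x - e x) + (y - e y).
  by rewrite linearP scalerBr opprD addrACA.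
by rewrite !linearP scalerDr addrACA.
Qed.

(** If [e] splits off a part of a module and [e'] splits off what [1 - e] leaves
    of one more generator, then [e + e' (1 - e)] splits off both. *)
Definition corner (e e' : {linear F -> F}) := mklin (corner_linear e e').

Hypothesis vR : von_neumann_regular R.
Hypothesis cF : has_coords F.

(** Induction on the support of [y]: with [r = r x r] the coordinate at [k], the
    endomorphism [z |-> z_k x y] maps [y] to [r x y], and [y - r x y] has no
    coordinate at [k]. *)
Lemma split_cyclic (y : F) : exists e : {linear F -> F},
  (forall x, span [:: y] (e x)) /\ e y = y.
Proof.
have [K [c [fin sep]]] := cF.
have [l] := fin y; elim: l y => [|k l IH] y hl.
  exists (\0 : {linear F -> F}); split=> [x|] /=; first exact: (sm0 (span _)).
  by rewrite [RHS]sep // => k; apply: hl.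
have [x rx] := vR (c k y).
have elin : linear (fun z => ((c k z : R) * x) *: y).
  move=> a z z'; rewrite linearP mulrDl scalerDl scalerA; congr (_ *: _ + _).
  by rewrite mulrA.
pose e := mklin elin; have ey : e y = ((c k y : R) * x) *: y by rewrite mklinE.
have eY z : span [:: y] (e z) by rewrite mklinE; apply/smZ/span_mem/mem_head.
have [|e' [e'Y e'y]] := IH (y - e y).
  move=> j jl; rewrite ey linearB linearZ /=.
  have [->|jk] := eqVneq j k; first by rewrite {1}rx subrr.
  by rewrite [c j y]hl ?inE ?negb_or ?jk // scaler0 subr0.
exists (corner e e'); split=> [z|]; last by rewrite [LHS]mklinE e'y addrC subrK.
rewrite [corner _ _ _]mklinE; apply: smD => //; apply: span_min (e'Y _) => w.
by rewrite inE => /eqP ->; apply: smB => //; apply/span_mem/mem_head.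
Qed.

Lemma split_span (l : seq F) : exists e : {linear F -> F},
  (forall x, span l (e x)) /\ forall y, span l y -> e y = y.
Proof.
elim: l => [|y l [e [eY e1]]].
  exists (\0 : {linear F -> F}); split=> [x|x /span_nil ->] //; exact: (sm0 (span _)).
have [e' [e'Y e'y]] := split_cyclic (y - e y).
have lY z : span l z -> span (y :: l) z.
  by apply: span_sub => w wl; rewrite inE wl orbT.
exists (corner e e'); split=> z.
  rewrite [corner _ _ _]mklinE; apply: smD; first exact: lY.
  apply: span_min (e'Y _) => w; rewrite inE => /eqP ->; apply: smB; last exact: lY.
  exact/span_mem/mem_head.
move=> /span_cons[a [x [/e1 ex ->]]]; rewrite linearP; congr (_ *: _ + _); rewrite mklinE.
  by rewrite e'y addrC subrK.
by rewrite ex subrr linear0 addr0.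
Qed.
End LocalSplit.

Section RegularPure.
Variable R : pzRingType.
Hypothesis vR : von_neumann_regular R.

(** The relations of a finitely presented module span a direct summand of
    R^n, so the module is a retract of R^n. *)
Lemma fp_lifts (A : lmodType R) : finitely_presented A -> lifts A.
Proof.
move=> [m [n [r [p [sp ep]]]]].
pose l := [seq r (delta_mx 0 i) | i : 'I_m].
have im_r x : span l (r x).
  rewrite [x]row_sum_delta linear_sum; apply: (@sm_sum _ _ (span l)) => i _.
  rewrite linearZ /=; apply: (@smZ _ _ (span l)).
  by apply/span_mem/map_f; rewrite mem_enum.
have ker_p y : span l y -> p y = 0.
  apply: lin_ext_span => _ /mapP[i _ ->]; by apply/ep; exists (delta_mx 0 i).
have [e [eY e1]] := split_span vR (rV_coords R n) l.
have [|||i iP] := @linear_choice _ A 'rV[R]_n (fun a z => exists2 y, p y = a & z = y - e y).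
- by move=> a; have [y <-] := sp a; exists (y - e y), y.
- move=> a z z' [y <- ->] [y' e' ->].
  have : p (y' - y) = 0 by rewrite linearB e' subrr.
  move=> /ep[x xe]; have := e1 _ (im_r x); rewrite xe linearB => h.
  have -> : e y' = e y + (y' - y) by rewrite -h addrC subrK.
  by rewrite opprD opprB addrCA [y' + (y - y')]addrC subrK addrC.
- move=> a _ _ z z' [y <- ->] [y' <- ->]; exists (a *: y + y'); rewrite linearP //.
  by rewrite opprD scalerBr addrACA.
apply: (@lifts_retract _ _ _ i p _ (@lifts_rV _ _)) => a.
by have [y <- ->] := iP a; rewrite linearB [p (e y)]ker_p // subr0.
Qed.

Lemma exact_pure (L M N : lmodType R) (f : {linear L -> M}) (g : {linear M -> N}) :
  short_exact f g -> pure_exact f g.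
Proof.
move=> fg; split=> // A /fp_lifts lA; apply: hom_post_exact => // h.
by apply: lA => x; have [_ _] := fg; apply.
Qed.
End RegularPure.

(** * Exactness of the tensor product over a von Neumann regular ring *)

Section TensorSums.
Variables (R : pzRingType) (N : lmodType R^c) (M : lmodType R).

Definition psum (l : seq (N * M)) : tensor N M := \sum_(p <- l) ptensor p.1 p.2.

Lemma ptensorNl (x : N) (y : M) : ptensor (- x) y = - ptensor x y.
Proof. by apply/eqP; rewrite -addr_eq0 -ptensorDl addNr ptensor0l. Qed.

Lemma ptensorBr (x : N) (y y' : M) : ptensor x (y - y') = ptensor x y - ptensor x y'.
Proof. by apply/eqP; rewrite eq_sym subr_eq -ptensorDr subrK. Qed.

Lemma ptensor_sumr (I : Type) (s : seq I) (x : N) (y : I -> M) :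
  ptensor x (\sum_(i <- s) y i) = \sum_(i <- s) ptensor x (y i).
Proof.
elim: s => [|i s IH]; first by rewrite !big_nil ptensor0r.
by rewrite !big_cons ptensorDr IH.
Qed.

Lemma ptensor_suml (I : Type) (s : seq I) (x : I -> N) (y : M) :
  ptensor (\sum_(i <- s) x i) y = \sum_(i <- s) ptensor (x i) y.
Proof.
elim: s => [|i s IH]; first by rewrite !big_nil ptensor0l.
by rewrite !big_cons ptensorDl IH.
Qed.

Lemma psumN l : - psum l = psum [seq (- p.1, p.2) | p <- l].
Proof.
rewrite /psum big_map -sumrN; apply: eq_bigr => p _ /=.
by rewrite ptensorNl.
Qed.


Lemma tensor_sub (Y : subgroup (tensor N M)) :
  (forall x y, Y (ptensor x y)) -> forall t, Y t.
Proof.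
move=> hY t; apply/zpi_eq0.
apply: (@tensor_ext _ _ _ _ (zpi Y) \0) => x y; exact/zpi_eq0.
Qed.

Lemma tensor_psum (t : tensor N M) : exists l, t = psum l.
Proof.
have @Y : subgroup (tensor N M).
  exists (fun t => exists l, t = psum l); first by exists [::]; rewrite /psum big_nil.
  move=> _ _ [l ->] [l' ->]; exists (l ++ [seq (- p.1, p.2) | p <- l']).
  by rewrite psumN /psum big_cat.
apply: (@tensor_sub Y) => x y.
by exists [:: (x, y)]; rewrite /psum big_seq1.
Qed.
End TensorSums.

Section TensorMaps.
Variable R : pzRingType.

Lemma tensor_map_compE (N N' N'' : lmodType R^c) (M M' M'' : lmodType R)
    (f : {linear N -> N'}) (f' : {linear N' -> N''}) (h : {linear N -> N''})
    (g : {linear M -> M'}) (g' : {linear M' -> M''}) (k : {linear M -> M''}) t :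
  (forall x, f' (f x) = h x) -> (forall y, g' (g y) = k y) ->
  tensor_map f' g' (tensor_map f g t) = tensor_map h k t.
Proof.
move=> fh gk.
apply: (@tensor_ext _ _ _ _ (tensor_map f' g' \o tensor_map f g) (tensor_map h k)).
by move=> x y; rewrite /= !tensor_mapE fh gk.
Qed.

Lemma tensor_map_sum (N N' : lmodType R^c) (M M' : lmodType R)
    (f : {linear N -> N'}) (g : {linear M -> M'}) (I : Type) (s : seq I) x y :
  tensor_map f g (\sum_(i <- s) ptensor (x i) (y i)) =
  \sum_(i <- s) ptensor (f (x i)) (g (y i)).
Proof.
elim: s => [|i s IH]; first by rewrite !big_nil raddf0.
by rewrite !big_cons raddfD /= IH tensor_mapE.
Qed.

Lemma tensor_map_psum (N N' : lmodType R^c) (M M' : lmodType R)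
    (f : {linear N -> N'}) (g : {linear M -> M'}) l :
  tensor_map f g (psum l) = psum [seq (f p.1, g p.2) | p <- l].
Proof. by rewrite /psum big_map tensor_map_sum. Qed.

Section Kernel.
Variables (N : lmodType R^c) (P M : lmodType R) (q : {linear P -> M}).
Hypothesis sq : forall y, exists x, q x = y.

(** The elements [n (x) k] with [q k = 0] span the kernel of [N (x) q]: modulo
    their span, [n (x) y] depends only on [n] and [q y], which gives an inverse
    of [N (x) q] on the quotient. *)
Lemma tensor_kernel (s : tensor N P) :
  tensor_map (idfun : {linear N -> N}) q s = 0 ->
  exists l, (forall p, p \in l -> q p.2 = 0) /\ s = psum l.
Proof.
have @Y : subgroup (tensor N P).
  exists (fun s => exists l, (forall p, p \in l -> q p.2 = 0) /\ s = psum l).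
    by exists [::]; rewrite /psum big_nil.
  move=> _ _ [l [hl ->]] [l' [hl' ->]]; exists (l ++ [seq (- p.1, p.2) | p <- l']).
  split=> [p|]; last by rewrite psumN /psum big_cat.
  by rewrite mem_cat => /orP[/hl //|/mapP[p' /hl' ? ->]].
have inY x y : q y = 0 -> Y (ptensor x y).
  move=> qy; exists [:: (x, y)]; rewrite /psum big_seq1; split=> // p.
  by rewrite inE => /eqP ->.
have [r rq] := choice sq.
pose b (x : N) (y : M) : zquot Y := zpi Y (ptensor x (r y)).
have bE x y : b x (q y) = zpi Y (ptensor x y).
  by apply/zpi_eq; rewrite -ptensorBr; apply: inY; rewrite linearB rq subrr.
have bDl x x' y : b (x + x') y = b x y + b x' y by rewrite /b ptensorDl raddfD.
have bDr x y y' : b x (y + y') = b x y + b x y'.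
  by rewrite -[y]rq -[y']rq -linearD !bE ptensorDr raddfD.
have bZ x (a : R) y : b ((a : R^c) *: x) y = b x (a *: y).
  by rewrite -[y]rq -linearZ !bE ptensorZ.
move=> qs; suff /zpi_eq0 : zpi Y s = 0 by [].
have <- : mkadd (tensor_lift_is_zmod_morphism bDl bDr bZ)
    (tensor_map (idfun : {linear N -> N}) q s) = zpi Y s; last by rewrite qs raddf0.
apply: (@tensor_ext _ _ _ _ (mkadd _ \o tensor_map (idfun : {linear N -> N}) q)) => x y /=.
by rewrite mkaddE tensor_mapE tensor_liftE //= bE.
Qed.
End Kernel.

Section FreeCoords.
Variables (N : lmodType R^c) (K : eqType).

Let b k (x : N) (y : fmod R K) : N := (fcoord k y : R^c) *: x.

Let bDl k x x' y : b k (x + x') y = b k x y + b k x' y.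
Proof. exact: scalerDr. Qed.
Let bDr k x y y' : b k x (y + y') = b k x y + b k x y'.
Proof. by rewrite /b linearD; apply: (@scalerDl R^c). Qed.
Let bZ k x (a : R) y : b k ((a : R^c) *: x) y = b k x (a *: y).
Proof. by rewrite /b linearZ scalerA. Qed.

Definition tcoord k : {additive tensor N (fmod R K) -> N} :=
  mkadd (tensor_lift_is_zmod_morphism (@bDl k) (@bDr k) (@bZ k)).

Lemma tcoordE k x y : tcoord k (ptensor x y) = (fcoord k y : R^c) *: x.
Proof.
by rewrite mkaddE tensor_liftE; [| exact: bDl | exact: bDr | exact: bZ].
Qed.

(** N (x) R^(K) is the direct sum of copies of N. *)
Lemma tensor_freeE (t : tensor N (fmod R K)) :
  exists l, t = \sum_(k <- l) ptensor (tcoord k t) (fbase R k).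
Proof.
have [s ->] := tensor_psum t.
have [l [ul hl]] : exists l : seq K, uniq l /\
    forall p, p \in s -> forall k, k \notin l -> fcoord k p.2 = 0.
  elim: s => [|p s [l [ul IH]]]; first by exists [::].
  have [l' [ul' hl']] := fcoord_supp p.2.
  exists (undup (l ++ l')); rewrite undup_uniq; split=> // p'.
  rewrite inE => /predU1P[->|p's] k; rewrite mem_undup mem_cat negb_or => /andP[kl kl'].
    exact: hl'.
  exact: IH kl.
exists l; rewrite /psum.
under [RHS]eq_bigr => k _ do rewrite raddf_sum ptensor_suml.
rewrite exchange_big /=; apply: eq_big_seq => p ps.
rewrite {1}(fmodE ul (hl p ps)) ptensor_sumr; apply: eq_bigr => k _.
by rewrite tcoordE ptensorZ.
Qed.
End FreeCoords.

Arguments tcoord {N K}.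

Lemma tcoord_map (N N' : lmodType R^c) (K : eqType) (f : {linear N -> N'}) (k : K) t :
  tcoord k (tensor_map f (idfun : {linear fmod R K -> fmod R K}) t) = f (tcoord k t).
Proof.
apply: (@tensor_ext _ _ _ _ (tcoord k \o tensor_map f _) (f \o tcoord k)) => x y /=.
by rewrite tensor_mapE !tcoordE linearZ.
Qed.

Section Exact.
Hypothesis vR : von_neumann_regular R.

(** Lift [t] to B (x) F with F the free cover of M. Its image in C (x) F is a sum
    of tensors with relations of M; subtracting the projection onto the span of
    these relations does not change [t], and makes the coordinates vanish in C. *)
Lemma tensor_exact_l (A B C : lmodType R^c) (f : {linear A -> B}) (g : {linear B -> C})
    (M : lmodType R) : (forall y, g y = 0 -> exists x, f x = y) ->
  forall t, tensor_map g (idfun : {linear M -> M}) t = 0 ->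
  exists s, tensor_map f (idfun : {linear M -> M}) s = t.
Proof.
move=> fg t0 gt; have [L tL] := tensor_psum t0.
pose q := fcover M; pose F := fmod R M.
pose idF : {linear F -> F} := idfun.
pose t := psum [seq (p.1, fbase R p.2) | p <- L] : tensor B F.
have qt : tensor_map (idfun : {linear B -> B}) q t = t0.
  rewrite tL tensor_map_psum -map_comp /psum big_map; apply: eq_bigr => p _ /=.
  by rewrite fcoverE.
have [||l [hl ul]] := @tensor_kernel C F M q _ (tensor_map g idF t).
- by move=> y; exists (fbase R y); apply: fcoverE.
- rewrite (@tensor_map_compE _ _ _ _ _ _ g idfun g idF q q) // -gt -qt.
  by rewrite (@tensor_map_compE _ _ _ _ _ _ idfun g g q idfun q).
have [e [eY e1]] := split_span vR (free_coords R M) [seq p.2 | p <- l].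
have qe x : q (e x) = 0.
  by apply: lin_ext_span (eY x) => _ /mapP[p pl ->]; apply: hl.
pose t' := t - tensor_map (idfun : {linear B -> B}) e t.
have gt' : tensor_map g idF t' = 0.
  rewrite raddfB /= (@tensor_map_compE _ _ _ _ _ _ _ _ g _ _ e) //.
  rewrite -(@tensor_map_compE _ _ _ _ _ _ g idfun g idF e e) // ul.
  rewrite tensor_map_psum /psum big_map -sumrB big1_seq // => p /= pl.
  by rewrite e1 ?subrr //; apply/span_mem/map_f.
have qt' : tensor_map (idfun : {linear B -> B}) q t' = t0.
  rewrite raddfB /= qt (@tensor_map_compE _ _ _ _ _ _ _ _ idfun _ _ \0) //.
  by rewrite tensor_map_eq0 ?subr0 //; right.
have [l' t'E] := tensor_freeE t'.
have ex k : exists a, f a = tcoord k t'.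
  by apply: fg; rewrite -tcoord_map gt' raddf0.
have [a aP] := choice ex.
exists (tensor_map (idfun : {linear A -> A}) q (\sum_(k <- l') ptensor (a k) (fbase R k))).
rewrite -qt' t'E !tensor_map_sum; apply: eq_bigr => k _ /=.
by rewrite aP.
Qed.

(** Write [t] as a sum of tensors [x (x) y] and cover M'' by a free module F. The
    element of N (x) F with terms [x (x) [g y]] is a sum of tensors [n (x) k] with
    relations [k]. All these elements of F lie in a direct summand that maps to
    the image of [g], hence lifts to M'; under the lift the [y] are recovered
    modulo the image of [f], and the [k] land in that image. *)
Lemma tensor_exact_r (N : lmodType R^c) (M M' M'' : lmodType R)
    (f : {linear M -> M'}) (g : {linear M' -> M''}) :
  (forall y, g y = 0 -> exists x, f x = y) ->
  forall t, tensor_map (idfun : {linear N -> N}) g t = 0 ->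
  exists s, tensor_map (idfun : {linear N -> N}) f s = t.
Proof.
move=> fg t gt; have [L tL] := tensor_psum t.
pose q := fcover M''; pose F := fmod R M''.
pose s := psum [seq (p.1, fbase R (g p.2)) | p <- L] : tensor N F.
have [||l [hl sl]] := @tensor_kernel N F M'' q _ s.
- by move=> y; exists (fbase R y); apply: fcoverE.
- rewrite -gt tL !tensor_map_psum -map_comp /psum !big_map; apply: eq_bigr => p _ /=.
  by rewrite fcoverE.
pose m := [seq fbase R (g p.2) | p <- L] ++ [seq p.2 | p <- l].
have [e [eY e1]] := split_span vR (free_coords R M'') m.
have [|h gh] := @lifts_free R M'' M' M'' g (q \o e : {linear F -> M''}).
  move=> x /=; apply: (span_min (Y := preim_sm q (range_sm g)) _ (eY x)) => y.
  rewrite mem_cat => /orP[/mapP[p _ ->]|/mapP[p pl ->]] /=.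
    by exists p.2; rewrite fcoverE.
  by exists 0; rewrite linear0 hl.
have inf x y : g y = 0 -> exists u, tensor_map (idfun : {linear N -> N}) f u = ptensor x y.
  by move=> /fg[z <-]; exists (ptensor x z); rewrite tensor_mapE.
pose q' : {linear F -> M'} := h.
have hm x : span m x -> g (q' x) = q x by move=> xm; rewrite gh /= e1.
have @Y : subgroup (tensor N M').
  exists (fun t => exists u, tensor_map (idfun : {linear N -> N}) f u = t).
    by exists 0; rewrite raddf0.
  by move=> _ _ [u <-] [u' <-]; exists (u - u'); rewrite raddfB.
have Ysum l' : (forall p, p \in l' -> g p.2 = 0) -> Y (psum l').
  move=> h'; rewrite /psum big_seq; elim/big_ind: _ => //.
  - exact: (sg0 Y).
  - exact: (@sgD _ Y).
  - by move=> p /h'; apply: inf.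
have tE : t = psum [seq (p.1, p.2 - q' (fbase R (g p.2))) | p <- L]
            + psum [seq (p.1, q' p.2) | p <- l].
  have -> : psum [seq (p.1, q' p.2) | p <- l] = tensor_map (idfun : {linear N -> N}) q' s.
    by rewrite sl tensor_map_psum.
  rewrite tL tensor_map_psum -map_comp /psum !big_map -big_split.
  by apply: eq_bigr => p _ /=; rewrite ptensorBr subrK.
rewrite tE; apply: (@sgD _ Y); apply: Ysum => _ /mapP[p pl ->] /=.
  rewrite linearB hm ?fcoverE ?subrr //; apply: span_mem.
  by rewrite mem_cat; apply/orP; left; apply/mapP; exists p.
rewrite hm ?hl //; apply: span_mem.
by rewrite mem_cat; apply/orP; right; apply/mapP; exists p.
Qed.
End Exact.
End TensorMaps.

(** * Semi-flat complexes *)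

Section FlatModules.
Variable R : pzRingType.

Lemma tensor_surj (N N' : lmodType R^c) (M M' : lmodType R)
    (f : {linear N -> N'}) (g : {linear M -> M'}) :
  (forall y, exists x, f x = y) -> (forall y, exists x, g x = y) ->
  forall t, exists s, tensor_map f g s = t.
Proof.
move=> sf sg.
have @Y : subgroup (tensor N' M').
  exists (fun t => exists s, tensor_map f g s = t); first by exists 0; rewrite raddf0.
  by move=> _ _ [s <-] [s' <-]; exists (s - s'); rewrite raddfB.
apply: (@tensor_sub _ _ _ Y) => x' y'.
by have [[x <-] [y <-]] := (sf x', sg y'); exists (ptensor x y); rewrite tensor_mapE.
Qed.

Hypothesis vR : von_neumann_regular R.

Lemma tensor_inj_l (A B : lmodType R^c) (f : {linear A -> B}) (M : lmodType R) :
  injective f -> injective (tensor_map f (idfun : {linear M -> M})).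
Proof.
move=> injf t t' e; apply/eqP; rewrite -subr_eq0; apply/eqP.
have [||s <-] := @tensor_exact_l _ vR A A B (\0 : {linear A -> A}) f M _ (t - t').
- by move=> y fy; exists 0; apply: injf; rewrite fy /= linear0.
- by rewrite raddfB /= e subrr.
- by apply: tensor_map_eq0; left.
Qed.

Lemma tensor_inj_r (N : lmodType R^c) (A B : lmodType R) (f : {linear A -> B}) :
  injective f -> injective (tensor_map (idfun : {linear N -> N}) f).
Proof.
move=> injf t t' e; apply/eqP; rewrite -subr_eq0; apply/eqP.
have [||s <-] := @tensor_exact_r _ vR N A A B (\0 : {linear A -> A}) f _ (t - t').
- by move=> y fy; exists 0; apply: injf; rewrite fy /= linear0.
- by rewrite raddfB /= e subrr.
- by apply: tensor_map_eq0; right.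
Qed.

Lemma regular_flat (F : lmodType R) : flat F.
Proof.
move=> A B C f g [injf fg sg]; split.
- exact: tensor_inj_l.
- move=> t; split=> [gt|[s <-]].
    by apply: (tensor_exact_l vR _ gt) => y /fg.
  rewrite (@tensor_map_compE _ _ _ _ _ _ _ f g \0 _ _ idfun) //.
    by apply: tensor_map_eq0; left.
  by move=> x; apply/fg; exists x.
- by apply: tensor_surj => // y; exists y.
Qed.
End FlatModules.

(** Indices [i' + 1 = i] as hypotheses, to avoid transport between [i - 1 + 1]
    and [i]. *)
Lemma acyclic_at (S : pzRingType) (M : complex S) : acyclic (forget M) ->
  forall i i' i'', i' + 1 = i -> i'' + 1 = i' -> forall x : M i', cx_d M i' i'' x = 0 ->
  exists y : M i, cx_d M i i' y = x.
Proof.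
move=> acM i i' i'' <- e x; have -> : i'' = i' - 1 by rewrite -e addrK.
exact: acM.
Qed.

Section SemiFlat.
Variables (R : pzRingType) (N : complex R^c) (F : complex R).
Hypothesis vR : von_neumann_regular R.
Hypothesis acN : acyclic (forget N).

Local Notation tm := tensor_map.

Lemma tensor_acyclic_at (G : lmodType R) i i' i'' : i' + 1 = i -> i'' + 1 = i' ->
  forall t : tensor (N i') G, tm (cx_d N i' i'') (idfun : {linear G -> G}) t = 0 ->
  exists s : tensor (N i) G, tm (cx_d N i i') (idfun : {linear G -> G}) s = t.
Proof.
by move=> e e' t; apply: (tensor_exact_l vR) => y; apply: (acyclic_at acN e e').
Qed.

Lemma tensor_cycles (A : lmodType R^c) j : forall t : tensor A (F j),
  tm (idfun : {linear A -> A}) (cx_d F j (j - 1)) t = 0 ->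
  exists s, tm (idfun : {linear A -> A}) (cycles_incl F j) s = t.
Proof.
move=> t; apply: (tensor_exact_r vR) => y /eqP dy.
by exists (Ker dy).
Qed.

Lemma cycles_incl_inj j : injective (cycles_incl F j).
Proof. exact: val_inj. Qed.

Let cycles_d j z : cx_d F j (j - 1) (cycles_incl F j z) = 0.
Proof. by apply/eqP; case: z. Qed.

(** The image of [t] under [d (x) 1] lies in N (x) Z(F), where it is a cycle and
    hence a boundary. Subtracting a preimage from N (x) Z(F) does not affect
    [(1 (x) d) t] and leaves a cycle of [d (x) 1]. *)
Lemma tensor_dd_lift i i' j : i' + 1 = i -> forall t : tensor (N i') (F j),
  tm (cx_d N i' (i' - 1)) (cx_d F j (j - 1)) t = 0 ->
  exists v : tensor (N i) (F j),
    tm (cx_d N i i') (cx_d F j (j - 1)) v =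
    tm (idfun : {linear N i' -> N i'}) (cx_d F j (j - 1)) t.
Proof.
move=> e t ddt.
have [|z zE] := @tensor_cycles (N (i' - 1)) j
    (tm (cx_d N i' (i' - 1)) (idfun : {linear F j -> F j}) t).
  by rewrite (@tensor_map_compE _ _ _ _ _ _ _ _ _ (cx_d N i' (i' - 1)) _ _ (cx_d F j (j - 1))).
have [|||z' z'E] := @tensor_acyclic_at (cycles F j) i' (i' - 1) (i' - 1 - 1) _ _ z.
- by rewrite subrK.
- by rewrite subrK.
- apply: (tensor_inj_r vR (@cycles_incl_inj j)); rewrite raddf0 /=.
  rewrite (@tensor_map_compE _ _ _ _ _ _ _ _ idfun (cx_d N (i' - 1) (i' - 1 - 1)) _ _ (cycles_incl F j)) //.
  rewrite -(@tensor_map_compE _ _ _ _ _ _ _ idfun (cx_d N (i' - 1) (i' - 1 - 1)) (cx_d N (i' - 1) (i' - 1 - 1))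
    (cycles_incl F j) idfun (cycles_incl F j)) // zE.
  rewrite (@tensor_map_compE _ _ _ _ _ _ _ _ _ \0 _ _ idfun) //.
    by apply: tensor_map_eq0; left.
  by move=> x; apply: cx_dd.
pose u := t - tm (idfun : {linear N i' -> N i'}) (cycles_incl F j) z'.
have [||v vE] := @tensor_acyclic_at (F j) i i' (i' - 1) e _ u.
- by rewrite subrK.
- rewrite raddfB /= -zE -z'E; apply/eqP; rewrite subr_eq0; apply/eqP.
  by rewrite !(@tensor_map_compE _ _ _ _ _ _ _ _ _ (cx_d N i' (i' - 1)) _ _ (cycles_incl F j)).
exists v.
rewrite -(@tensor_map_compE _ _ _ _ _ _ _ (cx_d N i i') idfun _ idfun (cx_d F j (j - 1))) // vE.
rewrite raddfB /= (@tensor_map_compE _ _ _ _ _ _ _ _ _ idfun _ _ \0) //.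
by rewrite [tm _ \0 _]tensor_map_eq0 ?subr0 //; right.
Qed.

Section Part.
Variable n : int.
Implicit Type t : tensor_part N F n.

(** Pointwise choices in bidegrees (i, j) form an element of the direct sum as
    soon as zero can be chosen wherever [t] vanishes. *)
Lemma tensor_part_lift (t : tensor_part N F n)
    (Q : forall i i' j, tensor (N i) (F j) -> Prop) :
  (forall i i' j, i' + 1 = i -> tensor_val t i' j = 0 -> Q i i' j 0) ->
  (forall i i' j, i' + 1 = i -> exists w, Q i i' j w) ->
  exists w : tensor_part N F (n + 1), forall i i' j, i' + 1 = i -> Q i i' j (tensor_val w i j).
Proof.
move=> Q0 Qex.
have ex i j : {w | Q i (i - 1) j w /\ (tensor_val t (i - 1) j = 0 -> w = 0)}.
  apply: cid; have [t0|t0] := pselect (tensor_val t (i - 1) j = 0).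
    by exists 0; split=> //; apply: Q0; rewrite ?subrK.
  by have [|w hw] := Qex i (i - 1) j; [rewrite subrK | exists w; split].
pose w : bifamily (fun i j => tensor (N i) (F j)) := fun i j => sval (ex i j).
have w0 i j : tensor_val t (i - 1) j = 0 -> w i j = 0.
  by have [_] := svalP (ex i j).
have wP : w \in @tensor_deg R N F (n + 1).
  have := tensor_valP t; rewrite !unfold_in => /asboolP[td [s ts]].
  apply/asboolP; split=> [i j ij|]; first by apply/w0/td; lia.
  exists [seq (k.1 + 1, k.2) | k <- s] => i j ij; apply/w0/ts.
  by apply: contra ij => /(map_f (fun k => (k.1 + 1, k.2))); rewrite /= subrK.
exists (TensorPart wP) => i i' j e /=; have -> : i' = i - 1 by rewrite -e addrK.
by have [] := svalP (ex i j).
Qed.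

End Part.

Lemma tensor_cycleP n (t : tensor_part N F n) :
  @tensor_d_fun _ N F n (n - 1) t = 0 -> forall i i' j j', i' + 1 = i -> j' + 1 = j ->
  tm (cx_d N i i') (idfun : {linear F j' -> F j'}) (tensor_val t i j') =
  - (tm (idfun : {linear N i' -> N i'}) (cx_d F j j') (tensor_val t i' j)
     *~ (-1) ^+ `|i'|%N).
Proof.
move=> dt i i' j j' <- <-; apply/eqP; rewrite -addr_eq0; apply/eqP.
have := congr1 (fun u => tensor_val u i' j') dt.
by rewrite /= subrK eqxx.
Qed.

(** In two steps a cycle [t] is reduced to zero: a first boundary makes it lie in
    N (x) Z(F), by [tensor_dd_lift]; N (x) Z(F) is acyclic because Z(F) is flat. *)
Lemma tensor_acyclic : acyclic (tensor_complex N F).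
Proof.
move=> n t /= dt; have tP := tensor_cycleP dt.
have [||w wP] := @tensor_part_lift n t (fun i i' j w =>
    tm (cx_d N i i') (cx_d F j (j - 1)) w =
    tm (idfun : {linear N i' -> N i'}) (cx_d F j (j - 1)) (tensor_val t i' j)).
- by move=> i i' j _ ->; rewrite !raddf0.
- move=> i i' j e; apply: tensor_dd_lift e _ _.
  rewrite -(@tensor_map_compE _ _ _ _ _ _ _ (cx_d N i' (i' - 1)) idfun _ idfun (cx_d F j (j - 1))) //.
  rewrite (tP i' (i' - 1) (j + 1) j) ?subrK // raddfN /= raddfMz /=.
  rewrite (@tensor_map_compE _ _ _ _ _ _ _ _ _ idfun _ _ \0) //; last exact: cx_dd.
  by rewrite tensor_map_eq0 ?mul0rz ?oppr0 //; right.
pose t' := t - @tensor_d_fun _ N F (n + 1) n w.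
have t'E i j : tensor_val t' i j = tensor_val t i j
    - (tm (cx_d N (i + 1) i) (idfun : {linear F j -> F j}) (tensor_val w (i + 1) j)
    + tm (idfun : {linear N i -> N i}) (cx_d F (j + 1) j) (tensor_val w i (j + 1))
      *~ (-1) ^+ `|i|%N).
  by rewrite /t' /= eqxx.
have dt' : @tensor_d_fun _ N F n (n - 1) t' = 0.
  by rewrite /t' raddfB /= dt tensor_dd subr0.
have t'P := tensor_cycleP dt'.
have d2t' i j : tm (idfun : {linear N i -> N i}) (cx_d F j (j - 1)) (tensor_val t' i j) = 0.
  rewrite t'E raddfB raddfD /= raddfMz /=.
  rewrite (@tensor_map_compE _ _ _ _ _ _ _ _ _ (cx_d N (i + 1) i) _ _ (cx_d F j (j - 1))) //.
  rewrite (@tensor_map_compE _ _ _ _ _ _ _ _ _ idfun _ _ \0) //; last exact: cx_dd.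
  rewrite [X in _ + X *~ _]tensor_map_eq0 ?mul0rz ?addr0; last by right.
  by rewrite wP // subrr.
have [||y yP] := @tensor_part_lift n t' (fun i i' j y =>
    tm (cx_d N i i') (idfun : {linear F j -> F j}) y = tensor_val t' i' j /\
    tm (idfun : {linear N i -> N i}) (cx_d F j (j - 1)) y = 0).
- by move=> i i' j _ ->; rewrite !raddf0.
- move=> i i' j e; have [z zE] := tensor_cycles (d2t' i' j).
  have [||z' z'E] := @tensor_acyclic_at (cycles F j) i i' (i' - 1) e _ z.
  + by rewrite subrK.
  + apply: (tensor_inj_r vR (@cycles_incl_inj j)); rewrite raddf0 /=.
    rewrite (@tensor_map_compE _ _ _ _ _ _ _ _ idfun (cx_d N i' (i' - 1)) _ _ (cycles_incl F j)) //.
    rewrite -(@tensor_map_compE _ _ _ _ _ _ _ idfun (cx_d N i' (i' - 1)) (cx_d N i' (i' - 1))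
      (cycles_incl F j) idfun (cycles_incl F j)) // zE.
    rewrite (t'P i' (i' - 1) (j + 1) j) ?subrK //.
    have := d2t' (i' - 1) (j + 1); rewrite addrK => ->.
    by rewrite mul0rz oppr0.
  exists (tm (idfun : {linear N i -> N i}) (cycles_incl F j) z'); split.
    rewrite -zE -z'E.
    by rewrite !(@tensor_map_compE _ _ _ _ _ _ _ _ _ (cx_d N i i') _ _ (cycles_incl F j)).
  rewrite (@tensor_map_compE _ _ _ _ _ _ _ _ _ idfun _ _ \0) //.
  by rewrite tensor_map_eq0 //; right.
exists (w + y); rewrite raddfD /=.
have -> : @tensor_d_fun _ N F (n + 1) n y = t'.
  apply: val_inj => /=; rewrite eqxx; apply: bifamily_ext => i j; rewrite /tensor_d_val.
  have [-> _] := yP (i + 1) i j erefl.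
  have [_] := yP i (i - 1) (j + 1) (subrK _ _); rewrite addrK => ->.
  by rewrite mul0rz addr0 t'E.
by rewrite addrC subrK.
Qed.
End SemiFlat.

Lemma regular_semi_flat (R : pzRingType) (vR : von_neumann_regular R) (F : complex R) :
  semi_flat F.
Proof.
by split=> [i|N acN]; [apply: regular_flat | apply: tensor_acyclic].
Qed.

Lemma regular_pure_acyclic (R : pzRingType) : von_neumann_regular R ->
  forall M : complex R, acyclic (forget M) -> pure_acyclic M.
Proof.
move=> vR M acM; split=> // i; apply: exact_pure => //.
split=> [|y|z].
- exact: val_inj.
- split=> [/(congr1 val) /= e|[x <-]].
    by exists (Ker (introT eqP e)).
  by apply: val_inj => /=; apply/eqP; case: x.
- have [|||y yE] := @acyclic_at _ _ acM i (i - 1) (i - 1 - 1) _ _ (ker_val z).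
  + exact: subrK.
  + exact: subrK.
  + by apply/eqP; case: z.
  by exists y; apply: val_inj.
Qed.

(** * Recovering regularity *)

Section Principal.
Variables (R : pzRingType) (a : R).

Definition principal : submodule (R^o : lmodType R).
Proof.
exists (fun x => exists r, x = r * a); first by exists 0; rewrite mul0r.
by move=> b _ _ [r ->] [s ->]; exists (b * r + s); rewrite mulrDl -mulrA.
Defined.

Definition cyclic_quot : lmodType R := quot_of principal.
Definition cyclic_pi : {linear R^o -> cyclic_quot} := quot_pi principal.

Lemma cyclic_pi_eq0 x : cyclic_pi x = 0 <-> exists r, x = r * a.
Proof. exact: quot_pi_eq0. Qed.

Lemma cyclic_quot_fp : finitely_presented cyclic_quot.
Proof.
have rlin : linear (fun x : 'rV[R]_1 => const_mx (x 0 0 * a) : 'rV[R]_1).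
  by move=> b x y; apply/rowP => i; rewrite !mxE mulrDl mulrA.
have plin : linear (fun x : 'rV[R]_1 => cyclic_pi (x 0 0)).
  by move=> b x y; rewrite !mxE -linearP.
exists 1, 1, (mklin rlin), (mklin plin); split=> [u|y].
  have [x <-] := quot_pi_surj u; exists (const_mx x).
  by rewrite (mklinE plin) mxE.
rewrite (mklinE plin); split=> [/cyclic_pi_eq0[r yr]|[x <-]].
  exists (const_mx r); rewrite (mklinE rlin); apply/rowP => i.
  by rewrite !mxE [i]ord1 yr.
by rewrite (mklinE rlin) mxE; apply/cyclic_pi_eq0; exists (x 0 0).
Qed.

(** A splitting of R -> R/Ra sends the class of 1 to some [e] with [a e = 0] and
    [1 - e] in Ra. *)
Lemma cyclic_split (s : {linear cyclic_quot -> R^o}) :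
  (forall u, cyclic_pi (s u) = u) -> exists x, a = a * x * a.
Proof.
move=> sP; pose e : R := s (cyclic_pi 1).
have /cyclic_pi_eq0[x xE] : cyclic_pi (1 - e) = 0 by rewrite linearB sP subrr.
exists x; rewrite -mulrA -xE mulrBr mulr1.
have -> : a * e = 0; last by rewrite subr0.
have -> : a * e = s (cyclic_pi (a *: (1 : R^o))) by rewrite !linearZ.
have -> : cyclic_pi (a *: (1 : R^o)) = 0; last by rewrite linear0.
by apply/cyclic_pi_eq0; exists 1; rewrite mul1r; apply: mulr1.
Qed.

Lemma cyclic_quot_projective : projective cyclic_quot -> exists x, a = a * x * a.
Proof.
move=> pP; have [|s sP] := @projective_onto _ _ _ _ cyclic_pi idfun pP.
  exact: quot_pi_surj.
exact: (cyclic_split sP).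
Qed.
End Principal.

Section ConstantComplex.
Variables (R : pzRingType) (X : lmodType R) (d : {linear X -> X}).
Hypothesis dd : forall x, d (d x) = 0.

Definition cst_d (i j : int) : {linear X -> X} := if j + 1 == i then d else \0.

Lemma cst_d_shape i j : j + 1 != i -> forall x, cst_d i j x = 0.
Proof. by rewrite /cst_d => /negPf ->. Qed.

Lemma cst_dd i j k x : cst_d j k (cst_d i j x) = 0.
Proof. by rewrite /cst_d; case: eqP => // _; case: eqP => _ //; rewrite linear0. Qed.

(** One differential module repeated in every degree: any short exact sequence
    or any single module occurs in such a complex, without case distinctions on
    the degree. *)
Definition cst_complex : complex R :=
  @Complex R (fun _ => X) cst_d cst_d_shape cst_dd.

Lemma cst_acyclic : (forall x, d x = 0 -> exists y, d y = x) ->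
  acyclic (forget cst_complex).
Proof.
move=> ex i x /=; rewrite /cst_d subrK eqxx => /ex[y yx].
by exists y; rewrite eqxx.
Qed.
End ConstantComplex.

Lemma zero_dd (R : pzRingType) (X : lmodType R) (x : X) :
  (\0 : {linear X -> X}) ((\0 : {linear X -> X}) x) = 0.
Proof. by []. Qed.

Lemma pure_projective_regular (R : pzRingType) :
  (forall P : complex R, (forall i, pure_projective (P i)) -> semi_projective P) ->
  von_neumann_regular R.
Proof.
move=> h a; apply: cyclic_quot_projective.
have [|pP _] := h (cst_complex (@zero_dd R (cyclic_quot a))); last exact: (pP 0).
by move=> i L M N f g [_ hA]; apply: hA; apply: cyclic_quot_fp.
Qed.

Lemma pair_ext (S T : Type) (u v : S * T) : u.1 = v.1 -> u.2 = v.2 -> u = v.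
Proof. by case: u v => [? ?] [? ?] /= -> ->. Qed.

(** The sum of the terms of ker q -> R -> R/Ra, with the two maps as
    differential, is an acyclic differential module, and R/Ra is a direct summand
    of its cycles. *)
Lemma acyclic_pure_regular (R : pzRingType) :
  (forall M : complex R, acyclic (forget M) -> pure_acyclic M) ->
  von_neumann_regular R.
Proof.
move=> h a; pose q := cyclic_pi a; pose L : lmodType R := ker q.
pose X : lmodType R := (L * R^o * cyclic_quot a)%type.
have comb0 (V : lmodType R) (b : R) : 0 = b *: 0 + 0 :> V by rewrite scaler0 addr0.
have dlin : linear (fun x : X => ((0, ker_incl q x.1.1), q x.1.2) : X).
  move=> b x y; apply: pair_ext; last exact: (linearP q b x.1.2 y.1.2).
  apply: pair_ext; first exact: (comb0 L b).
  exact: (linearP (ker_incl q) b x.1.1 y.1.1).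
pose d := mklin dlin.
have dE x : d x = ((0, ker_incl q x.1.1), q x.1.2) by apply: mklinE.
have [injq exq sq] := ker_exact (@quot_pi_surj _ _ (principal a)).
have dd x : d (d x) = 0.
  rewrite !dE linear0; have -> : q (ker_incl q x.1.1) = 0 by apply/exq; exists x.1.1.
  by [].
have exd x : d x = 0 -> exists y, d y = x.
  case: x => [[l m] n]; rewrite dE => -[/= e /exq[l' l'm]].
  have [m' m'n] := sq n; exists ((l', m'), 0).
  have l0 : l = 0 by apply: injq; rewrite linear0.
  by rewrite dE l0; congr ((_, _), _).
have [_ /(_ 0)[_ pX]] := h _ (@cst_acyclic _ _ _ dd exd).
have jlin : linear (fun n : cyclic_quot a => ((0, 0), n) : X).
  move=> b x y; apply: pair_ext => //.
  by apply: pair_ext; [exact: (comb0 L b) | exact: (comb0 R^o b)].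
have j0 n : cx_d (cst_complex dd) (0 - 1) (0 - 1 - 1) (mklin jlin n) = 0.
  by rewrite /= /cst_d subrK eqxx dE mklinE /= !linear0.
have [_ _ /(_ (corestr j0))[s sE]] := pX _ (cyclic_quot_fp a).
have slin : linear (fun n => (s n : X).1.2) by move=> b x y; rewrite linearP.
apply: (@cyclic_split _ _ (mklin slin)) => n; rewrite (mklinE slin).
have := congr1 (fun k : {linear cyclic_quot a -> _} => (ker_val (k n) : X).2) sE.
rewrite -[LHS]/((cst_d d 0 (0 - 1) (s n)).2) -[RHS]/((mklin jlin n : X).2) (mklinE jlin).
by rewrite /cst_d subrK eqxx dE.
Qed.

(** The product [(a r, y) |-> a r y] is a pairing of aR and R/Ra with values in
    R/aRa. It sends [a (x) 1] to the class of [a], and flatness makes that tensor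
    vanish because it does so in R (x) R/Ra. *)
Lemma flat_regular (R : pzRingType) :
  (forall F : complex R, semi_flat F) -> von_neumann_regular R.
Proof.
move=> h a; have [/(_ 0) flatF _] := h (cst_complex (@zero_dd R (cyclic_quot a))).
pose A := principal (R := R^c) a.
have [injF _ _] := flatF _ _ _ _ _ (sub_quot_exact A).
have aA : A (a : R^c) by exists 1; rewrite mul1r.
pose u := sub_mk aA; pose q := cyclic_pi a.
have t0 : ptensor u (q 1) = 0.
  apply: injF; rewrite raddf0 /= tensor_mapE sub_mkE.
  have -> : ptensor (a : (R^c)^o) (q 1) = ptensor (1 : (R^c)^o) (q (a *: (1 : R^o))).
    by rewrite linearZ -ptensorZ; congr (ptensor _ _); apply/esym/mulr1.
  have -> : q (a *: (1 : R^o)) = 0; last exact: ptensor0r.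
  by apply/cyclic_pi_eq0; exists 1; rewrite mul1r; apply: mulr1.
have @Y : subgroup R.
  exists (fun x => exists r, x = a * r * a); first by exists 0; rewrite mulr0 mul0r.
  by move=> _ _ [r ->] [s ->]; exists (r - s); rewrite mulrBr mulrBl.
pose b (x : sub_of A) (y : cyclic_quot a) : zquot Y := zpi Y ((sub_incl x : R) * (repr y : R)).
have bE x (y : R) : b x (q y) = zpi Y ((sub_incl x : R) * y).
  have [r xr] := sub_inclP x; apply/zpi_eq; rewrite -mulrBr.
  have /cyclic_pi_eq0[s ->] : q ((repr (q y) : R) - y) = 0.
    by rewrite linearB [q (repr _)]quot_piK subrr.
  have xr' : (sub_incl x : R) = a * (r : R) := xr.
  by exists ((r : R) * s); rewrite xr' !mulrA.
have sq y : exists x, q x = y by apply: quot_pi_surj.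
have bDl x x' y : b (x + x') y = b x y + b x' y.
  by rewrite /b linearD mulrDl raddfD.
have bDr x y y' : b x (y + y') = b x y + b x y'.
  have [[z <-] [z' <-]] := (sq y, sq y').
  by rewrite -linearD !bE mulrDr raddfD.
have bZ x (c : R) y : b ((c : R^c) *: x) y = b x (c *: y).
  by have [z <-] := sq y; rewrite -linearZ !bE linearZ /= mulrA.
have := tensor_liftE bDl bDr bZ u (q 1).
have := raddf0 (mkadd (tensor_lift_is_zmod_morphism bDl bDr bZ)).
rewrite /= mkaddE t0 => -> ; rewrite bE => /esym/zpi_eq0[r].
by rewrite sub_mkE mulr1 => e; exists r.
Qed.

(** * Extending partial functions transfinitely *)

Section ZornExtend.
Variables (D A B : Type).
Variables (X : (D -> Prop) -> A -> Prop) (Good : (D -> Prop) -> (A -> B) -> Prop).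

Definition cover (C : (D -> Prop) * (A -> B) -> Prop) : D -> Prop :=
  fun d => exists2 c, C c & c.1 d.

Definition extends (c c' : (D -> Prop) * (A -> B)) : Prop :=
  (forall d, c.1 d -> c'.1 d) /\ (forall a, X c.1 a -> c'.2 a = c.2 a).

Hypothesis X_mono : forall I I' : D -> Prop,
  (forall d, I d -> I' d) -> forall a, X I a -> X I' a.
Hypothesis Good_cover : forall C : (D -> Prop) * (A -> B) -> Prop,
  (exists c, C c) -> (forall c, C c -> Good c.1 c.2) ->
  (forall c c', C c -> C c' -> extends c c' \/ extends c' c) ->
  forall f : A -> B, (forall c, C c -> forall a, X c.1 a -> f a = c.2 a) ->
  exists2 f', Good (cover C) f' & forall a, X (cover C) a -> f' a = f a.

(** Zorn for partial functions [A -> B] whose domain [X I] depends on an index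
    set [I], the order being extension. The index set rather than the domain is
    maximal, since enlarging it need not enlarge the domain. Functions are
    total, with irrelevant values outside their domain; the union of a chain may
    therefore be modified there to meet [Good]. *)
Lemma zorn_extend (I0 : D -> Prop) (f0 : A -> B) : Good I0 f0 ->
  exists I f, [/\ Good I f, extends (I0, f0) (I, f) &
    forall I' f', Good I' f' -> extends (I, f) (I', f') -> forall d, I' d -> I d].
Proof.
move=> good0.
pose T := {c : (D -> Prop) * (A -> B) | Good c.1 c.2 /\ extends (I0, f0) c}.
have ext_refl c : extends c c by [].
have ext_trans c1 c2 c3 : extends c1 c2 -> extends c2 c3 -> extends c1 c3.
  move=> [h1 e1] [h2 e2]; split=> [d /h1/h2 //|a a1].
  by rewrite -e1 // e2 //; apply: X_mono a1.
pose t0 : T := exist _ (I0, f0) (conj good0 (ext_refl (I0, f0))).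
have [|||[[I f] [/= gI eI]] maxI] := @ZL_preorder T t0 (fun s t => `[< extends (sval s) (sval t) >]).
- by move=> t; apply/asboolP.
- by move=> r s t /asboolP rs /asboolP st; apply/asboolP/(ext_trans _ (sval s)).
- move=> C totC; have [[t Ct]|C0] := pselect (exists t, C t); last first.
    by exists t0 => s Cs; case: C0; exists s.
  pose C' c := exists2 s, C s & sval s = c.
  have C'tot c c' : C' c -> C' c' -> extends c c' \/ extends c' c.
    by move=> [s Cs <-] [s' Cs' <-]; have [/asboolP|/asboolP] := totC _ _ Cs Cs'; [left|right].
  have C'ne : exists c, C' c by exists (sval t), t.
  have ex a : exists b, forall c, C' c -> X c.1 a -> b = c.2 a.
    have [[c C'c ca]|no] := pselect (exists2 c, C' c & X c.1 a).
      exists (c.2 a) => c' C'c' c'a.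
      by have [[_ e]|[_ e]] := C'tot _ _ C'c C'c'; rewrite e.
    by exists (f0 a) => c C'c ca; case: no; exists c.
  have [f fP] := choice ex.
  have [|f' gf' f'f] := Good_cover C'ne _ C'tot (fun c C'c a => fP a c C'c).
    by move=> _ [s _ <-]; have [] := svalP s.
  have ub c : C' c -> extends c (cover C', f').
    move=> C'c; split=> [d cd|a ca]; first by exists c.
    rewrite /= f'f; first exact: fP.
    by apply: X_mono ca => d cd; exists c.
  have e0 : extends (I0, f0) (cover C', f').
    by apply: (ext_trans _ (sval t)); [have [] := svalP t | apply: ub; exists t].
  exists (exist _ (cover C', f') (conj gf' e0)) => s Cs; apply/asboolP.
  by apply: ub; exists s.
exists I, f; split=> // I' f' g' e'.
have e0 : extends (I0, f0) (I', f') by apply: ext_trans e'.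
have := maxI (exist _ (I', f') (conj g' e0)).
by move=> /(_ (introT (asboolP _) e'))/asboolP[].
Qed.
End ZornExtend.

(** * Divisible abelian groups *)

Definition divisible (D : zmodType) : Prop :=
  forall (n : nat) (d : D), (0 < n)%N -> exists e, e *+ n = d.

Section Divisible.
Variables (V D : zmodType).

Definition partial_hom (I : V -> Prop) (f : V -> D) : Prop :=
  I 0 /\ forall x y, I x -> I y -> I (x - y) /\ f (x - y) = f x - f y.

Lemma partial_hom0 I f : partial_hom I f -> f 0 = 0.
Proof. by move=> [I0 IB]; rewrite -(subrr 0) (IB 0 0 I0 I0).2 subrr. Qed.

Lemma partial_homN I f x : partial_hom I f -> I x -> I (- x) /\ f (- x) = - f x.
Proof.
move=> hf Ix; have [I0 IB] := hf; have [] := IB _ _ I0 Ix.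
by rewrite (partial_hom0 hf) !sub0r.
Qed.

Lemma partial_homD I f x y : partial_hom I f -> I x -> I y ->
  I (x + y) /\ f (x + y) = f x + f y.
Proof.
move=> hf Ix Iy; have [INy fNy] := partial_homN hf Iy.
by have [] := hf.2 _ _ Ix INy; rewrite fNy !opprK.
Qed.

Lemma partial_homMn I f x n : partial_hom I f -> I x ->
  I (x *+ n) /\ f (x *+ n) = f x *+ n.
Proof.
move=> hf Ix; elim: n => [|n [IH1 IH2]].
  by rewrite !mulr0n (partial_hom0 hf); split=> //; have [] := hf.
by rewrite !mulrS -IH2; apply: partial_homD.
Qed.

Lemma partial_homMz I f x k : partial_hom I f -> I x ->
  I (x *~ k) /\ f (x *~ k) = f x *~ k.
Proof.
move=> hf Ix; case: k => n; rewrite -?pmulrn ?NegzE -?nmulrn //.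
  exact: partial_homMn.
have [h1 h2] := partial_homMn n.+1 hf Ix; rewrite -h2; exact: partial_homN.
Qed.

Lemma partial_hom_abs I f x k : partial_hom I f -> I (x *~ k) -> I (x *+ `|k|%N).
Proof.
move=> hf; case: k => n; rewrite ?NegzE -?nmulrn -?pmulrn // => Ik.
by have [] := partial_homN hf Ik; rewrite opprK.
Qed.

Lemma partial_hom_adjoin I f (x : V) (d : D) : partial_hom I f ->
  (forall k : int, I (x *~ k) -> f (x *~ k) = d *~ k) ->
  exists I' f', [/\ partial_hom I' f', forall y, I y -> I' y /\ f' y = f y, I' x & f' x = d].
Proof.
move=> hf hd; have [I0 IB] := hf.
pose h z v := exists y (k : int), [/\ I y, z = y + x *~ k & v = f y + d *~ k].
have huniq z v v' : h z v -> h z v' -> v = v'.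
  move=> [y [k [Iy -> ->]]] [y' [k' [Iy' e ->]]].
  have e' : x *~ (k' - k) = y - y'.
    by apply/eqP; rewrite mulrzBr subr_eq addrAC eq_sym subr_eq e addrC.
  have [Iyy fyy] := IB _ _ Iy Iy'.
  have := hd (k' - k); rewrite e' fyy => /(_ Iyy)/eqP.
  by rewrite mulrzBr eq_sym subr_eq addrAC eq_sym subr_eq => /eqP ->; rewrite addrC.
pose I' z := exists v, h z v.
have ex z : exists v, I' z -> h z v.
  by have [[v hv]|no] := pselect (I' z); [exists v | exists 0].
have [f' f'P] := choice ex.
have f'E z v : h z v -> f' z = v.
  by move=> hv; have /f'P hz : I' z; [exists v | apply: huniq hz hv].
have h0 y : I y -> h y (f y) by move=> Iy; exists y, 0; rewrite !mulr0z !addr0.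
have hx : h x d by exists 0, 1; rewrite (partial_hom0 hf) !mulr1z !add0r.
exists I', f'; split.
- split; first by exists (f 0); apply: h0.
  move=> z z' [v hv] [v' hv']; rewrite (f'E _ _ hv) (f'E _ _ hv').
  have hB : h (z - z') (v - v').
    move: hv hv' => [y [k [Iy -> ->]]] [y' [k' [Iy' -> ->]]].
    have [Iyy fyy] := IB _ _ Iy Iy'.
    exists (y - y'), (k - k'); split=> //; first by rewrite mulrzBr opprD addrACA.
    by rewrite fyy mulrzBr opprD addrACA.
  by split; [exists (v - v') | apply: f'E].
- by move=> y /h0 hy; split; [exists (f y) | apply: f'E].
- by exists d.
- exact: f'E.
Qed.

Hypothesis divD : divisible D.

(** The multiples of [x] in the domain are the multiples of the least positive
    one, [n x], if there is any; divide the value at [n x] by [n]. *)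
Lemma partial_hom_value I f (x : V) : partial_hom I f ->
  exists d, forall k : int, I (x *~ k) -> f (x *~ k) = d *~ k.
Proof.
move=> hf.
have [[n0 n0P]|no] := pselect (exists n : nat, (0 < n)%N && `[< I (x *+ n) >]); last first.
  exists 0 => k; have [->|k0] := eqVneq k 0.
    by rewrite !mulr0z (partial_hom0 hf).
  move=> Ik; case: no; exists `|k|%N; rewrite absz_gt0 k0 /=; apply/asboolP.
  exact: partial_hom_abs hf Ik.
have exn : exists n : nat, (0 < n)%N && `[< I (x *+ n) >] by exists n0.
have [n /andP[n_gt0 /asboolP In] nmin] := ex_minnP exn.
have [d dn] := divD (f (x *+ n)) n_gt0; exists d => k Ik.
have kE : k = (k %/ n)%Z * n + (k %% n)%Z by apply: divz_eq.
have n0' : n%:Z != 0 by rewrite -lt0n in n_gt0 *; case: n n_gt0 {In nmin dn kE}.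
have [Iq fq] := partial_homMz (k %/ n)%Z hf In.
have r_ge0 := modz_ge0 k n0'.
have r0 : (k %% n)%Z = 0.
  have Ir : I (x *~ (k %% n)%Z).
    have [INq _] := partial_homN hf Iq; have [] := partial_homD hf Ik INq.
    by rewrite {1}kE mulrzDr mulrC mulrzA pmulrn addrAC subrr add0r.
  move: r_ge0 Ir (ltz_mod k n0'); case: (k %% n)%Z => // r _ Ir; rewrite ltz_nat => rn.
  case: r Ir rn => // r Ir rn; have := nmin r.+1.
  by rewrite ltnS /= => /(_ (introT (asboolP _) Ir)); rewrite leqNgt rn.
by rewrite kE r0 addr0 mulrC !mulrzA -!pmulrn fq dn.
Qed.

(** Zorn: a maximal partial extension is total, since divisibility always
    provides a value at one more element. *)
Lemma divisible_extend (Y : subgroup V) (f : V -> D) :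
  (forall x y, Y x -> Y y -> f (x - y) = f x - f y) ->
  exists g : {additive V -> D}, forall x, Y x -> g x = f x.
Proof.
move=> fY; pose X (I : V -> Prop) := I.
have [|||I [g [hg [/= YI gf] maxI]]] := @zorn_extend V V D X partial_hom _ _ (sg_mem Y) f.
- by move=> I I' II' a; apply: II'.
- move=> C [c0 C0] hom tot g gC; exists g => //; split.
    by exists c0 => //; have [] := hom _ C0.
  move=> x y [c Cc cx] [c' Cc' c'y].
  have [c2 [C2 x2 y2]] : exists c2, [/\ C c2, c2.1 x & c2.1 y].
    have [[h _]|[h _]] := tot _ _ Cc Cc'; [exists c' | exists c]; split=> //; exact: h.
  have [_ /(_ x y x2 y2)[xy2 e]] := hom _ C2.
  split; first by exists c2.
  by rewrite !(gC c2).
- by split=> [|x y hx hy]; [apply: sg0 | split; [apply: sgB | apply: fY]].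
have total x : I x.
  have [d hd] := partial_hom_value x hg.
  have [I' [g' [hg' II' I'x _]]] := partial_hom_adjoin hg hd.
  by apply: (maxI I' g') => //; split=> y /II'[].
exists (mkadd (fun x y => (hg.2 x y (total x) (total y)).2)) => x Yx.
by rewrite mkaddE gf.
Qed.
End Divisible.

Definition int_subgroup : subgroup rat.
Proof.
apply: (@Subgroup rat (fun x => exists n : int, x = n%:~R)); first by exists 0.
by move=> _ _ [n ->] [m ->]; exists (n - m); rewrite rmorphB.
Defined.

Definition ratmodz : zmodType := zquot int_subgroup.

Lemma ratmodz_divisible : divisible ratmodz.
Proof.
move=> n d n_gt0; have [x <-] := zpi_surj d.
exists (zpi int_subgroup (x / n%:R)); rewrite -raddfMn -(mulr_natr (x / _)) divfK //.
by rewrite Num.Theory.pnatr_eq0 -lt0n.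
Qed.

(** Send [v] to 1/n if [v] has finite order [n], and to 1/2 otherwise. *)
Lemma ratmodz_cogenerator (V : zmodType) (v : V) : v != 0 ->
  exists g : {additive V -> ratmodz}, g v != 0.
Proof.
move=> v0; pose f (x : V) : ratmodz := 0.
pose I x := x = 0 :> V.
have hf : partial_hom I f.
  by split=> // _ _ -> ->; rewrite /I /f !subr0.
have [d d0 hd] : exists2 d : ratmodz, d != 0 & forall k : int, I (v *~ k) -> f (v *~ k) = d *~ k.
  have inv_n (n : nat) : (1 < n)%N -> zpi int_subgroup n%:R^-1 != 0.
    move=> n1; apply/eqP => /zpi_eq0[m mE].
    have n0 : n%:R != 0 :> rat by rewrite Num.Theory.pnatr_eq0; lia.
    have : (m * n)%:~R = 1%:~R :> rat by rewrite intrM -mE mulVf.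
    move=> /intr_inj/(congr1 absz)/eqP; rewrite abszM muln_eq1 => /andP[_] /=; lia.
  have [[n0 n0P]|no] := pselect (exists n : nat, (0 < n)%N && (v *+ n == 0)).
    have exn : exists n : nat, (0 < n)%N && (v *+ n == 0) by exists n0.
    have [n /andP[n_gt0 /eqP vn] nmin] := ex_minnP exn.
    have n1 : (1 < n)%N by case: n n_gt0 vn {nmin} => [//|[|//]] _; rewrite mulr1n => /eqP; rewrite (negPf v0).
    exists (zpi int_subgroup n%:R^-1); first exact: inv_n.
    have n0' : n%:Z != 0 by lia.
    move=> k vk; have r_ge0 := modz_ge0 k n0'.
    have kE : k = (k %/ n)%Z * n + (k %% n)%Z by apply: divz_eq.
    have r0 : (k %% n)%Z = 0.
      move: vk; rewrite /I {1}kE mulrzDr mulrC mulrzA -pmulrn vn mul0rz add0r.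
      move: r_ge0 (ltz_mod k n0'); case: (k %% n)%Z => // r _; rewrite ltz_nat => rn.
      case: r rn => // r rn; rewrite -pmulrn => /eqP vr.
      by have := nmin r.+1; rewrite vr /= => /(_ isT); rewrite leqNgt rn.
    rewrite -[LHS]/(0 : ratmodz) kE r0 addr0 mulrC mulrzA -pmulrn -raddfMn -(mulr_natr _^-1) mulVf.
      have -> : zpi int_subgroup 1 = 0 by apply/zpi_eq0; exists 1.
      by rewrite mul0rz.
    by rewrite Num.Theory.pnatr_eq0; lia.
  exists (zpi int_subgroup 2%:R^-1); first exact: inv_n.
  move=> k vk; have [->|k0] := eqVneq k 0; first by rewrite mulr0z.
  case: no; exists `|k|%N; rewrite absz_gt0 k0 /=; apply/eqP.
  exact: (partial_hom_abs hf vk).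
have [I' [f' [[I'0 hB] _ I'v f'v]]] := partial_hom_adjoin hf hd.
pose Y := Subgroup I'0 (fun x y hx hy => (hB x y hx hy).1).
have [g gP] := divisible_extend ratmodz_divisible (Y := Y) (fun x y hx hy => (hB x y hx hy).2).
by exists g; rewrite gP // f'v.
Qed.

(** * Character modules of cyclic modules *)

Section DualModule.
Variables (R : pzRingType) (a : R) (D : zmodType).

(** The additive maps from R/aR to D, as maps on R; the right multiplication of R
    on R/aR becomes a left action. *)
Record dual_mod : Type := DualMod {
  dual_fun :> R -> D;
  dual_add : zmod_morphism dual_fun;
  dual_ann : forall x, dual_fun (a * x) = 0 }.

HB.instance Definition _ := gen_eqMixin dual_mod.
HB.instance Definition _ := gen_choiceMixin dual_mod.

Lemma dual_ext (e e' : dual_mod) : (forall x, e x = e' x) -> e = e'.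
Proof.
case: e e' => [e eD eA] [e' e'D e'A] /= /funext ee'; subst e'.
by congr DualMod; apply: Prop_irrelevance.
Qed.

Lemma dual_ann1 (e : dual_mod) : e a = 0.
Proof. by have := dual_ann e 1; rewrite mulr1. Qed.

Definition dual0 : dual_mod.
Proof.
refine (@DualMod (fun => 0) _ _).
- by move=> x y; rewrite subr0.
- by [].
Defined.
Definition dualD (e e' : dual_mod) : dual_mod.
Proof.
refine (@DualMod (fun x => e x + e' x) _ _).
- by move=> x y; rewrite !dual_add opprD addrACA.
- by move=> x; rewrite !dual_ann addr0.
Defined.
Definition dualN (e : dual_mod) : dual_mod.
Proof.
refine (@DualMod (fun x => - e x) _ _).
- by move=> x y; rewrite dual_add opprD.
- by move=> x; rewrite dual_ann oppr0.
Defined.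

Lemma dualDA : associative dualD.
Proof. by move=> e f g; apply: dual_ext => x; apply: addrA. Qed.
Lemma dualDC : commutative dualD.
Proof. by move=> e f; apply: dual_ext => x; apply: addrC. Qed.
Lemma dual0D : left_id dual0 dualD.
Proof. by move=> e; apply: dual_ext => x; apply: add0r. Qed.
Lemma dualND : left_inverse dual0 dualN dualD.
Proof. by move=> e; apply: dual_ext => x; apply: addNr. Qed.
HB.instance Definition _ := GRing.isZmodule.Build dual_mod dualDA dualDC dual0D dualND.

Lemma dual_addD (e : dual_mod) x y : e (x + y) = e x + e y.
Proof.
have e0 : e 0 = 0 by rewrite -(subrr (0 : R)) dual_add subrr.
have -> : x + y = x - (0 - y) by rewrite opprB subr0.
by rewrite !dual_add e0 sub0r opprK.
Qed.

Definition dualZ (r : R) (e : dual_mod) : dual_mod.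
Proof.
refine (@DualMod (fun x => e (x * r)) _ _).
- by move=> x y; rewrite mulrBl dual_add.
- by move=> x; rewrite -mulrA dual_ann.
Defined.

Lemma dualZA r s e : dualZ r (dualZ s e) = dualZ (r * s) e.
Proof. by apply: dual_ext => x; rewrite /= mulrA. Qed.
Lemma dualZ1 : left_id 1 dualZ.
Proof. by move=> e; apply: dual_ext => x; rewrite /= mulr1. Qed.
Lemma dualZDr : right_distributive dualZ +%R.
Proof. by move=> r e f; apply: dual_ext. Qed.
Lemma dualZDl e : {morph dualZ^~ e : r s / r + s}.
Proof. by move=> r s; apply: dual_ext => x; rewrite /= mulrDr dual_addD. Qed.
HB.instance Definition _ := GRing.Zmodule_isLmodule.Build R dual_mod
  dualZA dualZ1 dualZDr dualZDl.

Section Hom.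
Variables (L : lmodType R) (chi : {additive L -> D}).
Hypothesis chi_ann : forall l, chi (a *: l) = 0.

Definition dual_hom_fun (l : L) : dual_mod.
Proof.
refine (@DualMod (fun x => chi (x *: l)) _ _).
- by move=> x y; rewrite scalerBl raddfB.
- by move=> x; rewrite -scalerA chi_ann.
Defined.

Lemma dual_hom_linear : linear dual_hom_fun.
Proof.
move=> r l l'; apply: dual_ext => x.
by rewrite -[RHS]/(chi ((x * r) *: l) + chi (x *: l')) /= scalerDr scalerA raddfD.
Qed.

Definition dual_hom : {linear L -> dual_mod} := mklin dual_hom_linear.

Lemma dual_homE l x : dual_hom l x = chi (x *: l).
Proof. by rewrite /dual_hom mklinE. Qed.
End Hom.

(** A homomorphism into the character module is a character vanishing on the
    multiples of [a]; purity against R/Ra says that the multiples of [a] inside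
    the submodule are multiples within it, so the character extends. *)
Lemma dual_pure_injective : divisible D -> pure_injective (dual_mod : lmodType R).
Proof.
move=> divD L M N f g [fg pfg]; apply: hom_pre_exact => // h.
have [injf exf sg] := fg.
have pure l m : f l = a *: m -> exists l', l = a *: l'.
  move=> flm.
  have [|||k kP] := @linear_choice _ (cyclic_quot a) N
    (fun u v => exists2 x, cyclic_pi a x = u & v = (x : R) *: g m).
  - by move=> u; have [x <-] := quot_pi_surj u; exists ((x : R) *: g m), x.
  - move=> u v v' [x <- ->] [x' e ->]; apply/eqP; rewrite -subr_eq0 -scalerBl.
    have /cyclic_pi_eq0[r ->] : cyclic_pi a (x - x') = 0 by rewrite linearB e subrr.
    by rewrite -scalerA -linearZ -flm; apply/eqP; have -> : g (f l) = 0 by [apply/exf; exists l]; rewrite scaler0.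
  - move=> b _ _ _ _ [x <- ->] [x' <- ->]; exists (b *: x + x'); first exact: linearP.
    by rewrite scalerDl -scalerA.
  have [_ _ /(_ k)[k' k'E]] := pfg _ (cyclic_quot_fp a).
  pose m' := k' (cyclic_pi a 1).
  have gm' : g m' = g m.
    have -> : g m' = k (cyclic_pi a 1) by rewrite -k'E.
    have [x e ->] := kP (cyclic_pi a 1); apply/eqP; rewrite -subr_eq0.
    have /cyclic_pi_eq0[r rE] : cyclic_pi a (x - 1) = 0 by rewrite linearB e subrr.
    rewrite -[X in _ - X]scale1r -scalerBl rE -scalerA -linearZ -flm.
    by have -> : g (f l) = 0 by [apply/exf; exists l]; rewrite scaler0.
  have am' : a *: m' = 0.
    rewrite /m' -!linearZ; have -> : cyclic_pi a (a *: (1 : R^o)) = 0; last by rewrite linear0.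
    by apply/cyclic_pi_eq0; exists 1; rewrite mul1r; apply: mulr1.
  have /exf[l' l'E] : g (m - m') = 0 by rewrite linearB gm' subrr.
  by exists l'; apply: injf; rewrite flm linearZ /= l'E scalerBr am' subr0.
pose chi l := (h l : R -> D) 1.
have chiB l l' : chi (l - l') = chi l - chi l' by rewrite /chi linearB.
have chi_ann l : chi (a *: l) = 0.
  by rewrite /chi linearZ -[LHS]/((h l : R -> D) (1 * a)) mul1r dual_ann1.
have @Y : subgroup M.
  apply: (@Subgroup M (fun z => exists l m, z = f l + a *: m)).
    by exists 0, 0; rewrite linear0 scaler0 addr0.
  move=> _ _ [l [m ->]] [l' [m' ->]]; exists (l - l'), (m - m').
  by rewrite linearB scalerBr opprD addrACA.
have ex z : exists v, forall l m, z = f l + a *: m -> v = chi l.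
  have [[l [m zE]]|no] := pselect (Y z); last by exists 0 => l m zE; case: no; exists l, m.
  exists (chi l) => l' m' e; apply/eqP; rewrite -subr_eq0 -chiB.
  have [|l'' ->] := pure (l - l') (m' - m); last by rewrite chi_ann.
  rewrite linearB scalerBr; apply/eqP; rewrite subr_eq addrAC eq_sym subr_eq.
  by rewrite addrC -e zE.
have [v vP] := choice ex.
have vE l m : v (f l + a *: m) = chi l by apply: vP.
have [|c cP] := divisible_extend divD (Y := Y) (f := v).
  move=> _ _ [l [m ->]] [l' [m' ->]].
  by rewrite opprD addrACA -linearB -scalerBr !vE.
have c_ann m : c (a *: m) = 0.
  rewrite cP; last by exists 0, m; rewrite linear0 add0r.
  by rewrite -[a *: m]add0r -(linear0 f) vE /chi linear0.
exists (dual_hom c_ann) => l; apply: dual_ext => x; rewrite dual_homE -linearZ.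
rewrite cP; last by exists (x *: l), 0; rewrite scaler0 addr0.
rewrite -[f _]addr0 -(scaler0 _ a) vE /chi linearZ.
by rewrite -[LHS]/((h l : R -> D) (1 * x)) mul1r.
Qed.
End DualModule.

(** Let [phi] be a character of R/aRa. Sending [u] in Ra to [y |-> phi (y u)] is a
    linear map into the characters of R/aR. If it extends to R, with value [e] at
    1, then [phi a] is the value of [a e] at 1, which is [e a = 0]. *)
Lemma pure_injective_regular (R : pzRingType) :
  (forall E : complex R, (forall i, pure_injective (E i)) -> semi_injective E) ->
  von_neumann_regular R.
Proof.
move=> h a; apply: contrapT => na.
have @Y : subgroup R.
  apply: (@Subgroup R (fun x => exists r, x = a * r * a)); first by exists 0; rewrite mulr0 mul0r.
  by move=> _ _ [r ->] [s ->]; exists (r - s); rewrite mulrBr mulrBl.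
have /ratmodz_cogenerator[phi phi_a] : zpi Y a != 0.
  by apply/eqP => /zpi_eq0.
pose E : lmodType R := dual_mod a ratmodz.
have [|iE _] := h (cst_complex (@zero_dd R E)).
  by move=> i; apply: dual_pure_injective; apply: ratmodz_divisible.
pose psi (u : sub_of (principal a)) : ratmodz := phi (zpi Y (sub_incl u : R)).
have psiB : zmod_morphism psi by move=> u u'; rewrite /psi linearB !raddfB.
have psi_ann u : mkadd psiB (a *: u) = 0.
  have [r uE] := sub_inclP u; rewrite mkaddE /psi linearZ uE.
  have -> : zpi Y (a *: (r * a : R^o)) = 0; last by rewrite raddf0.
  by apply/zpi_eq0; exists r; rewrite -mulrA.
have [v vE] := injective_extend_sub (dual_hom psi_ann) (iE 0).
have aP : principal a (a : R^o) by exists 1; rewrite mul1r.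
have := congr1 (fun e : E => (e : R -> ratmodz) 1) (vE (sub_mk aP)).
rewrite dual_homE mkaddE /psi scale1r !sub_mkE => e; move: phi_a; rewrite -e.
have -> : v (a : R^o) = a *: v (1 : R^o) by rewrite -linearZ; congr (v _); apply/esym/mulr1.
rewrite -[X in X != 0]/((v (1 : R^o) : R -> ratmodz) (1 * a)) mul1r dual_ann1.
by rewrite eqxx.
Qed.

(** * From complexes to differential modules *)

(** The ungraded form of the vanishing of the homology of a Hom complex. *)
Definition null_homotopic_maps (R : pzRingType) (X Y : lmodType R)
    (dX : {linear X -> X}) (dY : {linear Y -> Y}) : Prop :=
  forall f : {linear X -> Y}, (forall x, dY (f x) = f (dX x)) ->
  exists g : {linear X -> Y}, forall x, dY (g x) + g (dX x) = f x.

Section Totalization.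
Variables (R : pzRingType) (L : complex R).

Definition sum_d0 : {linear dsum L -> dsum L} :=
  dlift (fun i => dinj L (i - 1) \o cx_d L i (i - 1) : {linear L i -> dsum L}).

Lemma sum_d0_inj i i' x : i' + 1 = i -> sum_d0 (dinj L i x) = dinj L i' (cx_d L i i' x).
Proof.
move=> e; have ei' : i' = i - 1 by rewrite -e addrK.
by subst i'; rewrite /sum_d0 dliftE.
Qed.

Lemma sum_d0_proj k l : dproj L k (sum_d0 l) = cx_d L (k + 1) k (dproj L (k + 1) l).
Proof.
apply: (@dsum_lin_ext _ _ _ _ (dproj L k \o sum_d0) (cx_d L (k + 1) k \o dproj L (k + 1))).
move=> i x /=; have [e|ne] := eqVneq (k + 1) i.
  by subst i; rewrite (@sum_d0_inj (k + 1) k) // !dproj_inj.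
rewrite (@sum_d0_inj i (i - 1)) ?subrK // !dproj_inj0 ?linear0 //; first by rewrite eq_sym.
by apply: contraNneq ne => <-; rewrite subrK.
Qed.

Lemma sum_d0_dd l : sum_d0 (sum_d0 l) = 0.
Proof. by apply: dsum_ext => k; rewrite !sum_d0_proj cx_dd linear0. Qed.

Variable s : int.
Hypothesis ss : s * s = 1.

Lemma sum_d_linear : linear (fun l => sum_d0 l *~ s).
Proof. by move=> a x y; rewrite linearP mulrzDl scalerMzr. Qed.

Definition sum_d : {linear dsum L -> dsum L} := mklin sum_d_linear.

Lemma sum_dE l : sum_d l = sum_d0 l *~ s. Proof. exact: mklinE. Qed.

Lemma sum_dd l : sum_d (sum_d l) = 0.
Proof. by rewrite !sum_dE raddfMz /= sum_d0_dd !mul0rz. Qed.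

Lemma sum_d_acyclic : acyclic (forget L) ->
  forall l, sum_d l = 0 -> exists m, sum_d m = l.
Proof.
move=> acL l dl.
have d0l : sum_d0 l = 0.
  by move: dl; rewrite sum_dE => /(congr1 (fun u => u *~ s)); rewrite -mulrzA ss mul0rz.
have dk k k' : k' + 1 = k -> cx_d L k k' (dproj L k l) = 0.
  by move=> <-; rewrite -sum_d0_proj d0l linear0.
have ex k : exists y : L (k + 1), cx_d L (k + 1) k y = dproj L k l.
  by apply: (@acyclic_at _ _ acL _ k (k - 1)); rewrite ?subrK //; apply: dk; rewrite subrK.
pose y k := sval (cid (ex k)).
have yE k : cx_d L (k + 1) k (y k) = dproj L k l by apply: (svalP (cid (ex k))).
have [t [ut ht]] := dsum_supp l.
exists ((\sum_(k <- t) dinj L (k + 1) (y k)) *~ s).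
rewrite sum_dE raddfMz /= -mulrzA ss mulr1z linear_sum [RHS](dsumE ut ht).
by apply: eq_bigr => k _; rewrite (@sum_d0_inj _ k) // yE.
Qed.
End Totalization.

Section ProductTotalization.
Variables (R : pzRingType) (M : complex R).

Lemma prod_d_linear :
  linear (fun m : prodf M => (fun j => cx_d M (j + 1) j (m (j + 1))) : prodf M).
Proof. by move=> a x y; apply: prodf_ext => j; rewrite !prodfE linearP. Qed.

Definition prod_d : {linear prodf M -> prodf M} := mklin prod_d_linear.

Lemma prod_dE m j : prod_d m j = cx_d M (j + 1) j (m (j + 1)).
Proof. by rewrite /prod_d mklinE. Qed.

Lemma prod_dd m : prod_d (prod_d m) = 0.
Proof. by apply: prodf_ext => j; rewrite !prod_dE cx_dd. Qed.

Lemma prod_d_acyclic : acyclic (forget M) ->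
  forall m, prod_d m = 0 -> exists n, prod_d n = m.
Proof.
move=> acM m dm.
have dk k k' : k' + 1 = k -> cx_d M k k' (m k) = 0.
  by move=> <-; rewrite -prod_dE dm.
have ex i : exists y : M i, forall i', i' + 1 = i -> cx_d M i i' y = m i'.
  have [|||y yE] := @acyclic_at _ _ acM i (i - 1) (i - 1 - 1) _ _ (m (i - 1)).
  - exact: subrK.
  - exact: subrK.
  - by apply: dk; rewrite subrK.
  by exists y => i' e; have -> : i' = i - 1 by rewrite -e addrK.
pose y i := sval (cid (ex i)).
exists (y : prodf M); apply: prodf_ext => j; rewrite prod_dE.
exact: (svalP (cid (ex (j + 1)))).
Qed.
End ProductTotalization.

Section Transfer.
Variables (R : pzRingType) (L M : complex R).

(** The sign in the differential of Hom in degree [n] is moved into the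
    differential of the source. Conversely, the part of degree [n + 1] of an
    ungraded homotopy is a homotopy. *)
Lemma hom_complex_acyclic :
  (forall s : int, s * s = 1 -> null_homotopic_maps (sum_d L s) (prod_d M)) ->
  acyclic (hom_complex L M).
Proof.
move=> H n f /= df; pose s : int := (-1) ^+ `|n|%N.
have ss : s * s = 1 by rewrite -expr2 sqrr_sign.
have fP i j x : cx_d M (j + 1) j (hom_val f i (j + 1) x)
    = hom_val f (i - 1) j (cx_d L i (i - 1) x) *~ s.
  have := congr1 (fun u => hom_val u i j) df; rewrite /= subrK eqxx.
  move=> /(congr1 (fun k : {linear L i -> M j} => k x)).
  by rewrite hom_d_valE => /eqP; rewrite subr_eq0 => /eqP.
have hom_out i j : j != i + n -> hom_val f i j = 0.
  by have := hom_valP f; rewrite unfold_in => /asboolP/(_ i j).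
have flin i : linear (fun x : L i => (fun j => hom_val f i j x) : prodf M).
  by move=> a x y; apply: prodf_ext => j; rewrite prodfE linearP.
pose F := dlift (fun i => mklin (flin i)).
have FE i x j : F (dinj L i x) j = hom_val f i j x by rewrite /F dliftE mklinE.
have [|g gE] := H s ss F.
  apply: (@dsum_lin_ext _ _ _ _ (prod_d M \o F) (F \o sum_d L s)) => i x /=.
  apply: prodf_ext => j; rewrite prod_dE FE fP sum_dE raddfMz /=.
  rewrite (@sum_d0_inj _ _ i (i - 1)) ?subrK // -(FE (i - 1)).
  by rewrite prodfMz.
have glin i j : linear (fun x : L i => g (dinj L i x) j).
  by move=> a x y; rewrite !linearP prodfE.
pose G : bifamily (fun i j => {linear L i -> M j}) := fun i j =>
  if j == i + (n + 1) then mklin (glin i j) else 0.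
have GP : G \in hom_deg (n + 1).
  by rewrite unfold_in; apply/asboolP => i j ij; rewrite /G (negPf ij).
exists (HomPart GP); apply: val_inj => /=; rewrite eqxx.
apply: bifamily_ext => i j; apply: linear_ext => x; rewrite hom_d_valE /G.
have e1 : (j + 1 == i + (n + 1)) = (j == i + n) by lia.
have e2 : (j == i - 1 + (n + 1)) = (j == i + n) by lia.
rewrite e1 e2; have [ji|ji] := boolP (j == i + n); last first.
  by rewrite hom_out // !lin0E linear0 mul0rz subr0.
rewrite (mklinE (glin i (j + 1))) (mklinE (glin (i - 1) j)) -prod_dE -(@sign_succ n (n + 1)) // mulrNz opprK -/s.
have := congr1 (fun m : prodf M => m j) (gE (dinj L i x)); rewrite FE => <-.
rewrite sum_dE raddfMz /= (@sum_d0_inj _ _ i (i - 1)) ?subrK //.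
by rewrite -[RHS]/(_ + _) prodfMz.
Qed.
End Transfer.

(** * Differential modules: homotopies on submodules *)

Section Homotopy.
Variables (R : pzRingType) (P Y : lmodType R) (dY : {linear Y -> Y}).
Hypothesis dY_dd : forall y, dY (dY y) = 0.

Definition homotopy_on (d : {linear P -> P}) (S : P -> Prop) (f g : {linear P -> Y}) : Prop :=
  forall x, S x -> dY (g x) + g (d x) = f x.

Definition acyclic_on (d : {linear P -> P}) (S : P -> Prop) : Prop :=
  forall f : {linear P -> Y}, (forall x, S x -> dY (f x) = f (d x)) ->
  exists g : {linear P -> Y}, homotopy_on d S f g.

(** Changing a homotopy [u] on [S'] by a boundary makes it agree with a given
    homotopy [s] on [S]: the difference anticommutes with the differentials,
    hence is a boundary for the opposite differential. *)
Lemma extend_homotopy (d : {linear P -> P}) (S S' : P -> Prop) (f s u : {linear P -> Y}) :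
  (forall x, d (d x) = 0) -> (forall x, S x -> S' x) -> (forall x, S x -> S (d x)) ->
  acyclic_on (\- d) S -> homotopy_on d S' f u -> homotopy_on d S f s ->
  exists2 s' : {linear P -> Y}, homotopy_on d S' f s' & forall x, S x -> s' x = s x.
Proof.
move=> dd SS' Sd acS hu hs.
have [|v hv] := acS (u \- s : {linear P -> Y}).
  move=> x Sx /=; rewrite linearB !linearN /=.
  have -> : dY (u x) = dY (s x) + s (d x) - u (d x).
    by rewrite (hs x Sx) -(hu x (SS' x Sx)) addrK.
  by rewrite addrAC [dY (s x) + _]addrC addrK opprK addrC.
exists (u \- ((dY \o v) \- (v \o d)) : {linear P -> Y}) => x Sx /=.
  rewrite dd linear0 subr0 !linearB /= dY_dd oppr0 add0r opprK addrACA subrr addr0.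
  exact: hu.
by have /= := hv x Sx; rewrite linearN /= => ->; rewrite opprB addrC subrK.
Qed.
End Homotopy.

Section FreeHomotopy.
Variables (R : pzRingType) (B : eqType) (Y : lmodType R) (dY : {linear Y -> Y}).
Hypothesis vR : von_neumann_regular R.
Hypothesis dY_dd : forall y, dY (dY y) = 0.
Hypothesis dY_ex : forall y, dY y = 0 -> exists z, dY z = y.

Local Notation F := (fmod R B).
Local Notation e := (fbase R).

Lemma cycle_lift (h : {linear F -> Y}) : (forall x, dY (h x) = 0) ->
  exists g : {linear F -> Y}, forall x, dY (g x) = h x.
Proof. by move=> h0; apply: lifts_free => x; apply: dY_ex. Qed.

(** The boundaries of [span l] are finitely generated, so they are a summand [q]
    of the free module, and they lift back into [span l]. *)
Lemma boundary_section (d : {linear F -> F}) (l : seq F) :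
  exists q t : {linear F -> F}, [/\ forall x, span [seq d y | y <- l] (q x),
    forall x, span [seq d y | y <- l] x -> q x = x,
    forall x, span l (t x) & forall x, d (t x) = q x].
Proof.
have [p [pl p1]] := split_span vR (free_coords R B) l.
have [q [ql q1]] := split_span vR (free_coords R B) [seq d x | x <- l].
have [|t0 t0E] := @lifts_free R B F F (d \o p : {linear F -> F}) q.
  by move=> x; have [y yl <-] := span_map_ex (ql x); exists y; rewrite /= p1.
exists q, (p \o t0 : {linear F -> F}); by split=> // x; apply: pl.
Qed.

(** With [q] and [t] from [boundary_section], [z = 1 - t d] projects [span l] onto
    its cycles. A homotopy on the cycles is a lift [g0] of [f z]; on the
    complement, the image of [t], the failure of [g0] is a cycle in [Y] and is
    lifted by [h]. *)
Lemma span_acyclic_on (d : {linear F -> F}) (l : seq F) :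
  (forall x, d (d x) = 0) -> (forall x, span l x -> span l (d x)) ->
  acyclic_on dY d (span l).
Proof.
move=> dd ld f fd.
have [p [pl p1]] := split_span vR (free_coords R B) l.
have [q [t [ql q1 tl dt]]] := boundary_section d l.
have qd x : span l x -> q (d x) = d x by move=> xl; apply/q1/span_map.
pose z : {linear F -> F} := p \- (t \o (d \o p)).
have zE x : z x = p x - t (d (p x)) by [].
have zl x : span l (z x) by rewrite zE; apply: smB.
have dz x : d (z x) = 0 by rewrite zE linearB dt qd ?subrr //; apply: pl.
have z1 x : span l x -> d x = 0 -> z x = x.
  by move=> xl dx; rewrite zE p1 // dx linear0 subr0.
have [|g0 g0E] := @cycle_lift (f \o z : {linear F -> Y}).
  by move=> x; rewrite -[LHS]/(dY (f (z x))) fd // dz linear0.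
have qdl x : span l (q x).
  by have [y yl <-] := span_map_ex (ql x); apply: ld.
have dq x : d (q x) = 0.
  by have [y yl <-] := span_map_ex (ql x); apply: dd.
have [|h hE] := @cycle_lift ((f \o t) \- (g0 \o q) : {linear F -> Y}).
  move=> x; rewrite -[LHS]/(dY (f (t x) - g0 (q x))) linearB fd // dt.
  have -> : dY (g0 (q x)) = f (q x) by rewrite g0E -[LHS]/(f (z (q x))) z1.
  by rewrite subrr.
exists ((g0 \o z) \+ (h \o (d \o p)) : {linear F -> Y}) => x xl.
rewrite -[LHS]/(dY (g0 (z x) + h (d (p x))) + (g0 (z (d x)) + h (d (p (d x))))).
have dxl := ld x xl.
rewrite [in g0 (z (d x))]z1 // [p (d x)]p1 // dd linear0 addr0 p1 //.
have -> : dY (g0 (z x) + h (d x)) = f (z x) + (f (t (d x)) - g0 (d x)).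
  by rewrite linearD g0E hE -[LHS]/(f (z (z x)) + (f (t (d x)) - g0 (q (d x)))) qd // z1.
rewrite addrA subrK -linearD.
by rewrite zE p1 // subrK.
Qed.

Section Countable.
Variables (d : {linear F -> F}) (f : {linear F -> Y}).
Hypothesis dd : forall x, d (d x) = 0.
Hypothesis fd : forall x, dY (f x) = f (d x).

(** The finite sets [L n] are obtained from [b0] by adding supports of
    differentials. They exhaust [C], and compatible homotopies on the finitely
    generated stable submodules [W n] are found one after the other. *)
Lemma countable_homotopy (b0 : B) : exists (C : B -> Prop) (g : {linear F -> Y}),
  [/\ C b0, forall b c, C b -> fcoord c (d (e b)) != 0 -> C c &
      forall b, C b -> dY (g (e b)) + g (d (e b)) = f (e b)].
Proof.
have ex b : exists l : seq B, forall k, k \notin l -> fcoord k (d (e b)) = 0.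
  by have [l [_ hl]] := fcoord_supp (d (e b)); exists l.
have [supp suppP] := choice ex.
pose L n := iter n (fun l => l ++ flatten [seq supp b | b <- l]) [:: b0].
have LS n : {subset L n <= L n.+1} by move=> b bL; rewrite /= mem_cat bL.
have Lle m n : (m <= n)%N -> {subset L m <= L n}.
  elim: n => [|n IH]; first by rewrite leqn0 => /eqP ->.
  by rewrite leq_eqVlt => /predU1P[->|/IH mn] // b /mn; apply: LS.
have Ld n b k : b \in L n -> fcoord k (d (e b)) != 0 -> k \in L n.+1.
  move=> bL kb; rewrite /= mem_cat; apply/orP; right.
  apply/flattenP; exists (supp b); first exact: map_f.
  by apply: contraNT kb => /suppP ->.
pose E n := [seq e b | b <- L n].
(* E n alone need not span a stable submodule. *)
pose W n := E n ++ [seq d x | x <- E n].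
have Wd n x : span (W n) x -> span (W n) (d x).
  apply: (span_min (Y := preim_sm d (span (W n)))) => y.
  rewrite mem_cat => /orP[yE|/mapP[y' _ ->]] /=.
    by apply: span_mem; rewrite mem_cat map_f ?orbT.
  by rewrite dd; apply: (sm0 (span _)).
have WS n x : span (W n) x -> span (W n.+1) x.
  apply: span_sub => y; rewrite !mem_cat => /orP[/mapP[b bL ->]|/mapP[_ /mapP[b bL ->] ->]].
    by rewrite map_f //; apply: LS.
  by rewrite [X in _ || X]map_f ?orbT // map_f //; apply: LS.
have [g0 g0P] := @span_acyclic_on d (W 0) dd (Wd 0) f (fun x _ => fd x).
pose st := {ng : nat * {linear F -> Y} | homotopy_on dY d (span (W ng.1)) f ng.2}.
pose rel (s s' : st) := (sval s').1 = (sval s).1.+1 /\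
  forall x, span (W (sval s).1) x -> (sval s').2 x = (sval s).2 x.
have step s : {s' | rel s s'}.
  apply: cid; case: s => [[n g] /= gP].
  have [u uP] := @span_acyclic_on d (W n.+1) dd (Wd n.+1) f (fun x _ => fd x).
  have acN : acyclic_on dY (\- d) (span (W n)).
    apply: span_acyclic_on => x /=; first by rewrite linearN opprK.
    by move=> /Wd; apply: smN.
  have [g' g'P g'g] := extend_homotopy dY_dd dd (@WS n) (@Wd n) acN uP gP.
  by exists (exist _ (n.+1, g') g'P).
have [s [s0 sS]] := dependent_choice step (exist _ (0%N, g0) g0P).
have sn n : (sval (s n)).1 = n by elim: n => [|n IH]; [rewrite s0 | rewrite (sS n).1 IH].
pose g n := (sval (s n)).2.
have gP n : homotopy_on dY d (span (W n)) f (g n).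
  by have := svalP (s n); rewrite sn.
have WLe m n x : (m <= n)%N -> span (W m) x -> span (W n) x.
  elim: n => [|n IH]; first by rewrite leqn0 => /eqP ->.
  by rewrite leq_eqVlt => /predU1P[->|/IH mn] // /mn; apply: WS.
have gle m n x : (m <= n)%N -> span (W m) x -> g n x = g m x.
  elim: n => [|n IH]; first by rewrite leqn0 => /eqP ->.
  rewrite leq_eqVlt => /predU1P[->|mn] // xm; rewrite -(IH mn xm).
  by have [_] := sS n; rewrite sn; apply; apply: WLe xm.
pose C b := exists n, b \in L n.
have exv b : exists v, forall n, b \in L n -> g n (e b) = v.
  have [[n bn]|no] := pselect (C b); last by exists 0 => n bn; case: no; exists n.
  have eW m : b \in L m -> span (W m) (e b).
    by move=> bm; apply: span_mem; rewrite mem_cat map_f.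
  exists (g n (e b)) => m bm; case: (leqP m n) => mn.
    by rewrite (gle m n) //; apply: eW.
  by rewrite (gle n m) ?(ltnW mn) //; apply: eW.
have [v vP] := choice exv.
have gv n x : span (E n) x -> flift v x = g n x.
  by apply: span_eq => _ /mapP[b bn ->]; rewrite fliftE (vP b n).
exists C, (flift v); split.
- by exists 0%N; rewrite inE.
- by move=> b c [n bn] /(Ld n b c bn) cn; exists n.+1.
move=> b [n bn]; have bn1 := LS n b bn.
have eE : span (E n.+1) (e b) by apply/span_mem/map_f.
have dE : span (E n.+1) (d (e b)).
  have [t [ut ht]] := fcoord_supp (d (e b)).
  rewrite (fmodE ut ht); apply: (@sm_sum _ _ (span _)) => k _.
  have [->|kb] := eqVneq (fcoord k (d (e b))) 0.
    by rewrite scale0r; apply: (sm0 (span _)).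
  by apply: (@smZ _ _ (span _)); apply/span_mem/map_f/(Ld n b).
rewrite !(gv n.+1) //; apply: gP; apply: span_mem.
by rewrite mem_cat map_f.
Qed.
End Countable.

Lemma flift_eq (V : lmodType R) (s s' : B -> V) (x : F) :
  (forall k, fcoord k x != 0 -> s k = s' k) -> flift s x = flift s' x.
Proof.
move=> h; have [t [ut ht]] := fcoord_supp x.
rewrite (fmodE ut ht) !linear_sum; apply: eq_bigr => k _ /=.
rewrite !linearZ /= !fliftE; have [->|/h -> //] := eqVneq (fcoord k x) 0.
by rewrite !scale0r.
Qed.

(** Take a maximal homotopy [s] defined on the basis elements of a stable set
    [S]. Killing [S] leaves a free differential module, with differential [p d],
    on which the defect [f'] of [s] is a commuting map; a homotopy for [f'] on a
    countable stable set containing a new basis element extends [s]. *)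
Lemma free_null_homotopic (d : {linear F -> F}) :
  (forall x, d (d x) = 0) -> null_homotopic_maps d dY.
Proof.
move=> dd f fd.
pose Good (S : B -> Prop) (s : B -> Y) :=
  (forall b c, S b -> fcoord c (d (e b)) != 0 -> S c) /\
  (forall b, S b -> dY (flift s (e b)) + flift s (d (e b)) = f (e b)).
have [|||S [s [[Sd sS] _ maxS]]] :=
  @zorn_extend B B Y id Good _ _ (fun _ => False) (fun _ => 0).
- by move=> I I' II' b; apply: II'.
- move=> C [c0 C0] good tot g gC; exists g => //; split=> [b k [c Cc cb] kb|b [c Cc cb]].
    by exists c => //; have [h _] := good c Cc; apply: h kb.
  have [h <- //] := good c Cc; congr (dY _ + _); last first.
    by apply: flift_eq => k /(h _ _ cb); apply: gC.
  by rewrite !fliftE; apply: gC.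
- by split.
suff total b : S b.
  exists (flift s) => x.
  apply: (@free_lin_ext _ _ _ ((dY \o flift s) \+ (flift s \o d) : {linear F -> Y}) f) => b /=.
  exact: sS.
apply: contrapT => nSb.
pose p : {linear F -> F} := flift (fun b => if `[< S b >] then 0 else e b).
have pS c : S c -> p (e c) = 0 by move=> Sc; rewrite fliftE asboolT.
have pN c : ~ S c -> p (e c) = e c by move=> Sc; rewrite fliftE asboolF.
have p0 x : (forall k, fcoord k x != 0 -> S k) -> p x = 0.
  move=> h; have -> : p x = flift (fun _ => 0) x.
    by apply: flift_eq => k /h Sk; rewrite asboolT.
  apply: (@free_lin_ext _ _ _ (flift _) (\0 : {linear F -> F})) => k.
  by rewrite fliftE.
have pcoord k x : ~ S k -> fcoord k (p x) = fcoord k x.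
  move=> Sk; apply: (@free_lin_ext _ _ _ (fcoord k \o p) (fcoord k)) => c /=.
  have [Sc|/pN -> //] := pselect (S c); rewrite pS // linear0 fcoord_base.
  by case: eqP => // ck; case: Sk; rewrite -ck.
have pd x : p (d (p x)) = p (d x).
  apply: (@free_lin_ext _ _ _ (p \o (d \o p)) (p \o d)) => c /=.
  have [Sc|/pN -> //] := pselect (S c); rewrite pS // !linear0.
  by rewrite p0 // => k; apply: Sd.
pose dQ : {linear F -> F} := p \o d.
have dQdQ x : dQ (dQ x) = 0 by rewrite /dQ /= pd dd linear0.
pose s' := flift s; pose f' : {linear F -> Y} := f \- ((dY \o s') \+ (s' \o d)).
have f'E x : f' x = f x - (dY (s' x) + s' (d x)) by [].
have f'S c : S c -> f' (e c) = 0 by move=> Sc; rewrite f'E sS // subrr.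
have f'p x : f' (p x) = f' x.
  apply: (@free_lin_ext _ _ _ (f' \o p) f') => c; rewrite -[LHS]/(f' (p (e c))).
  by have [Sc|/pN -> //] := pselect (S c); rewrite pS // linear0 f'S.
have f'd x : dY (f' x) = f' (dQ x).
  by rewrite -[dQ x]/(p (d x)) f'p !f'E linearB linearD dY_dd add0r dd linear0 addr0 fd.
have [C [g [Cb Cd gC]]] := countable_homotopy dQdQ f'd b.
(* New values only outside S, so that the homotopy s is kept. *)
pose s1 c := if `[< S c >] then s c else s c + g (e c).
have s1E x : flift s1 x = s' x + g (p x).
  apply: (@free_lin_ext _ _ _ (flift s1) (s' \+ (g \o p) : {linear F -> Y})) => c /=.
  rewrite fliftE /s' fliftE /s1; case: asboolP => Sc; first by rewrite pS // linear0 addr0.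
  by rewrite pN.
apply: nSb; apply: (maxS (fun c => S c \/ C c) s1); last by right.
- split=> [c k [Sc|Cc] kc|c SCc].
  + by left; apply: Sd kc.
  + have [Sk|nSk] := pselect (S k); [by left | right].
    by apply: Cd Cc _; rewrite pcoord.
  rewrite !s1E; have [Sc|nSc] := pselect (S c).
    by rewrite pS // [p (d _)]p0 ?linear0 ?addr0 ?sS // => k; apply: Sd.
  have Cc : C c by case: SCc.
  rewrite pN // linearD addrACA (gC c Cc) f'E addrC subrK //.
- split=> c /=; first by left.
  by move=> Sc; rewrite /s1 asboolT.
Qed.
End FreeHomotopy.

(** If [q i = 1] with [q] the free cover, then [i d q] is a differential on the
    free module that makes [P] a retract of it. *)
Lemma lifts_null_homotopic (R : pzRingType) (P Y : lmodType R)
    (d : {linear P -> P}) (dY : {linear Y -> Y}) : von_neumann_regular R ->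
  lifts P -> (forall x, d (d x) = 0) -> (forall y, dY (dY y) = 0) ->
  (forall y, dY y = 0 -> exists z, dY z = y) -> null_homotopic_maps d dY.
Proof.
move=> vR lP dd dYdd exY f fd; pose q := fcover P.
have [|i iq] := lP _ _ q idfun; first by move=> x; exists (fbase R x); apply: fcoverE.
pose d' : {linear fmod R P -> fmod R P} := i \o (d \o q).
have [||g gE] := @free_null_homotopic R P Y dY vR dYdd exY d' _ (f \o q : {linear _ -> Y}).
- by move=> x /=; rewrite iq /= dd linear0.
- by move=> x /=; rewrite iq /= fd.
exists (g \o i : {linear P -> Y}) => x /=.
have := gE (i x); rewrite /= !iq /= => <-.
by [].
Qed.

Lemma regular_semi_projective (R : pzRingType) : von_neumann_regular R ->
  forall P : complex R, (forall i, pure_projective (P i)) -> semi_projective P.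
Proof.
move=> vR P ppP.
have pP i : projective (P i).
  by move=> L M N f g fg; apply: ppP; apply: exact_pure.
split=> // M acM; apply: hom_complex_acyclic => s ss.
apply: lifts_null_homotopic => //.
- by apply: lifts_dsum => i; apply: projective_lifts.
- exact: sum_dd.
- exact: prod_dd.
- exact: prod_d_acyclic.
Qed.

Local Open Scope fset_scope.
Local Open Scope ring_scope.

(** * Unions of directed families of acyclic submodules *)

(** Baer-type injectivity, for functions that are linear on a submodule only. *)
Definition extendable (R : pzRingType) (E : lmodType R) : Prop :=
  forall (U : lmodType R) (Y : submodule U) (v : U -> E),
  (forall a x y, Y x -> Y y -> v (a *: x + y) = a *: v x + v y) ->
  exists v' : {linear U -> E}, forall x, Y x -> v' x = v x.

Section DirectedUnion.
Variables (R : pzRingType) (P E : lmodType R) (dE : {linear E -> E}).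
Hypothesis dE_dd : forall y, dE (dE y) = 0.
Hypothesis extE : extendable E.
Variables (D : choiceType) (X : {fset D} -> submodule P).
Hypothesis X_mono : forall A A' : {fset D}, {subset A <= A'} ->
  forall x, X A x -> X A' x.

Definition funion (S : D -> Prop) (x : P) : Prop :=
  exists2 A : {fset D}, (forall a, a \in A -> S a) & X A x.

Lemma funion_mono (S S' : D -> Prop) : (forall a, S a -> S' a) ->
  forall x, funion S x -> funion S' x.
Proof. by move=> SS' x [A AS Ax]; exists A => // a /AS/SS'. Qed.

Lemma funion_fset A : funion (fun a => a \in A) = X A.
Proof.
by apply/funext => x; apply/propext; split=> [[B /X_mono BA /BA]|Ax] //; exists A.
Qed.

Lemma funionP S a x y : funion S x -> funion S y -> funion S (a *: x + y).
Proof.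
move=> [A AS Ax] [B BS By]; exists (A `|` B) => [b|].
  by rewrite inE => /orP[/AS|/BS].
by apply: smP; [apply: X_mono Ax | apply: X_mono By] => b bA; rewrite inE bA ?orbT.
Qed.

Lemma funion0 S : funion S 0.
Proof. by exists fset0 => //; apply: sm0. Qed.

Definition funion_sm S : submodule P := Submodule (funion0 S) (@funionP S).

Definition adjoin (S : D -> Prop) (A : {fset D}) : D -> Prop := fun a => S a \/ a \in A.

Variable W : rel D.
Hypothesis woW : well_order W.

Definition below (b a : D) : Prop := W a b /\ a <> b.
Definition down_closed (J : D -> Prop) : Prop := forall a b, J b -> W a b -> J a.

Lemma W_min (S : D -> Prop) : (exists a, S a) ->
  exists2 a, S a & forall b, S b -> W a b.
Proof.
move=> [a0 Sa0]; have [|a [[aS amin] _]] := woW (A := fun a => `[< S a >]).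
  by exists a0; apply/asboolP.
exists a; first exact/asboolP.
by move=> b Sb; apply: amin; apply/asboolP.
Qed.

Lemma W_total a b : W a b \/ W b a.
Proof.
have [|c [->|->] h] := @W_min (fun c => c = a \/ c = b); first by exists a; left.
  by left; apply: h; right.
by right; apply: h; left.
Qed.

Lemma W_anti a b : W a b -> W b a -> a = b.
Proof.
move=> ab ba; have [|c [_ cu]] := woW (A := fun c => (c == a) || (c == b)).
  by exists a; rewrite unfold_in eqxx.
have Wr x : W x x by have [] := W_total x x.
rewrite -(cu a) ?(cu b) //; split; rewrite ?unfold_in ?eqxx ?orbT // => x;
  by rewrite unfold_in => /orP[] /eqP ->.
Qed.

Lemma W_trans a b c : W a b -> W b c -> W a c.
Proof.
move=> ab bc; have [|m mS mmin] := @W_min (fun x => [\/ x = a, x = b | x = c]).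
  by exists a; constructor 1.
have ma := mmin a (Or31 _ _ erefl); have mb := mmin b (Or32 _ _ erefl).
have mc := mmin c (Or33 _ _ erefl).
case: mS ma mb mc => -> ma mb mc //; first by rewrite (W_anti ab ma).
by rewrite -(W_anti bc mb).
Qed.

Lemma below_down b : down_closed (below b).
Proof.
move=> a c [cb ne] ac; split; first exact: W_trans cb.
by move=> e; subst a; apply: ne; apply: W_anti.
Qed.

Section Limit.
Variable d : {linear P -> P}.
Hypothesis dd : forall x, d (d x) = 0.
Hypothesis Xd : forall A x, X A x -> X A (d x).
Hypothesis Xac : forall A, acyclic_on dE d (X A).

Lemma funion_d S x : funion S x -> funion S (d x).
Proof. by move=> [A AS /Xd Ax]; exists A. Qed.

(** A maximal partial homotopy, indexed by an initial segment of [J], is defined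
    on all of [J]: at the least missing index [b] it extends, because both
    [below b], with the finite set [A], and [below b], with [A] and [b], are
    covered by the hypothesis. *)
Lemma limit_acyclic_on (J : D -> Prop) : down_closed J ->
  (forall b, J b -> forall A, acyclic_on dE d (funion (adjoin (below b) A)) /\
                              acyclic_on dE (\- d) (funion (adjoin (below b) A))) ->
  forall A, acyclic_on dE d (funion (adjoin J A)).
Proof.
move=> downJ IH A f fd.
pose XA (I : D -> Prop) := funion (adjoin I A).
have XA_mono (I I' : D -> Prop) : (forall a, I a -> I' a) -> forall x, XA I x -> XA I' x.
  by move=> II'; apply: funion_mono => a [/II' Ia|aA]; [left | right].
pose Good (I : D -> Prop) (g : P -> E) := [/\ down_closed I, forall a, I a -> J a,
  exists gl : {linear P -> E}, forall x, gl x = g x &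
  forall x, XA I x -> dE (g x) + g (d x) = f x].
have XA0 : XA (fun _ => False) = X A.
  by rewrite -funion_fset; congr funion; apply/funext => a; apply/propext; split=> [[]|]; [| | right].
have [|g0 g0P] := @Xac A f.
  move=> x Ax; apply: fd; apply: (@XA_mono (fun _ => False)) => //.
  by rewrite XA0.
have [|||I [g [[downI IJ [gl glE] gP] _ maxI]]] := @zorn_extend D P E XA Good _ _ (fun _ => False) g0.
- exact: XA_mono.
- move=> C [c0 C0] good tot g gC.
  have cov x : XA (cover C) x -> exists2 c, C c & XA c.1 x.
    move=> [B BS Bx].
    have [c Cc cB] : exists2 c, C c & forall b, b \in B -> adjoin c.1 A b.
      have : forall s : seq D, {subset s <= B} ->
          exists2 c, C c & forall b, b \in s -> adjoin c.1 A b.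
        elim=> [_|b s IHs sB]; first by exists c0.
        have [|c Cc cs] := IHs; first by move=> z zs; apply: sB; rewrite inE zs orbT.
        have [[c' Cc' c'b]|bA] := BS b (sB b (mem_head _ _)); last first.
          by exists c => // z; rewrite inE => /predU1P[->|/cs //]; right.
        have [[h _]|[h _]] := tot _ _ Cc Cc'.
          exists c' => // z; rewrite inE => /predU1P[->|/cs[/h|]]; by [left | left | right].
        by exists c => // z; rewrite inE => /predU1P[->|/cs //]; left; apply: h.
      by move=> /(_ (enum_fset B)); apply.
    by exists c => //; exists B.
  have [|g' g'g] := @extE P (funion_sm (adjoin (cover C) A)) g.
    move=> a x y /= Ux Uy.
    have [c [Cc cx cy]] : exists c, [/\ C c, XA c.1 x & XA c.1 y].
      have [[c Cc cx] [c' Cc' c'y]] := (cov x Ux, cov y Uy).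
      have [[h _]|[h _]] := tot _ _ Cc Cc'; [exists c' | exists c]; split=> //.
        by apply: XA_mono cx.
      by apply: XA_mono c'y.
    have [_ _ [gl glE] _] := good c Cc.
    rewrite !(gC c Cc) // -?glE ?linearP //.
    exact: (@funionP (adjoin c.1 A)).
  exists g' => //; split.
  + by move=> a b [c Cc cb] ab; exists c => //; have [h _ _ _] := good c Cc; apply: h cb ab.
  + by move=> a [c Cc ca]; have [_ h _ _] := good c Cc; apply: h.
  + by exists g'.
  move=> x Ux; have [c Cc cx] := cov x Ux; have [_ _ _ <- //] := good c Cc.
  by rewrite !g'g ?(gC c Cc) //; apply: funion_d.
- split=> //; first by exists g0.
  by move=> x; rewrite XA0; apply: g0P.
suff total a : J a -> I a.
  exists gl => x Ux; rewrite !glE; apply: gP; apply: funion_mono Ux => a [/total|]; by [left | right].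
move=> Ja; apply: contrapT => nIa.
have [|b [Jb nIb] bmin] := @W_min (fun b => J b /\ ~ I b); first by exists a.
have Ib : I = below b.
  apply/funext => c; apply/propext; split=> [Ic|[cb ne]].
    have [cb|bc] := W_total c b; last by case: nIb; apply: downI Ic bc.
    by split=> // cb'; subst c.
  apply: contrapT => nIc; apply: ne; apply: (W_anti cb); apply: bmin; split=> //.
  exact: downJ Jb cb.
subst I; pose I' c := below b c \/ c = b.
have XAI' : XA I' = funion (adjoin (below b) (b |` A)).
  congr funion; apply/funext => c; apply/propext; rewrite /adjoin /I' inE in_fset1.
  split=> [[[h|->]|cA]|[h|/orP[/eqP ->|cA]]]; rewrite ?eqxx ?cA ?orbT; by intuition.
have [ac' _] := IH b Jb (b |` A); have [_ acN] := IH b Jb A.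
have I'J c : I' c -> J c by move=> [/IJ|->].
have sub x : XA I' x -> funion (adjoin J A) x.
  by apply: funion_mono => c [/I'J|]; [left | right].
have [|u uP] := ac' f; first by rewrite -XAI' => x /sub; apply: fd.
have BI' x : XA (below b) x -> XA I' x by apply: XA_mono => c; left.
have [||s' s'P s'g] := @extend_homotopy _ _ _ _ dE_dd d (XA (below b)) (XA I') f gl u
    dd BI' (@funion_d _) acN _ _.
- by rewrite XAI'.
- by move=> x Ux; rewrite !glE gP.
apply: nIb; apply: (maxI I' s'); last by right.
- split=> //; last by exists s'.
  move=> x y [hy|->] xy; first by left; apply: below_down hy xy.
  by have [->|ne] := eqVneq x b; [right | left; split=> //; apply/eqP].
- split=> x /=; first by left.
  by move=> Ux; rewrite s'g // glE.
Qed.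
End Limit.
End DirectedUnion.

(** Both signs of the differential are carried through the induction, since
    [extend_homotopy] trades one for the other. *)
Lemma directed_acyclic_on (R : pzRingType) (P E : lmodType R) (dE : {linear E -> E})
    (d : {linear P -> P}) (D : choiceType) (X : {fset D} -> submodule P) :
  (forall y, dE (dE y) = 0) -> extendable E -> (forall x, d (d x) = 0) ->
  (forall A A' : {fset D}, {subset A <= A'} -> forall x, X A x -> X A' x) ->
  (forall A x, X A x -> X A (d x)) ->
  (forall A, acyclic_on dE d (X A)) -> (forall A, acyclic_on dE (\- d) (X A)) ->
  acyclic_on dE d (fun x => exists A, X A x).
Proof.
move=> dEdd extE dd Xm Xd Xac XacN.
have [W woW] := well_ordering_principle D.
have acNN S : acyclic_on dE d S -> acyclic_on dE (\- (\- d : {linear P -> P})) S.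
  move=> ac f fd; have [|g gP] := ac f; first by move=> x /fd ->; rewrite /= opprK.
  by exists g => x Sx /=; rewrite opprK; apply: gP.
have both J : down_closed W J ->
  (forall b, J b -> forall A, acyclic_on dE d (funion X (adjoin (below W b) A)) /\
             acyclic_on dE (\- d) (funion X (adjoin (below W b) A))) ->
  forall A, acyclic_on dE d (funion X (adjoin J A)) /\
            acyclic_on dE (\- d) (funion X (adjoin J A)).
  move=> downJ IH A; split; first exact: (limit_acyclic_on dEdd extE Xm woW dd Xd Xac).
  apply: (limit_acyclic_on dEdd extE Xm woW _ _ XacN) => //.
  - by move=> x /=; rewrite linearN opprK.
  - by move=> B x /Xd; apply: smN.
  - by move=> b Jb B; have [h1 h2] := IH b Jb B; split=> //; apply: acNN.
have all_b b : forall A, acyclic_on dE d (funion X (adjoin (below W b) A)) /\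
             acyclic_on dE (\- d) (funion X (adjoin (below W b) A)).
  apply: contrapT => nb; pose bad b := ~ (forall A,
    acyclic_on dE d (funion X (adjoin (below W b) A)) /\
    acyclic_on dE (\- d) (funion X (adjoin (below W b) A))).
  have [|c cbad cmin] := W_min woW (S := bad); first by exists b.
  apply: cbad; apply: both; first exact: below_down.
  move=> b' [b'c ne]; apply: contrapT => b'bad; apply: ne.
  by apply: (W_anti woW) => //; apply: cmin.
have [|] := both (fun=> True) _ (fun b _ => all_b b) fset0; first by [].
move=> ac _ f fd.
have eqS x : (exists A, X A x) <-> funion X (adjoin (fun=> True) fset0) x.
  by split=> [[A Ax]|[A _ Ax]]; exists A => // a _; left.
have [|g gP] := ac f; first by move=> x /eqS/fd.
by exists g => x /eqS/gP.
Qed.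

(** * Acyclic differential modules mapping to injectives *)

Section AcyclicSubmodules.
Variables (R : pzRingType) (B : eqType) (d : {linear fmod R B -> fmod R B}).
Hypothesis vR : von_neumann_regular R.
Hypothesis dd : forall x, d (d x) = 0.

Local Notation P := (fmod R B).

Definition acyclic_span (l : seq P) : Prop :=
  (forall x, span l x -> span l (d x)) /\
  (forall x, span l x -> d x = 0 -> exists2 y, span l y & d y = x).

Lemma span_cat_map (s : {linear P -> P}) (l : seq P) x :
  span (l ++ [seq s y | y <- l]) x -> exists y z, [/\ span l y, span l z & x = y + s z].
Proof.
have @Y : submodule P.
  exists (fun x => exists y z, [/\ span l y, span l z & x = y + s z]).
    by exists 0, 0; split; [exact: (sm0 (span l)) | exact: (sm0 (span l)) | rewrite linear0 addr0].
  move=> a _ _ [y [z [yl zl ->]]] [y' [z' [yl' zl' ->]]].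
  exists (a *: y + y'), (a *: z + z'); split; [exact: smP | exact: smP |].
  by rewrite linearP scalerDr addrACA.
apply: (span_min (Y := Y)) => w; rewrite mem_cat => /orP[wl|/mapP[z zl ->]].
  exists w, 0; split; [exact: span_mem | exact: (sm0 (span l)) | by rewrite linear0 addr0].
by exists 0, z; split; [exact: (sm0 (span l)) | exact: span_mem | rewrite add0r].
Qed.

Lemma span_catl (l l' : seq P) x : span l x -> span (l ++ l') x.
Proof. by apply: span_sub => y yl; rewrite mem_cat yl. Qed.

Section Closure.
Variable K : submodule P.
Hypothesis Kd : forall x, K x -> K (d x).
Hypothesis Kac : forall x, K x -> d x = 0 -> exists2 y, K y & d y = x.

(** The homology of a finitely generated stable submodule is a direct summand
    of its cycles; adjoining a lift of that summand kills the homology and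
    creates no new cycle. *)
Lemma acyclic_closure (l : seq P) : (forall x, x \in l -> K x) ->
  exists l', [/\ {subset l <= l'}, forall x, x \in l' -> K x & acyclic_span l'].
Proof.
move=> lK; pose m := l ++ [seq d x | x <- l].
have mK x : span m x -> K x.
  apply: span_min => y; rewrite mem_cat => /orP[/lK //|/mapP[z /lK Kz ->]].
  exact: Kd.
have md x : span m x -> span m (d x).
  apply: (span_min (Y := preim_sm d (span m))) => y; rewrite mem_cat.
  case/orP=> [yl|/mapP[z zl ->]] /=; last by rewrite dd; apply: (sm0 (span m)).
  by apply: span_mem; rewrite mem_cat map_f ?orbT.
have [p [pm p1]] := split_span vR (free_coords R B) m.
have [q [t [qm q1 tm dt]]] := boundary_section vR d m.
have qd x : span m x -> q (d x) = d x by move=> xm; apply/q1/span_map.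
have qq x : q (q x) = q x by apply: q1.
have dq x : d (q x) = 0 by rewrite -dt dd.
have qm' x : span m (q x) by rewrite -dt; apply: md.
pose z : {linear P -> P} := p \- (t \o (d \o p)).
have zE x : z x = p x - t (d (p x)) by [].
have zm x : span m (z x) by rewrite zE; apply: smB.
have dz x : d (z x) = 0 by rewrite zE linearB dt qd ?subrr //; apply: pm.
have z1 x : span m x -> d x = 0 -> z x = x.
  by move=> xm dx; rewrite zE p1 // dx linear0 subr0.
(* z projects onto the cycles, q onto the boundaries; h projects onto a
   complement of the boundaries in the cycles. *)
pose h : {linear P -> P} := z \- (q \o z).
have hE x : h x = z x - q (z x) by [].
have hm x : span m (h x) by rewrite hE; apply: smB.
have dh x : d (h x) = 0 by rewrite hE linearB dz dq subrr.
have qh x : q (h x) = 0 by rewrite hE linearB qq subrr.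
have hh x : h (h x) = h x by rewrite [LHS]hE z1 // qh subr0.
have ex b : exists y, K y /\ d y = h (fbase R b).
  by have [y Ky dy] := Kac (mK _ (hm (fbase R b))) (dh _); exists y.
have [s0 s0P] := choice ex.
pose s : {linear P -> P} := flift s0.
have Ks x : K (s x).
  have [u [uu hu]] := fcoord_supp x; rewrite (fmodE uu hu) linear_sum; apply: sm_sum => b _.
  by rewrite linearZ fliftE; apply: smZ; have [] := s0P b.
have ds x : d (s x) = h x.
  apply: (@free_lin_ext _ _ _ (d \o s) h) => b.
  by rewrite -[LHS]/(d (s (fbase R b))) fliftE; have [] := s0P b.
(* Only the lift s of elements h x is adjoined: a combination w then
   contributes nothing once h w = 0. *)
pose sh : {linear P -> P} := s \o h.
have dsh x : d (sh x) = h x by rewrite -[sh x]/(s (h x)) ds hh.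
exists (m ++ [seq sh x | x <- m]); split.
- by move=> x xl; rewrite !mem_cat xl.
- move=> x; rewrite mem_cat => /orP[xm|/mapP[y _ ->]]; last exact: Ks.
  exact/mK/span_mem.
split=> [x|x] /span_cat_map[y [w [ym wm ->]]].
  by apply: span_catl; rewrite linearD dsh; apply: smD; [apply: md | apply: hm].
rewrite linearD dsh => /eqP; rewrite addr_eq0 => /eqP dyhw.
have hw : h w = 0.
  have : q (h w) = h w by apply: q1; rewrite -[h w]opprK -dyhw; apply/smN/span_map.
  by rewrite qh.
have dy : d y = 0 by rewrite dyhw hw oppr0.
rewrite -[sh w]/(s (h w)) hw linear0 addr0.
exists (t y + sh y).
  apply: smD; first exact/span_catl/tm.
  have /span_sub : span [seq sh v | v <- m] (sh y) by apply: span_map.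
  by apply=> v vm; rewrite mem_cat vm orbT.
by rewrite linearD dt dsh hE z1 // addrC subrK.
Qed.
End Closure.

(** With [q] and [t] from [boundary_section], the boundaries being all the
    cycles, [t (1 - t d)] is a contraction of [span l]. *)
Lemma acyclic_span_on (E : lmodType R) (dE : {linear E -> E}) (l : seq P) :
  acyclic_span l -> acyclic_on dE d (span l).
Proof.
move=> [ld lac] f fd; have [q [t [ql q1 tl dt]]] := boundary_section vR d l.
exists (f \o (t \o (idfun \- (t \o d))) : {linear P -> E}) => x xl.
rewrite -[LHS]/(dE (f (t (x - t (d x)))) + f (t (d x - t (d (d x))))).
have zl : span l (x - t (d x)) by apply: smB.
rewrite dd linear0 subr0 fd // dt -linearD; congr (f _).
rewrite q1 ?subrK //.
have [|y yl <-] := lac _ zl; last exact: span_map.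
by rewrite linearB dt q1 ?subrr //; apply: span_map.
Qed.
End AcyclicSubmodules.

Lemma acyclic_spanN (R : pzRingType) (B : eqType) (d : {linear fmod R B -> fmod R B}) l :
  acyclic_span d l -> acyclic_span (\- d) l.
Proof.
move=> [ld lac]; split=> [x xl|x xl /= /eqP]; first exact/smN/ld.
rewrite oppr_eq0 => /eqP /(lac x xl)[y yl <-].
exists (- y); first exact: (@smN _ _ (span l)).
by rewrite /= linearN opprK.
Qed.

Section AcyclicInFree.
Variables (R : pzRingType) (B : eqType) (d : {linear fmod R B -> fmod R B}).
Hypothesis vR : von_neumann_regular R.
Hypothesis dd : forall x, d (d x) = 0.

Local Notation P := (fmod R B).

Variables (E : lmodType R) (dE : {linear E -> E}).
Hypothesis dE_dd : forall y, dE (dE y) = 0.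
Hypothesis extE : extendable E.
Variable K : submodule P.
Hypothesis Kd : forall x, K x -> K (d x).
Hypothesis Kac : forall x, K x -> d x = 0 -> exists2 y, K y & d y = x.

Lemma acyclic_list_ex (l : seq P) : exists l', (forall x, x \in l -> K x) ->
  [/\ {subset l <= l'}, forall x, x \in l' -> K x & acyclic_span d l'].
Proof.
have [lK|no] := pselect (forall x, x \in l -> K x); last by exists [::].
by have [l' hl'] := acyclic_closure vR dd Kd Kac lK; exists l'.
Qed.

Definition acyclic_list (l : seq P) : seq P := sval (cid (acyclic_list_ex l)).

Lemma acyclic_listP l : (forall x, x \in l -> K x) ->
  [/\ {subset l <= acyclic_list l}, forall x, x \in acyclic_list l -> K x & acyclic_span d (acyclic_list l)].
Proof. exact: (svalP (cid (acyclic_list_ex l))). Qed.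

Local Notation D := (sub_of K).

(** By recursion on the size [n] of [A], the generators for the subsets of [A] are
    included, so that the resulting family is monotone. *)
Fixpoint family_gens (n : nat) (A : {fset D}) : seq P :=
  acyclic_list ([seq sub_incl a | a <- enum_fset A] ++
      if n is n'.+1 then flatten [seq family_gens n' (A `\ a) | a <- enum_fset A] else [::]).

Lemma family_gens_spec n A :
  [/\ forall x, x \in family_gens n A -> K x, acyclic_span d (family_gens n A),
      forall a, a \in A -> sub_incl a \in family_gens n A &
      forall n', n = n'.+1 -> forall a, a \in A -> {subset family_gens n' (A `\ a) <= family_gens n A}].
Proof.
elim: n A => [|n IH] A.
  have [|h1 h2 h3] := @acyclic_listP ([seq sub_incl a | a <- enum_fset A] ++ [::]).
    by move=> x; rewrite cats0 => /mapP[a _ ->]; apply: sub_inclP.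
  by split=> // a aA; apply: h1; rewrite cats0 map_f.
have [|h1 h2 h3] := @acyclic_listP ([seq sub_incl a | a <- enum_fset A] ++
    flatten [seq family_gens n (A `\ a) | a <- enum_fset A]).
  move=> x; rewrite mem_cat => /orP[/mapP[a _ ->]|/flattenP[_ /mapP[a _ ->]]].
    exact: sub_inclP.
  by have [+ _ _ _] := IH (A `\ a); apply.
split=> //; first by move=> a aA; apply: h1; rewrite mem_cat map_f.
move=> _ [<-] a aA x xA; apply: h1; rewrite mem_cat; apply/orP; right.
by apply/flattenP; exists (family_gens n (A `\ a)) => //; apply: map_f.
Qed.

Definition acyclic_family (A : {fset D}) : submodule P := span (family_gens #|` A| A).

Lemma acyclic_family_mono (A A' : {fset D}) : {subset A <= A'} -> forall x, acyclic_family A x -> acyclic_family A' x.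
Proof.
have [n] := ubnP #|` A'|; elim: n A' => // n IH A' An sAA' x Ax.
have [/fsubsetP sA'A|/fsubsetPn[a aA' aA]] := boolP (A' `<=` A).
  suff -> : A' = A by [].
  by apply/fsetP => a; apply/idP/idP => [/sA'A|/sAA'].
have cA' : #|` A'| = #|` A' `\ a|.+1 by rewrite (cardfsD1 a) aA'.
have : acyclic_family (A' `\ a) x.
  apply: IH => //; first by rewrite cA' ltnS in An.
  by move=> b bA; rewrite in_fsetD1 sAA' // andbT; apply: contraNneq aA => <-.
by apply: span_sub; have [_ _ _ +] := family_gens_spec #|` A'| A'; apply.
Qed.

Lemma submodule_acyclic_on : acyclic_on dE d K.
Proof.
have fam_spec A := family_gens_spec #|` A| A.
have famK A x : acyclic_family A x -> K x.
  by apply: span_min => y; have [h _ _ _] := fam_spec A; apply: h.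
have ac : acyclic_on dE d (fun x => exists A, acyclic_family A x).
  apply: directed_acyclic_on => //.
  - exact: acyclic_family_mono.
  - by move=> A x; have [_ [h _] _ _] := fam_spec A; apply: h.
  - by move=> A; have [_ h _ _] := fam_spec A; apply: acyclic_span_on.
  - move=> A; have [_ /acyclic_spanN h _ _] := fam_spec A.
    apply: acyclic_span_on => // x /=; by rewrite linearN opprK.
move=> f fd; have [|g gP] := ac f; first by move=> x [A /famK]; apply: fd.
exists g => x Kx; apply: gP; pose a := sub_mk Kx; exists [fset a]; apply: span_mem.
by have [_ _ h _] := fam_spec [fset a]; rewrite -[x](sub_mkE Kx) h // in_fset1.
Qed.
End AcyclicInFree.

Section AcyclicSource.
Variables (R : pzRingType) (X E : lmodType R) (dX : {linear X -> X}) (dE : {linear E -> E}).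
Hypothesis vR : von_neumann_regular R.
Hypothesis dXdX : forall x, dX (dX x) = 0.
Hypothesis acX : forall x, dX x = 0 -> exists y, dX y = x.
Hypothesis dEdE : forall y, dE (dE y) = 0.
Hypothesis extE : extendable E.

(** [P] has a pair of basis elements for each element of [X], the differential
    sending the first to the second; the kernel [K] of its projection onto [X] is
    acyclic. The contraction of [P] gives a homotopy [u] on [P], which
    anticommutes with the differentials on [K], so that a boundary corrects it to
    a homotopy vanishing on [K]. *)
Lemma acyclic_null_homotopic : null_homotopic_maps dX dE.
Proof.
move=> f fd; pose B : eqType := (X * bool)%type; pose P := fmod R B.
pose d : {linear P -> P} := flift (fun b : B => if b.2 then 0 else fbase R (b.1, true)).
pose r : {linear P -> X} := flift (fun b : B => if b.2 then dX b.1 else b.1).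
pose h : {linear P -> P} := flift (fun b : B => if b.2 then fbase R (b.1, false) else 0).
have dE' b : d (fbase R b) = if b.2 then 0 else fbase R (b.1, true) by apply: fliftE.
have rE b : r (fbase R b) = if b.2 then dX b.1 else b.1 by apply: fliftE.
have hE b : h (fbase R b) = if b.2 then fbase R (b.1, false) else 0 by apply: fliftE.
have dd x : d (d x) = 0.
  apply: (@free_lin_ext _ _ _ (d \o d) (\0 : {linear P -> P})) => -[y []].
    by rewrite -[LHS]/(d (d (fbase R (y, true)))) dE' linear0.
  by rewrite -[LHS]/(d (d (fbase R (y, false)))) !dE'.
have rd x : r (d x) = dX (r x).
  apply: (@free_lin_ext _ _ _ (r \o d) (dX \o r)) => -[y []].
    by rewrite -[LHS]/(r (d (fbase R (y, true)))) -[RHS]/(dX (r (fbase R (y, true)))) dE' rE linear0 dXdX.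
  by rewrite -[LHS]/(r (d (fbase R (y, false)))) -[RHS]/(dX (r (fbase R (y, false)))) dE' !rE.
have dh x : d (h x) + h (d x) = x.
  apply: (@free_lin_ext _ _ _ ((d \o h) \+ (h \o d) : {linear P -> P}) idfun) => -[y b].
  rewrite -[LHS]/(d (h (fbase R (y, b))) + h (d (fbase R (y, b)))) dE' hE.
  by case: b => /=; rewrite linear0 ?dE' ?hE ?addr0 ?add0r.
have sr y : exists x, r x = y by exists (fbase R (y, false)); rewrite rE.
have @K : submodule P.
  exists (fun x => r x = 0); first exact: linear0.
  by move=> a x y rx ry; rewrite linearP rx ry scaler0 addr0.
have Kd x : K x -> K (d x) by move=> rx; rewrite /K /= rd rx linear0.
have Kac x : K x -> d x = 0 -> exists2 y, K y & d y = x.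
  move=> rx dx; have dhx : d (h x) = x by have := dh x; rewrite dx linear0 addr0.
  have [y yE] : exists y, dX y = r (h x) by apply: acX; rewrite -rd dhx.
  have [w wE] := sr y.
  exists (h x - d w); last by rewrite linearB dd subr0.
  by rewrite /K /= linearB rd wE yE subrr.
have KdN x : K x -> K ((\- d : {linear P -> P}) x) by move=> /Kd; apply: smN.
have KacN x : K x -> (\- d : {linear P -> P}) x = 0 ->
    exists2 y, K y & (\- d : {linear P -> P}) y = x.
  move=> Kx /= /eqP; rewrite oppr_eq0 => /eqP /(Kac x Kx)[y Ky <-].
  by exists (- y); [apply: (@smN _ _ K) | rewrite /= linearN opprK].
have ddN x : (\- d : {linear P -> P}) ((\- d : {linear P -> P}) x) = 0.
  by rewrite /= linearN opprK.
pose u : {linear P -> E} := f \o (r \o h).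
have uE x : u x = f (r (h x)) by [].
have uP x : dE (u x) + u (d x) = f (r x).
  by rewrite !uE fd -rd -!linearD dh.
have [|v vP] := submodule_acyclic_on vR ddN dEdE extE KdN KacN (f := u).
  move=> x rx; have := uP x; rewrite rx linear0 => /eqP; rewrite addr_eq0 => /eqP ->.
  by rewrite -[RHS]/(u (- d x)) linearN.
pose g0 : {linear P -> E} := u \- ((dE \o v) \- (v \o d)).
have g0E x : g0 x = u x - (dE (v x) - v (d x)) by [].
have g0K x : r x = 0 -> g0 x = 0.
  move=> rx; have vx : dE (v x) + v (- d x) = u x := vP x rx.
  by rewrite g0E -vx linearN subrr.
have g0P x : dE (g0 x) + g0 (d x) = f (r x).
  rewrite !g0E dd linear0 subr0 !linearB dEdE -uP.
  by rewrite /= oppr0 add0r opprK addrACA subrr addr0.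
have [|||g gP] := @linear_choice _ X E (fun y z => exists2 x, r x = y & z = g0 x).
- by move=> y; have [x <-] := sr y; exists (g0 x), x.
- move=> y z z' [x rx ->] [x' rx' ->]; apply/eqP; rewrite -subr_eq0 -linearB.
  by rewrite g0K // linearB rx rx' subrr.
- move=> a _ _ _ _ [x <- ->] [x' <- ->]; exists (a *: x + x'); first exact: linearP.
  exact/esym/linearP.
have gr x : g (r x) = g0 x.
  have [x' rx' ->] := gP (r x); apply/eqP; rewrite -subr_eq0 -linearB.
  by rewrite g0K // linearB rx' subrr.
by exists g => y; have [x <-] := sr y; rewrite -rd !gr.
Qed.
End AcyclicSource.

Lemma prodf_extendable (R : pzRingType) (I : eqType) (E : I -> lmodType R) :
  (forall i, injective_module (E i)) -> extendable (prodf E).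
Proof.
move=> iE U Y v vlin.
have ex i : exists w : {linear U -> E i}, forall x, Y x -> w x = v x i.
  by apply: injective_extend => // a x y Yx Yy; rewrite vlin.
pose w i := sval (cid (ex i)).
have wP i x : Y x -> w i x = v x i by apply: (svalP (cid (ex i))).
have wlin : linear (fun x => (fun i => w i x) : prodf E).
  by move=> a x y; apply: prodf_ext => i; rewrite prodfE linearP.
by exists (mklin wlin) => x Yx; rewrite mklinE; apply: prodf_ext => i; apply: wP.
Qed.

Lemma regular_semi_injective (R : pzRingType) : von_neumann_regular R ->
  forall E : complex R, (forall i, pure_injective (E i)) -> semi_injective E.
Proof.
move=> vR E piE.
have iE i : injective_module (E i).
  by move=> L M N f g fg; apply: piE; apply: exact_pure.
split=> // M acM; apply: hom_complex_acyclic => s ss.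
apply: acyclic_null_homotopic => //.
- exact: sum_dd.
- exact: sum_d_acyclic.
- exact: prod_dd.
- exact: prodf_extendable.
Qed.

Theorem mainTheorem1 (R : pzRingType) :
  [<-> von_neumann_regular R;
       forall M : complex R, acyclic (forget M) -> pure_acyclic M;
       forall F : complex R, semi_flat F;
       forall P : complex R,
         (forall i, pure_projective (P i)) -> semi_projective P;
       forall E : complex R,
         (forall i, pure_injective (E i)) -> semi_injective E ].
Proof.
tfae.
- exact: regular_pure_acyclic.
- by move=> /acyclic_pure_regular vR F; apply: regular_semi_flat.
- by move=> /flat_regular; apply: regular_semi_projective.
- by move=> /pure_projective_regular; apply: regular_semi_injective.
- exact: pure_injective_regular.
Qed.
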